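(* Let $\mathfrak g$ be a symmetrizable Kac--Moody superalgebra (as in the context), $\omega$ a consistent conjugate-linear anti-involution of $\mathfrak g$ such that the polarization $\mathfrak g_{\bar1}=(\mathfrak g_{\bar1})_-\oplus(\mathfrak g_{\bar1})_+$ is $\omega$-adapted, and $M$ a highest weight $\mathfrak g$-supermodule. If $M$ is $\omega$-unitarizable, then $M\otimes M(\mathfrak g_{\bar1})$, with the diagonal $\mathfrak g_{\bar0}$-action and the Hermitian form $\langle v\otimes P,w\otimes Q\rangle=\langle v,w\rangle_M\langle P,Q\rangle_{M(\mathfrak g_{\bar1})}$, is an $\omega|_{\mathfrak g_{\bar0}}$-unitarizable $\mathfrak g_{\bar0}$-module.
   Context: Kac--Moody superalgebras: for $I=\{1,\dots,n\}$, an $n\times n$ matrix $A=(a_{ij})$ with $a_{ii}\in\{0,2\}$, a parity function $p:I\to\mathbb Z_2$, and $\mathfrak h$ even of dimension $2n-\operatorname{rk}A$ with linearly independent $\alpha_i\in\mathfrak h^*$, $h_i\in\mathfrak h$, $\alpha_j(h_i)=a_{ij}$, let $\mathfrak g(A)$ be the Lie superalgebra generated by $\mathfrak h$ and $X_i,Y_i$ (parity $p(i)$) with $[h,X_i]=\alpha_i(h)X_i$, $[h,Y_i]=-\alpha_i(h)Y_i$, $[X_i,Y_j]=\delta_{ij}h_i$, $[\mathfrak h,\mathfrak h]=0$, modulo the maximal ideal meeting $\mathfrak h$ trivially. It is a Kac--Moody superalgebra if it is quasisimple (every ideal is contained in $\mathfrak h$ or together with $\mathfrak h$ spans), regular ($a_{ij}=0\Rightarrow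 a_{ji}=0$) and admissible ($a_{ii}=0,p(i)=\bar0\Rightarrow a_{ij}=0\ \forall j$; $a_{ii}=2,p(i)=\bar0\Rightarrow a_{ij}\in\mathbb Z_{\le0}$ for $j\ne i$; $a_{ii}=2,p(i)=\bar1\Rightarrow a_{ij}\in2\mathbb Z_{\le0}$ for $j\neq i$); symmetrizable if $DA$ is symmetric for an invertible diagonal $D=\operatorname{diag}(d_i)$, in which case it has the nondegenerate even supersymmetric invariant standard form $B$ with $B(h,h_j)=d_j\alpha_j(h)$. Standing assumption: $B(\alpha,\beta)\in\mathbb R$ for all simple roots $\alpha,\beta$. Principal grading: $\deg X_i=1$, $\deg Y_i=-1$, $\deg\mathfrak h=0$. Triangular decomposition $\mathfrak g=\mathfrak n^-\oplus\mathfrak h\oplus\mathfrak n^+$, root spaces $\mathfrak g^\alpha$. Weyl vector $\rho\in\mathfrak h^*$: $\rho(h_i)=\tfrac12\alpha_i(h_i)$. The Kac--Peterson class of $\mathfrak g_{\bar0}$ is assumed trivial: there is $\rho_{\bar0}\in\mathfrak h^*$ (extended by zero to root spaces) with $\rho_{\bar0}([x,y])=\tfrac12\operatorname{tr}(\mathrm{ad}_x\pi_-\mathrm{ad}_y\pi_+)-\tfrac12\operatorname{tr}(\mathrm{ad}_y\pi_-\mathrm{ad}_x\pi_+)$ on $\mathfrak g_{\bar0}$, where $\pi_+$, resp. $\pi_-$, is the projection of $\mathfrak g_{\bar0}$ onto its part of positive, resp. nonpositive, principal degree. Put $\rho_{\bar1}=\rho_{\bar0}-\rho$ (extended by zero to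 root spaces). A conjugate-linear anti-involution is a conjugate-linear $\omega:\mathfrak g\to\mathfrak g$ with $\omega^2=\mathrm{id}$, $\omega([x,y])=[\omega(y),\omega(x)]$; consistent means $\omega(\mathfrak g^\alpha)=\mathfrak g^{-\alpha}$ for all roots. Highest weight supermodule of highest weight $\Lambda$: $\mathfrak h$-weight supermodule with finite-dimensional weight spaces generated by a nonzero vector $v_\Lambda$ of weight $\Lambda$ with $\mathfrak n^+v_\Lambda=0$. If $\Lambda(h)=\overline{\Lambda(\omega(h))}$ for all $h\in\mathfrak h$ (assumed), $M$ has a unique Hermitian form $\langle\cdot,\cdot\rangle_M$ with $\langle v_\Lambda,v_\Lambda\rangle_M=1$ and $\langle xv,w\rangle_M=\langle v,\omega(x)w\rangle_M$ for $x\in\mathfrak g$ (contravariant); $M$ is $\omega$-unitarizable if this form is positive definite. A $\mathfrak g_{\bar0}$-module with a given Hermitian form is $\omega|_{\mathfrak g_{\bar0}}$-unitarizable if the form is positive definite and contravariant for $\omega|_{\mathfrak g_{\bar0}}$. Hermitian forms are conjugate-linear in the first argument. Oscillator module: $(\mathfrak g_{\bar1})_\pm=\mathfrak g_{\bar1}\cap\mathfrak n^\pm$, with homogeneous bases $(x_a)$ of $(\mathfrak g_{\bar1})_-$ and $(\partial_a)$ of $(\mathfrak g_{\bar1})_+$ such that $B(\partial_a,x_b)=\tfrac12\delta_{ab}$. The Clifford (Weyl) algebra $\mathrm{Cl}(\mathfrak g_{\bar1})$ (relations $xy-yx=2B(x,y)$) acts on $M(\mathfrak g_{\bar1})=\mathbb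 C[x_1,x_2,\dots]$, $x_a$ by multiplication, $\partial_a$ by $\partial/\partial x_a$; $\langle x^\alpha,x^\beta\rangle_{M(\mathfrak g_{\bar1})}=\delta_{\alpha,\beta}\,\alpha!$ for finitely supported multi-indices. The polarization is $\omega$-adapted of sign $\sigma\in\{\pm1\}$ if such bases can be (and then are) chosen with $\omega(x_a)=\sigma\partial_a$, $\omega(\partial_a)=\sigma x_a$ for all $a$; $\omega$-adapted means $\omega$-adapted of some sign. An element $x\in\mathfrak g_{\bar0}$ acts on $M(\mathfrak g_{\bar1})$ by $\pi(x)=\tfrac12\sum_a{:}[x,x_a]\partial_a{:}-\tfrac12\sum_a{:}[x,\partial_a]x_a{:}-\rho_{\bar1}(x)$, where ${:}\ {:}$ places elements of $(\mathfrak g_{\bar1})_-$ to the left of those of $(\mathfrak g_{\bar1})_+$; the diagonal action is $x(v\otimes P)=xv\otimes P+v\otimes\pi(x)P$.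
   Formalization: The formal theorem additionally assumes that the chosen ρ_1=ρ_0−ρ satisfies ρ_1(h)=conj(ρ_1(ω(h))) on h; since ρ and ρ_0 are not unique, the claim fails for other choices (e.g. sl(2|1), M trivial), and contravariance at v_Λ⊗1 forces this condition. *)

(* Defs.v *)
(* MathComp world; scalars are a numClosedFieldType C, instantiated to R[i]
   with R : realType in the statement. *)
From HB Require Import structures.
From mathcomp Require Import all_boot all_order all_algebra.
From mathcomp Require Import boolp classical_sets fsbigop.
From mathcomp Require Import finmap.
From mathcomp.multinomials Require Import monalg.

Set Implicit Arguments.
Unset Strict Implicit.
Unset Printing Implicit Defensive.

Import Order.TTheory GRing.Theory Num.Theory.

Local Open Scope classical_set_scope.
Local Open Scope ring_scope.

Section LinearAlgebra.
Variables (C : numClosedFieldType) (V : lmodType C).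

Definition subspace (U : set V) : Prop :=
  U 0 /\ forall (a : C) u v, U u -> U v -> U (a *: u + v).

Definition lspan (S : set V) : set V := smallest subspace S.

Definition fin_dim (U : set V) : Prop :=
  exists (r : nat) (b : 'I_r -> V), U `<=` lspan (range b).

Definition lin_indep (I : eqType) (e : I -> V) : Prop :=
  forall (s : seq I) (c : I -> C), uniq s ->
    \sum_(i <- s) c i *: e i = 0 -> forall i, i \in s -> c i = 0.

Definition is_basis (I : eqType) (U : set V) (e : I -> V) : Prop :=
  [/\ forall i, U (e i), lin_indep e & U `<=` lspan (range e)].

(* The trace on U of an endomorphism F of U of finite rank: the trace of the
   restriction of F to a finite-dimensional subspace (with basis b) of U that
   contains F(U). *)
Definition has_trace (U : set V) (F : V -> V) (t : C) : Prop :=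
  exists (r : nat) (b : 'I_r -> V) (m : 'M[C]_r),
    [/\ forall i, U (b i), lin_indep b,
        forall v, U v -> lspan (range b) (F v),
        forall j, F (b j) = \sum_i m i j *: b i
      & t = \tr m].

Definition posdef (f : V -> V -> C) : Prop := forall v, v != 0 -> 0 < f v v.

(* Together the two clauses make f conjugate-linear in its first argument. *)
Definition hermitian_form (f : V -> V -> C) : Prop :=
  (forall u (a : C) v w, f u (a *: v + w) = a * f u v + f u w) /\
  (forall u v, f u v = (f v u)^*).

End LinearAlgebra.

Definition is_tensor (C : numClosedFieldType) (M P T : lmodType C)
    (t : {bilinear M -> P -> T}) : Prop :=
  forall (W : lmodType C) (f : {bilinear M -> P -> W}),
    exists g : {linear T -> W},
      (forall v p, g (t v p) = f v p) /\
      forall g' : {linear T -> W},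
        (forall v p, g' (t v p) = f v p) -> g' =1 g.

(* In Z/2-gradings, false is the even and true the odd degree. *)
Definition is_grading (C : numClosedFieldType) (V : lmodType C)
    (par : bool -> set V) : Prop :=
  [/\ forall p, subspace (par p),
      forall v, exists v0 v1, [/\ par false v0, par true v1 & v = v0 + v1]
    & par false `&` par true `<=` [set 0]].

Record lieSuperalgebra (C : numClosedFieldType) := LieSuperalgebra {
  lie_sort :> lmodType C;
  par : bool -> set lie_sort;
  brk : {bilinear lie_sort -> lie_sort -> lie_sort};
  _ : is_grading par;
  _ : forall p q x y, par p x -> par q y -> par (p (+) q) (brk x y);
  _ : forall p q x y, par p x -> par q y ->
        brk x y = - ((-1) ^+ (p && q) *: brk y x);
  _ : forall p q x y z, par p x -> par q y ->
        brk x (brk y z) = brk (brk x y) z + (-1) ^+ (p && q) *: brk y (brk x z)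
}.

Arguments brk {C l}.

Record superModule (C : numClosedFieldType) (g : lieSuperalgebra C) :=
  SuperModule {
  mod_sort :> lmodType C;
  mpar : bool -> set mod_sort;
  act : {bilinear g -> mod_sort -> mod_sort};
  _ : is_grading mpar;
  _ : forall p q (x : g) (v : mod_sort), par p x -> mpar q v ->
        mpar (p (+) q) (act x v);
  _ : forall p q (x y : g) (v : mod_sort), par p x -> par q y ->
        act (brk x y) v = act x (act y v) - (-1) ^+ (p && q) *: act y (act x v)
}.

Section Ideals.
Variables (C : numClosedFieldType) (g : lieSuperalgebra C).

Definition subalgebra (U : set g) : Prop :=
  subspace U /\ forall x y, U x -> U y -> U (brk x y).

Definition graded_ideal (I : set g) : Prop :=
  [/\ subspace I,
      forall x y, I y -> I (brk x y)
    & forall x0 x1, par false x0 -> par true x1 -> I (x0 + x1) -> I x0 /\ I x1].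

End Ideals.

Section CartanMatrix.
Variables (C : numClosedFieldType) (n : nat) (A : 'M[C]_n) (p : 'I_n -> bool).

Definition regular : Prop := forall i j, A i j = 0 -> A j i = 0.

Definition admissible : Prop :=
  [/\ forall i, A i i = 0 -> p i = false -> forall j, A i j = 0,
      forall i, A i i = 2 -> p i = false ->
        forall j, j != i -> exists k : nat, A i j = - k%:R
    & forall i, A i i = 2 -> p i = true ->
        forall j, j != i -> exists k : nat, A i j = - (k.*2)%:R].

Definition symmetrizable : Prop :=
  exists d : 'rV[C]_n, (forall i, d 0 i != 0) /\
    (diag_mx d *m A)^T = diag_mx d *m A.

End CartanMatrix.

Record realization (C : numClosedFieldType) (n : nat) (A : 'M[C]_n) :=
  Realization {
  cartan :> vectType C;
  sroot : 'I_n -> 'Hom(cartan, C^o);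
  coroot : 'I_n -> cartan;
  _ : (\dim {: cartan} + \rank A = n.*2)%N;
  _ : free [tuple sroot i | i < n];
  _ : free [tuple coroot i | i < n];
  _ : forall i j, sroot j (coroot i) = A i j
}.

(* A Lie superalgebra together with images of the generators, subject to the
   Chevalley relations. *)
Record chevalleyAlg (C : numClosedFieldType) (n : nat) (A : 'M[C]_n)
    (p : 'I_n -> bool) (H : realization A) := ChevalleyAlg {
  calg :> lieSuperalgebra C;
  emb : {linear H -> calg};
  genX : 'I_n -> calg;
  genY : 'I_n -> calg;
  _ : forall h, par false (emb h);
  _ : forall i, par (p i) (genX i);
  _ : forall i, par (p i) (genY i);
  _ : forall h h', brk (emb h) (emb h') = 0;
  _ : forall h i, brk (emb h) (genX i) = (sroot H i h : C) *: genX i;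
  _ : forall h i, brk (emb h) (genY i) = - ((sroot H i h : C) *: genY i);
  _ : forall i j, brk (genX i) (genY j) =
        if i == j then emb (coroot H i) else 0
}.

Section KacMoody.
Variables (C : numClosedFieldType) (n : nat) (A : 'M[C]_n) (p : 'I_n -> bool).
Variable H : realization A.

Definition is_chevalley_hom (g1 g2 : chevalleyAlg p H) (f : {linear g1 -> g2}) :
    Prop :=
  [/\ forall q x, par q x -> par q (f x),
      forall x y, f (brk x y) = brk (f x) (f y),
      forall h, f (emb g1 h) = emb g2 h,
      forall i, f (genX g1 i) = genX g2 i
    & forall i, f (genY g1 i) = genY g2 i].

(* The Lie superalgebra presented by H and the X_i, Y_i with the Chevalley
   relations, containing H as a subspace. *)
Definition is_presented (g : chevalleyAlg p H) : Prop :=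
  [/\ injective (emb g),
      smallest (@subalgebra C g)
        (range (emb g) `|` range (genX g) `|` range (genY g)) = setT
    & forall g' : chevalleyAlg p H,
        exists f : {linear g -> g'}, is_chevalley_hom f].

(* g is g(A): the quotient of the presented superalgebra by its largest ideal
   meeting H trivially. *)
Definition is_contragredient (g : chevalleyAlg p H) : Prop :=
  exists (gt : chevalleyAlg p H) (q : {linear gt -> g}),
    [/\ is_presented gt, is_chevalley_hom q, range q = setT,
        graded_ideal (q @^-1` [set 0]) /\
        q @^-1` [set 0] `&` range (emb gt) `<=` [set 0]
      & forall I : set gt, graded_ideal I ->
          I `&` range (emb gt) `<=` [set 0] -> I `<=` q @^-1` [set 0]].

Variable g : chevalleyAlg p H.

Definition quasisimple : Prop :=
  forall I : set g, graded_ideal I ->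
    I `<=` range (emb g) \/ forall x, exists y h, I y /\ x = y + emb g h.

Definition is_kac_moody : Prop :=
  [/\ forall i, A i i = 0 \/ A i i = 2,
      is_contragredient g, quasisimple, regular A & admissible A p].

Definition root_space (l : 'Hom(H, C^o)) : set g :=
  [set x | forall h, brk (emb g h) x = (l h : C) *: x].

Definition is_root (l : 'Hom(H, C^o)) : Prop :=
  l != 0 /\ exists2 x, root_space l x & x != 0.

Definition nplus : set g := smallest (@subalgebra C g) (range (genX g)).
Definition nminus : set g := smallest (@subalgebra C g) (range (genY g)).
Definition oddplus : set g := par true `&` nplus.
Definition oddminus : set g := par true `&` nminus.

(* The homogeneous components of the principal grading. *)
Inductive pdeg : int -> g -> Prop :=
| PdegX i : pdeg 1 (genX g i)
| PdegY i : pdeg (-1) (genY g i)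
| PdegH h : pdeg 0 (emb g h)
| Pdeg0 k : pdeg k 0
| PdegD k (a : C) x y : pdeg k x -> pdeg k y -> pdeg k (a *: x + y)
| PdegB k l x y : pdeg k x -> pdeg l y -> pdeg (k + l) (brk x y).

Definition pi_plus (x : g) : g :=
  xget 0 [set u | lspan (\bigcup_(k in [set k : int | 0 < k]) pdeg k) u /\
                  lspan (\bigcup_(k in [set k : int | k <= 0]) pdeg k) (x - u)].
Definition pi_minus (x : g) : g := x - pi_plus x.

Definition cartan_part (x : g) : H :=
  xget 0 [set h | lspan (\bigcup_(l in is_root) root_space l) (x - emb g h)].

(* Extension of a functional on H to g by zero on the root spaces. *)
Definition ext0 (l : 'Hom(H, C^o)) (x : g) : C := l (cartan_part x).

(* Supersymmetry and invariance of B make [e] a scaling with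
   e_j A_ij = e_i A_ji; thus e is the inverse of a diagonal D with D A
   symmetric. *)
Definition standard_form (B : {biscalar g}) : Prop :=
  [/\ forall x y, par false x -> par true y -> B x y = 0 /\ B y x = 0,
      forall q r x y, par q x -> par r y -> B x y = (-1) ^+ (q && r) * B y x,
      forall x y z, B (brk x y) z = B x (brk y z),
      forall x, (forall y, B x y = 0) -> x = 0
    & exists e : 'I_n -> C, (forall j, e j != 0) /\
        forall h j, B (emb g h) (emb g (coroot H j)) = e j * sroot H j h].

(* The form induced by B on the dual of H takes real values on simple roots:
   s and t are the elements of H that B identifies with sroot i, sroot j. *)
Definition real_on_simple_roots (B : {biscalar g}) : Prop :=
  forall i j (s t : H),
    (forall h, B (emb g s) (emb g h) = sroot H i h) ->
    (forall h, B (emb g t) (emb g h) = sroot H j h) ->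
    B (emb g s) (emb g t) \is Num.real.

Definition is_weyl_vector (rho : 'Hom(H, C^o)) : Prop :=
  forall i, rho (coroot H i) = 2^-1 * sroot H i (coroot H i).

(* rho0 trivializes the Kac-Peterson cocycle of the even part. *)
Definition is_kac_peterson (rho0 : 'Hom(H, C^o)) : Prop :=
  forall x y : g, par false x -> par false y ->
    exists t1 t2 : C,
      [/\ has_trace (par false)
            (fun z => brk x (pi_minus (brk y (pi_plus z)))) t1,
          has_trace (par false)
            (fun z => brk y (pi_minus (brk x (pi_plus z)))) t2
        & ext0 rho0 (brk x y) = 2^-1 * t1 - 2^-1 * t2].

Definition conj_anti_involution (w : g -> g) : Prop :=
  [/\ forall (a : C) x y, w (a *: x + y) = a^* *: w x + w y,
      involutive w
    & forall x y, w (brk x y) = brk (w y) (w x)].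

Definition consistent (w : g -> g) : Prop :=
  forall l, is_root l -> w @` root_space l = root_space (- l).

(* l(h) is the complex conjugate of l(w(h)) for all h in H (a consistent w
   preserves H). Weyl vectors and functionals trivializing the Kac-Peterson
   cocycle are only determined up to functionals vanishing on a subspace of H,
   so this has to be asked of rho1 = rho0 - rho, whose value at h is minus the
   eigenvalue of h on the vacuum vector 1 of the oscillator module. *)
Definition omega_real (w : g -> g) (l : 'Hom(H, C^o)) : Prop :=
  forall h, l h = (ext0 l (w (emb g h)))^*.

Section HighestWeight.
Variable M : superModule g.

Definition weight_space (l : 'Hom(H, C^o)) : set M :=
  [set v | forall h, act M (emb g h) v = (l h : C) *: v].

Definition submodule (U : set M) : Prop :=
  subspace U /\ forall x v, U v -> U (act M x v).

Definition highest_weight_module (L : 'Hom(H, C^o)) (vL : M) : Prop :=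
  [/\ lspan (\bigcup_l weight_space l) = setT /\
      (forall l, fin_dim (weight_space l)),
      vL != 0, weight_space L vL,
      forall x, nplus x -> act M x vL = 0
    & smallest submodule [set vL] = setT].

Definition contravariant_form (w : g -> g) (vL : M) (f : M -> M -> C) : Prop :=
  [/\ hermitian_form f, f vL vL = 1
    & forall x u v, f (act M x u) v = f u (act M (w x) v)].

End HighestWeight.

(* T with the action a (relevant on the even part only) and the form f is a
   unitarizable module over the even part of g. *)
Definition even_unitarizable (w : g -> g) (T : lmodType C) (a : g -> T -> T)
    (f : T -> T -> C) : Prop :=
  [/\ forall x, par false x -> linear (a x),
      forall (c : C) x y v, par false x -> par false y ->
        a (c *: x + y) v = c *: a x v + a y v,
      forall x y v, par false x -> par false y ->
        a (brk x y) v = a x (a y v) - a y (a x v),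
      hermitian_form f /\ posdef f
    & forall x u v, par false x -> f (a x u) v = f u (a (w x) v)].

End KacMoody.

Arguments oddplus {C n A p H} g _.
Arguments oddminus {C n A p H} g _.

(* M(g_1), the polynomial algebra in variables indexed by J. *)
Notation osc C J := {malg C[{cmonom J}]} (only parsing).

Section Oscillator.
Variables (C : numClosedFieldType) (n : nat) (A : 'M[C]_n) (p : 'I_n -> bool).
Variables (H : realization A) (g : chevalleyAlg p H) (B : {biscalar g}).
Variables (J : choiceType) (xs ds : J -> g).

Definition is_polarization_basis : Prop :=
  [/\ is_basis (oddminus g) xs /\ is_basis (oddplus g) ds,
      forall a, exists k, pdeg k (xs a),
      forall a, exists k, pdeg k (ds a)
    & forall a b, B (ds a) (xs b) = if a == b then 2^-1 else 0].

Definition omega_adapted (w : g -> g) : Prop :=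
  exists2 s : C, s = 1 \/ s = -1 &
    forall a, w (xs a) = s *: ds a /\ w (ds a) = s *: xs a.

Definition pvar (a : J) : osc C J := << ucm a >>.

Definition pderiv (a : J) (P : osc C J) : osc C J :=
  \sum_(m <- msupp P) << P@_m *+ m a *g divcm m (ucm a) >>.

(* The Clifford action of the components of u in the odd parts of n^- and n^+;
   2 B(d_a, u) and 2 B(u, x_a) are the coordinates of u along x_a and d_a.
   The sums have finite support. *)
Definition creat (u : g) (P : osc C J) : osc C J :=
  \sum_(a \in [set: J]) (2 * B (ds a) u) *: (pvar a * P).
Definition annih (u : g) (P : osc C J) : osc C J :=
  \sum_(a \in [set: J]) (2 * B u (xs a)) *: pderiv a P.

(* The action of the normally ordered product :u v:. *)
Definition nord (u v : g) (P : osc C J) : osc C J :=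
  creat u (creat v P) + creat u (annih v P) + creat v (annih u P)
  + annih u (annih v P).

Definition osc_act (rho1 : 'Hom(H, C^o)) (x : g) (P : osc C J) : osc C J :=
  2^-1 *: (\sum_(a \in [set: J]) nord (brk x (xs a)) (ds a) P)
  - 2^-1 *: (\sum_(a \in [set: J]) nord (brk x (ds a)) (xs a) P)
  - ext0 rho1 x *: P.

Definition mfact (m : {cmonom J}) : nat :=
  (\prod_(a <- finsupp (cmonom_val m)) (m a)`!)%N.

Definition osc_form (P Q : osc C J) : C :=
  \sum_(m <- msupp P) (P@_m)^* * Q@_m * (mfact m)%:R.

End Oscillator.

(* Main.v *)
(* The form on [M (x) M(g_1)] is positive definite because the monomials are
   orthogonal with positive norms, so the substance is that [pi] is a
   contravariant representation of [g_0].

   Contravariance: [omega] exchanges the [x_a] and the [d_a] up to a sign,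
   multiplication by [x_a] and [d/dx_a] are adjoint, and the coefficients of
   [pi(omega(x))] are the conjugates of the transposed coefficients of [pi(x)].

   Representation: [pi(x)] and [ad x] act alike on the Clifford generators, so
   [[pi(x), pi(y)] - pi([x, y])] is a scalar, and its value on the vacuum is
   the difference of [rho_1([x, y])] and the cocycle of [g_1], a trace over
   the odd part of [n^+]. The Kac-Peterson hypothesis gives the same cocycle
   over [g_0], and the supertrace cocycle over all of [g] is the coboundary of
   [2 rho]: it is a super 2-cocycle, being the failure of the compression
   [x |-> pi_+ ad(x) pi_+] to be a homomorphism up to finite rank, and it
   agrees with the coboundary on Chevalley generators. *)

(* The obstacle is infinite dimension. Traces are taken only of operators of finite rank, given as
   sums of functional times vector. Finiteness comes from the principal grading, realized by the
   eigenspaces of [ad h0] for an [h0] on which every simple root is 1. Its components are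
   independent, and a nonzero degree is spanned by finitely many words in the generators. If [y] has
   degree [k], then [ad y] leads from positive to nonpositive degrees only out of degrees at most
   [|k|], so the operators in the cocycle have finite rank. The same bound leaves finitely many
   products of two variables in [pi(x)]; all other terms end in a derivative, so on a given
   polynomial [pi(x)] agrees with a finite truncation. The functional [rho0 - rho] arises because
   the supertrace is the even trace minus the odd one: the even cocycle is the coboundary of
   [2 rho0], the supertrace cocycle that of [2 rho]. On the pair [X_i, Y_i] the latter is the
   supertrace of a rank-one operator along [X_i], equal to the value of the i-th simple root on its
   coroot. *)
Require Import Defs.
From HB Require Import structures.
From mathcomp Require Import all_boot all_order all_algebra.
From mathcomp Require Import reals.
From mathcomp Require Import complex.
From mathcomp Require Import boolp classical_sets fsbigop.
From mathcomp Require Import finmap ring zify.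
From mathcomp.multinomials Require Import monalg.

Set Implicit Arguments.
Unset Strict Implicit.
Unset Printing Implicit Defensive.

Import Order.TTheory GRing.Theory Num.Theory.
Local Open Scope classical_set_scope.
Local Open Scope ring_scope.

(** * Linear identities in modules *)

Section LinearExpressions.
Variables (R : comNzRingType) (V : lmodType R).

(** Reflection for module identities: two linear expressions agree as soon as the coefficients of
    every atom agree, which leaves scalar goals for [ring]. *)
Inductive lexp :=
  | LVar of nat | LZero | LAdd of lexp & lexp | LOpp of lexp | LScale of R & lexp.

Fixpoint leval (env : seq V) e : V :=
  match e with
  | LVar i => env`_i
  | LZero => 0
  | LAdd a b => leval env a + leval env b
  | LOpp a => - leval env a
  | LScale c a => c *: leval env a
  end.

(** [eqn] in place of [==] lets [cbn] reduce the coefficient of an atom to 0 or 1. *)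
Fixpoint lcoef e (i : nat) : R :=
  match e with
  | LVar j => if eqn i j then 1 else 0
  | LZero => 0
  | LAdd a b => lcoef a i + lcoef b i
  | LOpp a => - lcoef a i
  | LScale c a => c * lcoef a i
  end.

Fixpoint lwf n e :=
  match e with
  | LVar j => (j < n)%N
  | LZero => true
  | LAdd a b => lwf n a && lwf n b
  | LOpp a => lwf n a
  | LScale c a => lwf n a
  end.

Fixpoint lcoefs_eq e1 e2 n : Prop :=
  match n with
  | 0%N => True
  | n'.+1 => lcoef e1 n' = lcoef e2 n' /\ lcoefs_eq e1 e2 n'
  end.

Lemma levalE env e : lwf (size env) e ->
  leval env e = \sum_(i < size env) lcoef e i *: env`_i.
Proof.
elim: e => [j||a IHa b IHb|a IHa|c a IHa] /=.
- move=> ltj; rewrite (bigD1 (Ordinal ltj)) //= -[eqn _ _]/(j == j) eqxx scale1r big1 ?addr0 // => i.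
  by rewrite -val_eqE -[eqn _ _]/(_ == _) /= => /negbTE ->; rewrite scale0r.
- by move=> _; rewrite big1 // => i _; rewrite scale0r.
- case/andP=> /IHa -> /IHb ->; rewrite -big_split /=.
  by apply: eq_bigr => i _; rewrite scalerDl.
- by move/IHa ->; rewrite -sumrN; apply: eq_bigr => i _; rewrite scaleNr.
- by move/IHa ->; rewrite scaler_sumr; apply: eq_bigr => i _; rewrite scalerA.
Qed.

Lemma leval_eq env e1 e2 : lwf (size env) e1 -> lwf (size env) e2 ->
  lcoefs_eq e1 e2 (size env) -> leval env e1 = leval env e2.
Proof.
move=> w1 w2 H; rewrite !levalE //; apply: eq_bigr => i _; congr (_ *: _).
elim: (size env) H {i}(i : nat) (ltn_ord i) => [_ []//|m IH] /= [e /IH {}IH] i.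
by rewrite ltnS leq_eqVlt => /orP[/eqP ->//|]; apply: IH.
Qed.

End LinearExpressions.

Ltac lmem x env :=
  lazymatch env with
  | nil => constr:(false)
  | cons x _ => constr:(true)
  | cons _ ?e => lmem x e
  end.

Ltac lidx x env :=
  lazymatch env with
  | cons x _ => constr:(0%N)
  | cons _ ?e => let i := lidx x e in constr:(S i)
  end.

Ltac lenv t env :=
  lazymatch t with
  | (?a + ?b)%R => let e := lenv a env in lenv b e
  | (- ?a)%R => lenv a env
  | (_ *: ?a)%R => lenv a env
  | 0%R => env
  | _ => let b := lmem t env in
         lazymatch b with true => env | false => constr:(cons t env) end
  end.

Ltac lreify R t env :=
  lazymatch t with
  | (?a + ?b)%R => let x := lreify R a env in let y := lreify R b env in
                   constr:(@LAdd R x y)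
  | (- ?a)%R => let x := lreify R a env in constr:(@LOpp R x)
  | (?c *: ?a)%R => let x := lreify R a env in constr:(@LScale R c x)
  | 0%R => constr:(@LZero R)
  | _ => let i := lidx t env in constr:(@LVar R i)
  end.

Ltac lmod_ring R :=
  lazymatch goal with
  | |- ?a = ?b =>
    let T := type of a in
    let env := lenv a (@nil T) in
    let env := lenv b env in
    let x := lreify R a env in
    let y := lreify R b env in
    refine (@leval_eq R _ env x y isT isT _);
    cbn [lcoefs_eq size lcoef eqn]; repeat split; ring
  end.

(** * Subspaces and traces of finite-rank operators *)

Section Subspaces.
Variables (C : numClosedFieldType) (V : lmodType C).
Implicit Types (U W S : set V) (x y : V).

Section Closure.
Variables (U : set V) (subU : subspace U).

Lemma subspace0 : U 0. Proof. by case: subU. Qed.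

Lemma subspaceD x y : U x -> U y -> U (x + y).
Proof. by move=> Ux Uy; rewrite -[x]scale1r; case: subU => _; apply. Qed.

Lemma subspaceZ a x : U x -> U (a *: x).
Proof.
by move=> Ux; rewrite -[a *: x]addr0; case: subU => U0; apply.
Qed.

Lemma subspaceN x : U x -> U (- x).
Proof. by rewrite -scaleN1r; apply: subspaceZ. Qed.

Lemma subspaceB x y : U x -> U y -> U (x - y).
Proof. by move=> Ux /subspaceN; apply: subspaceD. Qed.

End Closure.

Lemma lspan_sub S U : subspace U -> S `<=` U -> lspan S `<=` U.
Proof. exact: smallest_sub. Qed.

Lemma sub_lspan S : S `<=` lspan S.
Proof. exact: sub_gen_smallest. Qed.

Lemma subspace_lspan S : subspace (lspan S).
Proof.
split=> [U [[U0 _] _]|a u v Su Sv U [subU SU]] //.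
by apply: subU.2; [apply: Su | apply: Sv].
Qed.

Lemma lspanS S1 S2 : S1 `<=` S2 -> lspan S1 `<=` lspan S2.
Proof.
by move=> S12; apply: lspan_sub; [exact: subspace_lspan|move=> x /S12; exact: sub_lspan].
Qed.

Definition complementary U W : Prop :=
  [/\ subspace U, subspace W, forall x, U x -> W x -> x = 0
    & forall x, exists2 u, U u & W (x - u)].

(** The same choice as in [pi_plus], so that [pi_plusE] only has to identify the two subspaces. For
    complementary subspaces uniqueness makes the choice linear. *)
Definition proj U W x : V := xget 0 [set u | U u /\ W (x - u)].

Section Projection.
Variables (U W : set V) (UW : complementary U W).

Lemma proj_in x : U (proj U W x).
Proof.
case: UW => _ _ _ /(_ x)[u Uu Wu].
by have [|//] := @xgetPex _ 0 [set u | U u /\ W (x - u)]; exists u.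
Qed.

Lemma proj_sub x : W (x - proj U W x).
Proof.
case: UW => _ _ _ /(_ x)[u Uu Wu].
by have [|//] := @xgetPex _ 0 [set u | U u /\ W (x - u)]; exists u.
Qed.

Lemma proj_uniq x u : U u -> W (x - u) -> proj U W x = u.
Proof.
move=> Uu Wu; have [sU sW d _] := UW.
apply/eqP; rewrite -subr_eq0; apply/eqP/d; first exact: subspaceB (proj_in _) Uu.
have -> : proj U W x - u = (x - u) - (x - proj U W x) by rewrite opprB [RHS]addrC subrKA.
exact: subspaceB Wu (proj_sub _).
Qed.

Lemma proj_is_linear : linear (proj U W).
Proof.
move=> a x y; have [sU sW _ _] := UW; apply: proj_uniq.
  by apply: sU.2; exact: proj_in.
have -> : a *: x + y - (a *: proj U W x + proj U W y) =
  a *: (x - proj U W x) + (y - proj U W y) by lmod_ring C.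
by apply: sW.2; exact: proj_sub.
Qed.

Lemma proj_id x : U x -> proj U W x = x.
Proof. by move=> Ux; apply: proj_uniq; rewrite ?subrr //; case: UW => _ []. Qed.

Lemma proj_eq0 x : W x -> proj U W x = 0.
Proof. by move=> Wx; apply: proj_uniq; rewrite ?subr0 //; case: UW => [[]]. Qed.

End Projection.

End Subspaces.

Fact mklin_key : unit. Proof. by []. Qed.

(* Locked, lest simplification expose the underlying function. *)
Definition mklin (R : pzRingType) (U V : lmodType R) (f : U -> V)
    (lf : linear f) : {linear U -> V} :=
  locked_with mklin_key
    (HB.pack f (GRing.isLinear.Build R U V _ f lf) : {linear U -> V}).

Lemma mklinE (R : pzRingType) (U V : lmodType R) (f : U -> V)
  (lf : linear f) x : mklin lf x = f x.
Proof. by rewrite /mklin unlock. Qed.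

(** * Finite-rank operators on a space of arbitrary dimension *)

Section FiniteRank.
Variables (C : numClosedFieldType) (V : lmodType C).
Implicit Types (F G : V -> V) (s : seq ({linear V -> C^o} * V)).

(** A list of pairs is an element of the tensor product of the dual of [V] with [V]; [frop] is the
    operator it defines and [frtr] its contraction. *)
Definition frop s (v : V) : V := \sum_(q <- s) (q.1 v : C) *: q.2.
Definition frtr s : C := \sum_(q <- s) q.1 q.2.

(* The matrix [Phi] of the values of the functionals at the vectors satisfies
   [Phi * Phi = 0], so a full rank factorization [Phi = L R] has [R L = 0]. *)
Lemma frtr0 s : (forall v, frop s v = 0) -> frtr s = 0.
Proof.
move=> s0; pose q0 : {linear V -> C^o} * V := (\0%R : {linear V -> C^o}, 0).
pose Phi : 'M[C]_(size s) := \matrix_(i, j) (nth q0 s i).1 (nth q0 s j).2.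
have -> : frtr s = \tr Phi.
  by rewrite /frtr (big_nth q0) big_mkord; apply: eq_bigr => i _; rewrite mxE.
have Phi2 : Phi *m Phi = 0.
  apply/matrixP => i k; rewrite !mxE.
  have := congr1 (nth q0 s i).1 (s0 (nth q0 s k).2).
  rewrite linear0 linear_sum (big_nth q0) big_mkord => e; rewrite -[RHS]e.
  by apply: eq_bigr => j _; rewrite linearZ /= !mxE mulrC.
have Rl : row_base Phi *m col_base Phi = 0.
  have e : col_base Phi *m (row_base Phi *m col_base Phi) *m row_base Phi = 0.
    by rewrite mulmxA mulmx_base -mulmxA mulmx_base.
  apply: (@row_full_inj _ _ _ _ (col_base Phi)); first exact: col_base_full.
  apply: (@row_free_inj _ _ _ _ (row_base Phi)); first exact: row_base_free.
  by rewrite /= e mulmx0 mul0mx.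
by rewrite -(mulmx_base Phi) mxtrace_mulC Rl mxtrace0.
Qed.

Definition has_ftr F (t : C) : Prop := exists2 s, F =1 frop s & t = frtr s.
Definition frank F : Prop := exists t, has_ftr F t.
Definition ftr F : C := xget 0 (has_ftr F).

Lemma has_ftr_lin F G a t u : has_ftr F t -> has_ftr G u ->
  has_ftr (fun v => a *: F v + G v) (a * t + u).
Proof.
move=> [s Fs ->] [s' Gs ->].
exists ([seq (q.1, a *: q.2) | q <- s] ++ s') => [v|].
  rewrite /frop big_cat big_map Fs Gs /frop scaler_sumr; congr (_ + _).
  by apply: eq_bigr => q _; rewrite /= !scalerA mulrC.
rewrite /frtr big_cat big_map mulr_sumr; congr (_ + _).
by apply: eq_bigr => q _; rewrite linearZ.
Qed.

(** Two representations of one operator differ by a representation of zero, whose contraction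
    vanishes by [frtr0]; so the trace depends on the operator alone. *)
Lemma has_ftr_fun F t u : has_ftr F t -> has_ftr F u -> t = u.
Proof.
move=> Ft Fu; have [s Fs e] := has_ftr_lin (-1) Ft Fu.
apply/eqP; rewrite eq_sym -subr_eq0 addrC -mulN1r e; apply/eqP/frtr0 => v.
by rewrite -Fs scaleN1r addNr.
Qed.

Lemma ftrP F : frank F -> has_ftr F (ftr F).
Proof. by move=> ?; apply: xgetPex. Qed.

Lemma has_ftrE F t : has_ftr F t -> ftr F = t.
Proof. by move=> Ft; apply: (has_ftr_fun _ Ft); apply: ftrP; exists t. Qed.

Lemma eq_ftr F G : F =1 G -> ftr F = ftr G.
Proof. by move/funext->. Qed.

Lemma frank_lin F G a : frank F -> frank G -> frank (fun v => a *: F v + G v).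
Proof. by move=> [t Ft] [u Gu]; exists (a * t + u); apply: has_ftr_lin. Qed.

Lemma ftr_lin F G a : frank F -> frank G ->
  ftr (fun v => a *: F v + G v) = a * ftr F + ftr G.
Proof. by move=> /ftrP Ft /ftrP Gu; apply/has_ftrE/has_ftr_lin. Qed.

Lemma has_ftr_cst0 : has_ftr (fun=> 0) 0.
Proof. by exists [::] => [v|]; rewrite /frop /frtr big_nil. Qed.

Lemma frank0 : frank (fun=> 0).
Proof. by exists 0; exact: has_ftr_cst0. Qed.

Lemma ftr_cst0 : ftr (fun=> 0) = 0.
Proof. exact: has_ftrE has_ftr_cst0. Qed.

Lemma frankZ F a : frank F -> frank (fun v => a *: F v).
Proof.
move/(frank_lin a)/(_ frank0); congr frank.
by apply/funext => v; rewrite addr0.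
Qed.

Lemma ftrZ F a : frank F -> ftr (fun v => a *: F v) = a * ftr F.
Proof.
move/(ftr_lin a)/(_ frank0); rewrite ftr_cst0 addr0 => <-.
by apply: eq_ftr => v; rewrite addr0.
Qed.

Lemma frankD F G : frank F -> frank G -> frank (fun v => F v + G v).
Proof.
move=> fF /(frank_lin 1 fF); congr frank.
by apply/funext => v; rewrite scale1r.
Qed.

Lemma has_ftr_compl (G : {linear V -> V}) s :
  has_ftr (G \o frop s) (\sum_(q <- s) q.1 (G q.2)).
Proof.
exists [seq (q.1, G q.2) | q <- s] => [v|]; last by rewrite /frtr big_map.
by rewrite /frop big_map /= linear_sum; apply: eq_bigr => q _; rewrite linearZ.
Qed.

Lemma has_ftr_compr (G : {linear V -> V}) s :
  has_ftr (frop s \o G) (\sum_(q <- s) q.1 (G q.2)).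
Proof.
by exists [seq ((q.1 \o G : {linear V -> C^o}), q.2) | q : {linear V -> C^o} * V <- s] => [v|];
  rewrite /frop /frtr big_map.
Qed.

Lemma frank_compl (G : {linear V -> V}) F : frank F -> frank (G \o F).
Proof. by move=> [t [s /funext-> _]]; eexists; exact: has_ftr_compl. Qed.

Lemma frank_compr (G : {linear V -> V}) F : frank F -> frank (F \o G).
Proof. by move=> [t [s /funext-> _]]; eexists; exact: has_ftr_compr. Qed.

(** Composing with [G] on either side turns a list for [F] into one with the same contraction, the
    sum of the [q.1 (G q.2)]. *)
Lemma ftrC (G : {linear V -> V}) F : frank F -> ftr (F \o G) = ftr (G \o F).
Proof.
move=> [t [s /funext-> _]].
by rewrite (has_ftrE (has_ftr_compl _ _)) (has_ftrE (has_ftr_compr _ _)).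
Qed.

(** Induction on the spanning list. If [b] is not in the span of the others, its coefficient in
    [F v] is well defined, hence a linear functional of [v], and subtracting this rank-one part
    leaves an operator into the smaller span. *)
Lemma frank_span (s : seq V) (F : {linear V -> V}) :
  (forall v, lspan [set` s] (F v)) -> frank F.
Proof.
elim: s F => [|b s IH] F Fs.
  have := frank0; congr frank; apply/funext => v; apply/esym.
  have : lspan [set` [::]] `<=` [set (0 : V)].
    apply: lspan_sub => //; split=> // a u w -> ->.
    by rewrite scaler0 addr0.
  by apply; exact: Fs.
have sW := subspace_lspan [set` s].
have bs w : lspan [set` b :: s] w -> exists a, lspan [set` s] (w - a *: b).
  move: w; apply: lspan_sub; first split.
  - by exists 0; rewrite scale0r subr0; exact: (subspace0 sW).
  - move=> a u w [c Uc] [d Ud]; exists (a * c + d).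
    have -> : a *: u + w - (a * c + d) *: b = a *: (u - c *: b) + (w - d *: b).
      by lmod_ring C.
    exact: sW.2.
  move=> w /=; rewrite inE => /orP[/eqP->|ws].
    by exists 1; rewrite scale1r subrr; exact: (subspace0 sW).
  by exists 0; rewrite scale0r subr0; apply: sub_lspan.
have [sb|nsb] := pselect (lspan [set` s] b).
  apply: IH => v; have [a Wa] := bs _ (Fs v).
  by rewrite -[F v](subrK (a *: b)); apply: (subspaceD sW) => //; exact: (subspaceZ sW).
pose phi v := xget 0 [set a | lspan [set` s] (F v - a *: b)].
have phiP v : lspan [set` s] (F v - phi v *: b).
  have [a Wa] := bs _ (Fs v).
  by apply: (@xgetPex _ 0 [set a | lspan [set` s] (F v - a *: b)]); exists a.
have phi_uniq v a : lspan [set` s] (F v - a *: b) -> phi v = a.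
  move=> Wa; apply/eqP/negP => /negP; rewrite -subr_eq0 => ne; apply: nsb.
  rewrite -[b]scale1r -(mulVf ne) -scalerA; apply: (subspaceZ sW).
  have -> : (phi v - a) *: b = (F v - a *: b) - (F v - phi v *: b) by lmod_ring C.
  exact: (subspaceB sW).
have lphi : linear (phi : V -> C^o).
  move=> a u v; apply: phi_uniq.
  have -> : F (a *: u + v) - (a *: (phi u : C^o) + phi v : C) *: b =
    a *: (F u - phi u *: b) + (F v - phi v *: b).
    by rewrite linearP scalerDl -[_ *: (phi u : C^o)]/(a * phi u); lmod_ring C.
  exact: sW.2.
pose phil := mklin lphi.
have lF' : linear (fun v => F v - phi v *: b).
  move=> a u v; rewrite linearP lphi scalerDl -[_ *: (phi u : C^o)]/(a * phi u).
  by lmod_ring C.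
have := @frankD (frop [:: (phil, b)]) (mklin lF').
have -> : (fun v => frop [:: (phil, b)] v + mklin lF' v) = F.
  by apply/funext => v; rewrite /frop big_seq1 /= !mklinE addrC subrK.
by apply; [eexists; exists [:: (phil, b)] | apply: IH => v; rewrite mklinE; exact: phiP].
Qed.

Lemma lspan_ranged (r : nat) (b : 'I_r -> V) x : lspan (range b) x ->
  exists c : 'I_r -> C, x = \sum_i c i *: b i.
Proof.
move: x; apply: lspan_sub; first split.
- by exists (fun=> 0); rewrite big1 // => i _; rewrite scale0r.
- move=> a u v [c ->] [d ->]; exists (fun i => a * c i + d i).
  rewrite scaler_sumr -big_split; apply: eq_bigr => i _.
  by rewrite scalerDl scalerA.
move=> _ [i _ <-]; exists (fun j => (j == i)%:R).
rewrite (bigD1 i) //= eqxx scale1r big1 ?addr0 // => j /negbTE->.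
by rewrite scale0r.
Qed.

(** [has_trace] is about an operator on a subspace, [ftr] about one on the whole space; a projection
    [p] onto [U] links them. The coordinates of [F (p v)] along the basis are the functionals, and
    their values on the basis are the entries of the matrix. *)
Lemma has_trace_ftr U (F p : {linear V -> V}) t :
  (forall v, U (p v)) -> (forall v, U v -> p v = v) ->
  has_trace U F t -> frank (F \o p) /\ ftr (F \o p) = t.
Proof.
move=> Up pU [r [b [m [Ub lb Fb bm ->]]]].
have /choice[c cE] v : exists c : 'I_r -> C, F (p v) = \sum_i c i *: b i.
  exact: (lspan_ranged (Fb _ (Up v))).
have c_uniq (c1 c2 : 'I_r -> C) :
    \sum_i c1 i *: b i = \sum_i c2 i *: b i -> forall i, c1 i = c2 i.
  move=> e i; apply/eqP; rewrite -subr_eq0; apply/eqP.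
  apply: (lb (index_enum 'I_r) (fun i => c1 i - c2 i)); rewrite ?index_enum_uniq ?mem_index_enum //.
  by under eq_bigr do rewrite scalerBl; rewrite sumrB e subrr.
have lc i : linear (fun v => c v i : C^o).
  move=> a u v; apply: (c_uniq (c (a *: u + v)) (fun i => a * c u i + c v i)).
  rewrite -cE !linearP !cE scaler_sumr -big_split; apply: eq_bigr => j _.
  by rewrite scalerDl scalerA.
suff tr : has_ftr (F \o p) (\tr m) by split; [exists (\tr m) | exact: has_ftrE].
exists [seq (mklin (lc i), b i) | i <- index_enum 'I_r] => [v|].
  by rewrite /frop big_map /= cE; apply: eq_bigr => i _; rewrite mklinE.
rewrite /frtr big_map; apply: eq_bigr => i _ /=; rewrite mklinE.
by apply: (c_uniq (m^~ i) (c (b i))); rewrite -cE pU // bm.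
Qed.

End FiniteRank.

(** * Grading, triangular decomposition and invariant forms *)

Lemma lspan_lin (C : numClosedFieldType) (V V' : lmodType C) (S : set V)
    (U : set V') (f : {linear V -> V'}) : subspace U ->
  (forall x, S x -> U (f x)) -> forall x, lspan S x -> U (f x).
Proof.
move=> sU SU; apply: (@lspan_sub _ _ _ (f @^-1` U)) => //; split.
  by rewrite /preimage /= linear0; exact: (subspace0 sU).
by move=> a u v; rewrite /preimage /= linearP; exact: sU.2.
Qed.

(** * Parity components and brackets *)

Section LieSuper.
Variables (C : numClosedFieldType) (g : lieSuperalgebra C).
Implicit Types (x y z : g) (S Q : set g).

Lemma par_grading : is_grading (@par C g).
Proof. by case: g. Qed.

Lemma brk_par p q x y : par p x -> par q y -> par (p (+) q) (brk x y).
Proof. by case: g x y => V P b ? H ? ? x y; apply: H. Qed.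

Lemma brk_skew p q x y : par p x -> par q y ->
  brk x y = - ((-1) ^+ (p && q) *: brk y x).
Proof. by case: g x y => V P b ? ? H ? x y; apply: H. Qed.

Lemma brk_jac p q x y z : par p x -> par q y ->
  brk x (brk y z) = brk (brk x y) z + (-1) ^+ (p && q) *: brk y (brk x z).
Proof. by case: g x y z => V P b ? ? ? H x y z; apply: H. Qed.

Lemma par_sub p : subspace (@par C g p).
Proof. by case: par_grading. Qed.

Lemma par_compl p : complementary (@par C g p) (par (~~ p)).
Proof.
have [sub dec int] := par_grading; split=> //.
  by case: p => x P1 P2; apply: int.
move=> x; have [x0 [x1 [P0 P1 ->]]] := dec x; case: p.
  by exists x1; rewrite ?addrK.
by exists x0; rewrite // addrC addKr.
Qed.

Definition pproj p : {linear g -> g} := mklin (proj_is_linear (par_compl p)).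

Lemma pproj_par p x : par p (pproj p x).
Proof. by rewrite mklinE; exact: (proj_in (par_compl p)). Qed.

Lemma pproj_id p x : par p x -> pproj p x = x.
Proof. by rewrite mklinE; exact: (proj_id (par_compl p)). Qed.

Lemma pproj_eq0 p x : par (~~ p) x -> pproj p x = 0.
Proof. by rewrite mklinE; exact: (proj_eq0 (par_compl p)). Qed.

Lemma pproj_neq p q x : par p x -> p != q -> pproj q x = 0.
Proof. by move=> Px ne; apply: pproj_eq0; case: p q ne Px => [] []. Qed.

Lemma pprojD x : pproj false x + pproj true x = x.
Proof.
suff -> : pproj true x = x - pproj false x by rewrite addrC subrK.
rewrite !mklinE; apply: (proj_uniq (par_compl true)).
  exact: (proj_sub (par_compl false)).
by rewrite subKr; exact: (proj_in (par_compl false)).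
Qed.

Lemma brk_pproj p x y : pproj p (brk x y) =
  brk (pproj false x) (pproj p y) + brk (pproj true x) (pproj (~~ p) y).
Proof.
have P q q' z : par q z -> pproj q' z = if q == q' then z else 0.
  by case: eqP => [<- /pproj_id //|/eqP ne /pproj_neq ->].
rewrite -{1}[x]pprojD -{1}[y]pprojD linearDl !linearDr /= !linearD /=.
rewrite !(P _ _ _ (brk_par (pproj_par _ _) (pproj_par _ _))) /=.
by case: p; rewrite /= ?addr0 ?add0r.
Qed.

Lemma brk_jac_even x y z : par false x ->
  brk x (brk y z) = brk (brk x y) z + brk y (brk x z).
Proof.
move=> P; rewrite -[y]pprojD !linearDl !linearDr !linearDl.
rewrite (brk_jac _ P (pproj_par false y)) (brk_jac _ P (pproj_par true y)) /=.
by lmod_ring C.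
Qed.

Lemma brk_skew_even x y : par false x -> brk x y = - brk y x.
Proof.
move=> P; rewrite -[y]pprojD linearDl linearDr.
rewrite (brk_skew P (pproj_par false y)) (brk_skew P (pproj_par true y)) /=.
by rewrite !scale1r opprD.
Qed.

(** The signed bracket rules hold for homogeneous elements, so closure of [Q] is asked for these
    only. The induction runs over the elements all of whose parity components lie in [Q]. *)
Lemma homog_ind S Q : (forall x, S x -> exists p, par p x) ->
  subspace Q -> S `<=` Q ->
  (forall p q x y, par p x -> par q y -> Q x -> Q y -> Q (brk x y)) ->
  smallest (@subalgebra C g) S `<=` Q.
Proof.
move=> Sh sQ SQ QQ.
suff H : smallest (@subalgebra C g) S `<=` [set x | forall p, Q (pproj p x)].
  by move=> x /H Qx; rewrite -[x]pprojD; apply: (subspaceD sQ).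
apply: smallest_sub; first split; first split.
- by move=> p; rewrite linear0; apply: (subspace0 sQ).
- by move=> a u v Qu Qv p; rewrite linearP; apply: sQ.2.
- move=> x y Qx Qy p; rewrite brk_pproj; apply: (subspaceD sQ);
    by apply: (QQ _ _ _ _ (pproj_par _ _) (pproj_par _ _)).
move=> x Sx p; have [q Px] := Sh x Sx; have [<-|ne] := eqVneq q p.
  by rewrite pproj_id //; apply: SQ.
by rewrite (pproj_neq Px ne); exact: (subspace0 sQ).
Qed.

End LieSuper.

(** * Algebras with Chevalley generators and their principal grading *)

Section Chevalley.
Variables (C : numClosedFieldType) (n : nat) (A : 'M[C]_n) (p : 'I_n -> bool).
Variables (H : realization A) (g : chevalleyAlg p H).
Implicit Types (x y : g) (h : H) (k l : int).

Lemma par_emb h : par false (emb g h). Proof. by case: g. Qed.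
Lemma par_genX i : par (p i) (genX g i). Proof. by case: g. Qed.
Lemma par_genY i : par (p i) (genY g i). Proof. by case: g. Qed.
Lemma brk_emb h h' : brk (emb g h) (emb g h') = 0. Proof. by case: g. Qed.
Lemma brk_embX h i : brk (emb g h) (genX g i) = (sroot H i h : C) *: genX g i.
Proof. by case: g. Qed.
Lemma brk_embY h i : brk (emb g h) (genY g i) = - ((sroot H i h : C) *: genY g i).
Proof. by case: g. Qed.
Lemma brk_XY i j : brk (genX g i) (genY g j) = if i == j then emb g (coroot H i) else 0.
Proof. by case: g. Qed.

(** Linear independence of the simple roots makes the matrix of their values on a basis of the
    Cartan subalgebra right invertible. The constant 1 yields the grading element [h0]; a delta
    function isolates one simple root. *)
Lemma sroot_dual (c : 'I_n -> C) : exists h, forall j, (sroot H j h : C) = c j.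
Proof.
have fr : free [tuple sroot H i | i < n] by case: H.
pose e := vbasis {: cartan H}.
pose N := \matrix_(j < n, i < \dim {: cartan H}) (sroot H j e`_i : C).
have rfN : row_free N.
  rewrite -kermx_eq0; apply/eqP/row_matrixP => r; rewrite row0.
  set u := row r _; have uN : u *m N = 0.
    by apply/sub_kermxP; rewrite row_sub.
  apply/rowP => j; rewrite [RHS]mxE.
  move/freeP: fr => /(_ (fun j => u 0 j)); apply.
  apply/lfunP => v; rewrite zero_lfunE [v](coord_vbasis (memvf v)) linear_sum.
  rewrite big1 // => i _; rewrite linearZ /= sum_lfunE.
  have := congr1 (fun M : 'rV_ _ => M 0 i) uN; rewrite !mxE => e0.
  rewrite [X in _ *: X](_ : _ = 0) ?scaler0 // -[RHS]e0.
  apply: eq_bigr => l _.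
  rewrite (nth_map l) ?size_enum_ord // nth_ord_enum scale_lfunE.
  by rewrite [N l i]mxE.
have [X NX] := row_freeP rfN.
exists (\sum_i (\sum_j X i j * c j) *: e`_i) => j.
rewrite linear_sum /=.
have := congr1 (fun M : 'M_ _ => (M *m \col_j c j) j 0) NX.
rewrite mul1mx -mulmxA !mxE => <-; apply: eq_bigr => i _.
by rewrite linearZ /= !mxE mulrC; congr (_ * _); apply: eq_bigr => l _; rewrite !mxE.
Qed.

(** Right-normed brackets of [m.+1] letters; the shift matches the cases [Posz m.+1] and [Negz m] of
    [gcomp]. *)
Fixpoint words (z : 'I_n -> g) (m : nat) : seq g :=
  match m with
  | 0%N => [seq z i | i <- enum 'I_n]
  | m'.+1 => [seq brk (z i) w | i <- enum 'I_n, w <- words z m']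
  end.

Definition wspan z m : set g := lspan [set` words z m].

Lemma wspan_brk z m i x : wspan z m x -> wspan z m.+1 (brk (z i) x).
Proof.
apply: lspan_lin; first exact: subspace_lspan.
move=> w wm; apply: sub_lspan => /=.
by apply/allpairsP; exists (i, w); rewrite mem_enum.
Qed.

Lemma wspan_ind z m (U : set g) : subspace U ->
  (forall i w, wspan z m w -> U (brk (z i) w)) -> wspan z m.+1 `<=` U.
Proof.
move=> sU HU; apply: lspan_sub => // _ /allpairsP[[i w] [_ /= wm ->]].
by apply: HU; exact: sub_lspan.
Qed.

Lemma wspan_ind0 z (U : set g) : subspace U -> (forall i, U (z i)) -> wspan z 0 `<=` U.
Proof. by move=> sU HU; apply: lspan_sub => // _ /mapP[i _ ->]. Qed.

Lemma wspan_gen z i : wspan z 0 (z i).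
Proof. by apply: sub_lspan; apply/mapP; exists i; rewrite ?mem_enum. Qed.

Section Words.
Variables (z z' : 'I_n -> g) (c : 'I_n -> H -> C).
Hypothesis z_par : forall i, par (p i) (z i).
Hypothesis z'_par : forall i, par (p i) (z' i).
Hypothesis hz : forall h i, brk (emb g h) (z i) = c i h *: z i.
Hypothesis z'z : forall i j, range (emb g) (brk (z' i) (z j)).

Lemma wspan_emb m h x : wspan z m x -> wspan z m (brk (emb g h) x).
Proof.
have s (k : nat) := subspace_lspan [set` words z k].
elim: m x => [|m IH] x.
  apply: (lspan_lin (s _)) => _ /mapP[i _ ->]; rewrite /= hz; apply: (subspaceZ (s 0%N)).
  exact: wspan_gen.
apply: (lspan_lin (s _)) => _ /allpairsP[[i w] [_ /= wm ->]].
rewrite brk_jac_even; last exact: par_emb.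
apply: (subspaceD (s m.+1)); last by apply: wspan_brk; apply: IH; exact: sub_lspan.
rewrite hz linearZl_LR; apply: (subspaceZ (s m.+1)).
by apply: wspan_brk; exact: sub_lspan.
Qed.

Lemma subspace_emb : subspace (range (emb g)).
Proof.
split; first by exists 0; rewrite ?linear0.
by move=> a _ _ [u _ <-] [v _ <-]; exists (a *: u + v); rewrite ?linearP.
Qed.

Lemma wspan_lower0 i x : wspan z 0 x -> range (emb g) (brk (z' i) x).
Proof.
apply: lspan_lin; first exact: subspace_emb.
by move=> _ /mapP[j _ ->]; exact: z'z.
Qed.

(** The Jacobi identity moves [z' i] inward: its bracket with [z j] lies in the Cartan subalgebra,
    which preserves word spans, and the rest is shorter. With [z] and [z'] abstract this covers both
    the X-words acted on by [Y] and the Y-words acted on by [X]. *)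
Lemma wspan_lower m i x : wspan z m.+1 x -> wspan z m (brk (z' i) x).
Proof.
have s (k : nat) := subspace_lspan [set` words z k].
elim: m x => [|m IH] x;
  apply: (lspan_lin (s _)) => _ /allpairsP[[j w] [_ /= wm ->]];
  rewrite (brk_jac _ (z'_par i) (z_par j)).
  apply: (subspaceD (s 0%N)).
    have [h _ <-] := z'z i j; apply: wspan_emb; exact: sub_lspan.
  (* For two letters the inner bracket lies in the Cartan subalgebra, not in a word span, so it is
     moved across [z j] by skew symmetry. *)
  apply: (subspaceZ (s 0%N)); have [|h _ <-] := @wspan_lower0 i w.
    exact: sub_lspan.
  rewrite -[brk _ _]opprK -brk_skew_even; last exact: par_emb.
  by apply: (subspaceN (s 0%N)); apply: wspan_emb; exact: wspan_gen.
apply: (subspaceD (s m.+1)).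
  have [h _ <-] := z'z i j; apply: wspan_emb; exact: sub_lspan.
apply: (subspaceZ (s m.+1)); apply: wspan_brk; apply: IH; exact: sub_lspan.
Qed.

End Words.

(** An explicit model of the component of degree [k], visibly finite-dimensional outside degree 0,
    as the finite-rank arguments require. [E_gcomp] and [pdeg_E] identify it with the eigenspaces of
    [h0] and with the principal grading. *)
Definition gcomp (k : int) : set g :=
  match k with
  | Posz 0 => range (emb g)
  | Posz m.+1 => wspan (genX g) m
  | Negz m => wspan (genY g) m
  end.

Lemma subspace_gcomp k : subspace (gcomp k).
Proof. by case: k => [[|m]|m]; [exact: subspace_emb|exact: subspace_lspan..]. Qed.

Lemma brk_YX i j : range (emb g) (brk (genY g i) (genX g j)).
Proof.
rewrite (brk_skew (par_genY i) (par_genX j)) brk_XY.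
apply: (subspaceN subspace_emb); apply: (subspaceZ subspace_emb).
by case: eqP => _; [exists (coroot H j)|exists 0; rewrite ?linear0].
Qed.

Lemma brk_XY_emb i j : range (emb g) (brk (genX g i) (genY g j)).
Proof.
by rewrite brk_XY; case: eqP => _; [exists (coroot H i)|exists 0; rewrite ?linear0].
Qed.

Lemma brk_embY' h i : brk (emb g h) (genY g i) = - (sroot H i h : C) *: genY g i.
Proof. by rewrite brk_embY scaleNr. Qed.

Lemma brkH_gcomp h k x : gcomp k x -> gcomp k (brk (emb g h) x).
Proof.
case: k => [[|m]|m] /=.
- by move=> [h' _ <-]; rewrite brk_emb; exists 0; rewrite ?linear0.
- exact: (wspan_emb (brk_embX)).
- exact: (wspan_emb (brk_embY')).
Qed.

Lemma brkX_gcomp i k x : gcomp k x -> gcomp (k + 1) (brk (genX g i) x).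
Proof.
case: k => [[|m]|[|m]].
- move=> [h _ <-]; rewrite -[brk _ _]opprK -brk_skew_even; last exact: par_emb.
  rewrite brk_embX add0r; apply: (subspaceN (subspace_gcomp 1)).
  apply: (subspaceZ (subspace_gcomp 1)); exact: wspan_gen.
- by rewrite -PoszD addn1; exact: wspan_brk.
- exact: (wspan_lower0 brk_XY_emb).
- have -> : Negz m.+1 + 1 = Negz m.
    by rewrite !NegzE -[m.+2]addn1 PoszD opprD subrK.
  exact: (wspan_lower par_genY par_genX brk_embY' brk_XY_emb).
Qed.

Lemma brkY_gcomp i k x : gcomp k x -> gcomp (k - 1) (brk (genY g i) x).
Proof.
case: k => [[|[|m]]|m].
- move=> [h _ <-]; rewrite -[brk _ _]opprK -brk_skew_even; last exact: par_emb.
  rewrite brk_embY sub0r opprK.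
  apply: (subspaceZ (subspace_gcomp (-1))); exact: wspan_gen.
- exact: (wspan_lower0 brk_YX).
- have -> : Posz m.+2 - 1 = Posz m.+1 by rewrite -addn1 PoszD addrK.
  exact: (wspan_lower par_genX par_genY brk_embX brk_YX).
- have -> : Negz m - 1 = Negz m.+1.
    by rewrite !NegzE -[m.+2]addn1 PoszD opprD.
  exact: wspan_brk.
Qed.

Definition generators : set g :=
  range (emb g) `|` range (genX g) `|` range (genY g).

Lemma generators_homog x : generators x -> exists q, par q x.
Proof.
by move=> [[|]|] [i _ <-]; [exists false; exact: par_emb|exists (p i); exact: par_genX|
  exists (p i); exact: par_genY].
Qed.

Hypothesis gen : smallest (@subalgebra C g) generators = setT.

Lemma gen_ind (Q : set g) : subspace Q ->
  (forall h, Q (emb g h)) -> (forall i, Q (genX g i)) -> (forall i, Q (genY g i)) ->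
  (forall q r x y, par q x -> par r y -> Q x -> Q y -> Q (brk x y)) ->
  forall x, Q x.
Proof.
move=> sQ QH QX QY QQ x.
have : smallest (@subalgebra C g) generators x by rewrite gen.
move: x; apply: homog_ind => //; first exact: generators_homog.
by move=> x [[|]|] [i _ <-].
Qed.

Lemma gcomp_span x : lspan (\bigcup_k gcomp k) x.
Proof.
set S := lspan _; have sS : subspace S := subspace_lspan _.
have gS k : gcomp k `<=` S by move=> u Gu; apply: sub_lspan; exists k.
(* Generators map components to components, and the operators preserving [S] are closed under
   brackets by the Jacobi identity; so [S] is stable under all of [g]. *)
have ideal y u : S u -> S (brk y u).
  move: y u; apply: gen_ind.
  - split=> [u _|a u v Su Sv w Sw]; first by rewrite linear0l; exact: (subspace0 sS).
    by rewrite linearPl; apply: sS.2; [exact: Su|exact: Sv].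
  - by move=> h; apply: lspan_lin => // u [k _ Gu]; apply: (gS k); exact: brkH_gcomp.
  - by move=> i; apply: lspan_lin => // u [k _ Gu]; apply: (gS (k + 1)); exact: brkX_gcomp.
  - by move=> i; apply: lspan_lin => // u [k _ Gu]; apply: (gS (k - 1)); exact: brkY_gcomp.
  move=> q r y z Py Pz Sy Sz u Su.
  have -> : brk (brk y z) u = brk y (brk z u) - (-1) ^+ (q && r) *: brk z (brk y u).
    by rewrite (brk_jac _ Py Pz) addrK.
  apply: (subspaceB sS); first exact: (Sy _ (Sz _ Su)).
  by apply: (subspaceZ sS); exact: (Sz _ (Sy _ Su)).
move: x; apply: gen_ind => //.
- by move=> h; apply: (gS 0); exists h.
- by move=> i; apply: (gS 1); exact: wspan_gen.
- by move=> i; apply: (gS (-1)); exact: wspan_gen.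
- by move=> q r x y _ _ _; exact: ideal.
Qed.

Variable h0 : H.
Hypothesis h0E : forall j, (sroot H j h0 : C) = 1.

(** Distinct integers are distinct eigenvalues in characteristic 0, so this description of the
    principal grading yields the independence of its components. *)
Definition E k : set g := [set x | brk (emb g h0) x = (k%:~R : C) *: x].

Lemma subspace_E k : subspace (E k).
Proof.
split=> [|a u v]; rewrite /E /=; first by rewrite linear0 scaler0.
by rewrite linearPr => -> ->; lmod_ring C.
Qed.

Lemma E_brk k l x y : E k x -> E l y -> E (k + l) (brk x y).
Proof.
rewrite /E /= => Ex Ey; rewrite brk_jac_even; last exact: par_emb.
by rewrite Ex Ey linearZl_LR linearZr_LR rmorphD /= scalerDl.
Qed.

Lemma E_emb h : E 0 (emb g h).
Proof. by rewrite /E /= brk_emb scale0r. Qed.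

Lemma E_genX i : E 1 (genX g i).
Proof. by rewrite /E /= brk_embX h0E. Qed.

Lemma E_genY i : E (-1) (genY g i).
Proof. by rewrite /E /= brk_embY h0E rmorphN1 scale1r scaleN1r. Qed.

Lemma gcompE k : gcomp k `<=` E k.
Proof.
case: k => [[|m]|m]; first by move=> _ [h _ <-]; exact: E_emb.
  elim: m => [|m IH].
    by apply: wspan_ind0; [exact: subspace_E|exact: E_genX].
  apply: wspan_ind; first exact: subspace_E.
  by move=> i w /IH Ew; rewrite -[Posz m.+2]/(1 + Posz m.+1); apply: E_brk => //; exact: E_genX.
elim: m => [|m IH].
  by apply: wspan_ind0; [exact: subspace_E|exact: E_genY].
apply: wspan_ind; first exact: subspace_E.
move=> i w /IH Ew; rewrite -[Negz m.+1]/(-1 + Negz m).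
by apply: E_brk => //; exact: E_genY.
Qed.

Lemma E_pproj q k x : E k x -> E k (pproj g q x).
Proof.
rewrite /E /= => Ex; have := brk_pproj q (emb g h0) x.
rewrite Ex linearZ /= (pproj_id (par_emb _)) => ->.
by rewrite [pproj _ true _]pproj_eq0 ?linear0l ?addr0 //; exact: par_emb.
Qed.

Definition ES (S : set int) : set g := lspan (\bigcup_(k in S) E k).

Lemma subspace_ES S : subspace (ES S).
Proof. exact: subspace_lspan. Qed.

Lemma E_ES (S : set int) k : S k -> E k `<=` ES S.
Proof. by move=> Sk x Ex; apply: sub_lspan; exists k. Qed.

Lemma ES1 k : ES [set k] = E k.
Proof.
apply/seteqP; split; last exact: E_ES.
by apply: lspan_sub; [exact: subspace_E|move=> x [_ ->]].
Qed.

Lemma ES_ind (S : set int) (U : set g) : subspace U ->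
  (forall k x, S k -> E k x -> U x) -> ES S `<=` U.
Proof. by move=> sU HU; apply: lspan_sub => // x [k Sk Ex]; exact: HU Ex. Qed.

Lemma ES_setT x : ES setT x.
Proof.
have := gcomp_span x; move: x; apply: lspanS => x [k _ /gcompE Ex].
by exists k.
Qed.

Lemma ES_brk (S S' S'' : set int) x y :
  (forall k l, S k -> S' l -> S'' (k + l)) ->
  ES S x -> ES S' y -> ES S'' (brk x y).
Proof.
move=> SS Sx; move: y; apply: lspan_lin; first exact: subspace_ES.
move=> y [l S'l Ey]; move: x Sx; apply: ES_ind; first split.
- by rewrite /= linear0l; exact: (subspace0 (subspace_ES _)).
- by move=> a u v; rewrite /= linearPl; exact: (subspace_ES _).2.
by move=> k x Sk Ex; apply: (E_ES (SS _ _ Sk S'l)); exact: E_brk.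
Qed.

(** The product of the operators [ad h0 - k] for [k] in [s]: it kills the components with degree in
    [s] and acts on every other one by a nonzero scalar. *)
Definition annop (s : seq int) x : g :=
  foldr (fun k y => brk (emb g h0) y - (k%:~R : C) *: y) x s.

Lemma annopP s a x y : annop s (a *: x + y) = a *: annop s x + annop s y.
Proof.
elim: s => [//|k s IH] /=; rewrite IH linearPr.
by lmod_ring C.
Qed.

Lemma annop0 s : annop s 0 = 0.
Proof. by elim: s => [//|k s IH] /=; rewrite IH linear0 scaler0 subrr. Qed.

Lemma annop_brk s x : annop s (brk (emb g h0) x) = brk (emb g h0) (annop s x).
Proof. by elim: s => [//|k s IH] /=; rewrite IH linearBr linearZr_LR. Qed.

Lemma annop_cat s s' x : annop (s ++ s') x = annop s (annop s' x).
Proof. by rewrite /annop foldr_cat. Qed.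

Lemma annopC s s' x : annop s (annop s' x) = annop s' (annop s x).
Proof.
elim: s' x => [//|k s' IH] x /=.
by rewrite -[LHS]/(annop s (brk _ _ - _)) addrC -scaleNr annopP annop_brk IH scaleNr addrC.
Qed.

Lemma annop_E s k x : k \notin s -> E k x -> annop s x = 0 -> x = 0.
Proof.
move=> ks Ex; suff -> : annop s x = (\prod_(l <- s) (k - l)%:~R : C) *: x.
  move/eqP; rewrite scaler_eq0 prodf_seq_eq0 => /orP[/hasP[l ls]|/eqP //].
  rewrite /= intr_eq0 subr_eq0 => /eqP kl; by rewrite kl ls in ks.
elim: s {ks} => [|l s IH] /=; first by rewrite big_nil scale1r.
by rewrite IH linearZr_LR Ex big_cons rmorphB /=; lmod_ring C.
Qed.

Lemma annop_ES (S : set int) x : ES S x -> exists2 s, {in s, forall k, S k} & annop s x = 0.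
Proof.
move: x; apply: ES_ind; first split.
- by exists [::].
- move=> a u v [s Ss su] [s' Ss' sv]; exists (s ++ s').
    by move=> k; rewrite mem_cat => /orP[/Ss|/Ss'].
  by rewrite annopP !annop_cat sv annop0 addr0 annopC su annop0 scaler0.
move=> k x Sk Ex; exists [:: k] => [l|]; first by rewrite inE => /eqP->.
by rewrite /= Ex subrr.
Qed.

(** In place of a Bezout relation between polynomials without common root: the outermost factor puts
    the result of the remaining ones into a single eigenspace, where [annop s'] is injective. *)
Lemma annop_disjoint s s' x : {in s, forall k, k \notin s'} ->
  annop s x = 0 -> annop s' x = 0 -> x = 0.
Proof.
elim: s => [//|k s IH] ss' /= sx s'x; apply: IH => // [l ls|].
  by apply: ss'; rewrite inE ls orbT.
apply: (@annop_E s' k); first by apply: ss'; rewrite inE eqxx.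
  by apply/eqP; rewrite -subr_eq0; apply/eqP.
by rewrite annopC s'x annop0.
Qed.

Lemma ES_compl (S : set int) : complementary (ES S) (ES (~` S)).
Proof.
split; [exact: subspace_ES|exact: subspace_ES| |].
  move=> x /annop_ES[s Ss sx] /annop_ES[s' Ss' s'x].
  by apply: annop_disjoint sx s'x => k /Ss Sk; apply/negP => /Ss'.
move=> x; have := ES_setT x; move: x; apply: ES_ind; first split.
- exists 0; rewrite ?subr0; exact: (subspace0 (subspace_ES _)).
- move=> a x y [u Su Wu] [v Sv Wv]; exists (a *: u + v); first exact: (subspace_ES _).2.
  have -> : a *: x + y - (a *: u + v) = a *: (x - u) + (y - v) by lmod_ring C.
  exact: (subspace_ES _).2.
move=> k x _ Ex; have [Sk|nSk] := pselect (S k).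
  by exists x; rewrite ?subrr; [exact: (E_ES Sk)|exact: (subspace0 (subspace_ES _))].
by exists 0; rewrite ?subr0; [exact: (subspace0 (subspace_ES _))|exact: (E_ES nSk)].
Qed.

Definition pS S : {linear g -> g} := mklin (proj_is_linear (ES_compl S)).

Lemma pS_in S x : ES S (pS S x). Proof. by rewrite mklinE; exact: (proj_in (ES_compl S)). Qed.
Lemma pS_E (S : set int) k x : E k x -> pS S x = if `[<S k>] then x else 0.
Proof.
move=> Ex; rewrite mklinE; case: asboolP => Sk; first exact: (proj_id (ES_compl S) (E_ES Sk Ex)).
exact: (proj_eq0 (ES_compl S) (E_ES (Sk : (~` S) k) Ex)).
Qed.

Lemma E_eq_lin (V' : lmodType C) (f f' : {linear g -> V'}) :
  (forall k x, E k x -> f x = f' x) -> f =1 f'.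
Proof.
move=> ff x; have := ES_setT x; move: x; apply: ES_ind => [|k x _]; last exact: ff.
split=> [|a u v] /=; first by rewrite !linear0.
by rewrite !linearP => -> ->.
Qed.

Lemma pS_pproj S q x : pS S (pproj g q x) = pproj g q (pS S x).
Proof.
apply: (E_eq_lin (f := pS S \o pproj g q) (f' := pproj g q \o pS S)) => k {}x Ex /=.
rewrite (pS_E S Ex) (pS_E S (E_pproj q Ex)).
by case: ifP => _ //; rewrite linear0.
Qed.

Lemma pS_par S q x : par q x -> par q (pS S x).
Proof. by move=> Px; rewrite -[x](pproj_id Px) pS_pproj; exact: pproj_par. Qed.

(** The word spaces lie in the eigenspaces and together span everything; since the eigenspaces are
    independent, the inclusions are equalities. *)
Lemma E_gcomp k : E k = gcomp k.
Proof.
apply/seteqP; split; last exact: gcompE.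
have dec x : exists2 u, gcomp k u & ES (~` [set k]) (x - u).
  have := gcomp_span x; move: x; apply: lspan_sub; first split.
  - by exists 0; rewrite ?subr0; [exact: (subspace0 (subspace_gcomp _))|exact: (subspace0 (subspace_ES _))].
  - move=> a x y [u Su Wu] [v Sv Wv]; exists (a *: u + v); first exact: (subspace_gcomp _).2.
    have -> : a *: x + y - (a *: u + v) = a *: (x - u) + (y - v) by lmod_ring C.
    exact: (subspace_ES _).2.
  move=> x [l _ Gx]; have [<-|ne] := eqVneq l k.
    by exists x => //; rewrite subrr; exact: (subspace0 (subspace_ES _)).
  exists 0; first exact: (subspace0 (subspace_gcomp _)).
  rewrite subr0; apply: (@E_ES _ l); last exact: gcompE.
  by apply/eqP.
move=> x Ex; have [u Gu Wu] := dec x.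
have [_ _ d _] := ES_compl [set k].
suff /eqP : x - u = 0 by rewrite subr_eq0 => /eqP->.
apply: d => //; rewrite ES1; apply: (subspaceB (subspace_E k)) => //.
exact: gcompE.
Qed.

Lemma pdeg_E k : @pdeg C n A p H g k = E k.
Proof.
apply/seteqP; split=> x.
  elim=> {k x}.
  - exact: E_genX.
  - exact: E_genY.
  - exact: E_emb.
  - by move=> k; exact: (subspace0 (subspace_E k)).
  - by move=> k a x y _ Ex _ Ey; exact: (subspace_E k).2.
  - by move=> k l x y _ Ex _ Ey; exact: E_brk.
have sp l : subspace (@pdeg C n A p H g l) by split; [exact: Pdeg0|move=> a u v; exact: PdegD].
rewrite E_gcomp; case: k => [[|m]|m]; first by move=> [h _ <-]; exact: PdegH.
  elim: m x => [|m IH] x; first by apply: wspan_ind0 => // i; exact: PdegX.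
  apply: wspan_ind => // i w /IH; rewrite -[Posz m.+2]/(1 + Posz m.+1).
  by apply: PdegB; exact: PdegX.
elim: m x => [|m IH] x; first by apply: wspan_ind0 => // i; exact: PdegY.
apply: wspan_ind => // i w /IH; rewrite -[Negz m.+1]/(-1 + Negz m).
by apply: PdegB; exact: PdegY.
Qed.

Definition posdeg : set int := [set k : int | 0 < k].
Definition negdeg : set int := [set k : int | k < 0].

Lemma pi_plusE x : pi_plus x = pS posdeg x.
Proof.
have npos : [set k : int | k <= 0] = ~` posdeg.
  by apply/seteqP; split=> k /=; rewrite leNgt => /negP.
rewrite /pi_plus npos mklinE /proj /ES.
by do 2![rewrite (@eq_bigcupr _ _ _ _ E); last by move=> k _; rewrite pdeg_E].
Qed.

Lemma pi_minusE x : pi_minus x = x - pS posdeg x.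
Proof. by rewrite /pi_minus pi_plusE. Qed.

Lemma nplusE : @nplus C n A p H g = ES posdeg.
Proof.
apply/seteqP; split.
  apply: smallest_sub; first split; [exact: subspace_ES| |].
    by move=> x y; apply: ES_brk => k l; exact: addr_gt0.
  by move=> _ [i _ <-]; apply: (@E_ES _ 1) => //; exact: E_genX.
have [sn bn] : subalgebra (@nplus C n A p H g).
  split; first split.
  - by move=> U [[[U0 _] _] _].
  - by move=> a u v nu nv U [sU XU]; apply: sU.1.2; [exact: nu|exact: nv].
  - by move=> u v nu nv U [sU XU]; apply: sU.2; [exact: nu|exact: nv].
have nX i : @nplus C n A p H g (genX g i) by apply: sub_gen_smallest; exists i.
apply: ES_ind => // [] [[|m]|m] // x _; rewrite E_gcomp /=.
elim: m x => [|m IH] x; first exact: wspan_ind0.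
by apply: wspan_ind => // i w /IH; exact: bn.
Qed.

Lemma nminusE : @nminus C n A p H g = ES negdeg.
Proof.
apply/seteqP; split.
  apply: smallest_sub; first split; [exact: subspace_ES| |].
    by move=> x y; apply: ES_brk => k l; rewrite /negdeg /= => k0 l0; rewrite -[0]addr0 ltrD.
  by move=> _ [i _ <-]; apply: (@E_ES _ (-1)) => //; exact: E_genY.
have [sn bn] : subalgebra (@nminus C n A p H g).
  split; first split.
  - by move=> U [[[U0 _] _] _].
  - by move=> a u v nu nv U [sU XU]; apply: sU.1.2; [exact: nu|exact: nv].
  - by move=> u v nu nv U [sU XU]; apply: sU.2; [exact: nu|exact: nv].
have nX i : @nminus C n A p H g (genY g i) by apply: sub_gen_smallest; exists i.
apply: ES_ind => // [] [[|m]|m] // x _; rewrite E_gcomp /=.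
elim: m x => [|m IH] x; first exact: wspan_ind0.
by apply: wspan_ind => // i w /IH; exact: bn.
Qed.

Hypothesis emb_inj : injective (emb g).

Local Notation rspace := (@root_space C n A p H g).

Lemma word_root (z : 'I_n -> g) (r : 'I_n -> 'Hom(H, C^o)) m x :
  (forall i, rspace (r i) (z i)) -> x \in words z m ->
  exists f, rspace f x.
Proof.
move=> rz; elim: m x => [|m IH] x; first by case/mapP=> i _ ->; exists (r i).
case/allpairsP=> [[i w] [_ /= /IH[l lw] ->]]; exists (r i + l) => h.
rewrite brk_jac_even; last exact: par_emb.
by rewrite lw rz linearZl_LR linearZr_LR add_lfunE scalerDl.
Qed.

Lemma rspace_genX i : rspace (sroot H i) (genX g i).
Proof. by move=> h; rewrite brk_embX. Qed.

Lemma rspace_genY i : rspace (- sroot H i) (genY g i).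
Proof. by move=> h; rewrite brk_embY opp_lfunE scaleNr. Qed.

Lemma E_emb_brk k h x : E k x -> E k (brk (emb g h) x).
Proof. by move=> Ex; rewrite -[k]add0r; apply: E_brk => //; exact: E_emb. Qed.

Definition roots_span : set g :=
  lspan (\bigcup_(f in @is_root C n A p H g) rspace f).

(** The degree-0 part [u] of a root vector lies in the Cartan subalgebra, so [ad h] kills it; it
    also multiplies it by [l h], and some [l h] is nonzero, so [u] vanishes. Conversely words are
    weight vectors, and a nonzero word of nonzero degree has nonzero weight because [h0] detects the
    degree. *)
Lemma roots_spanE : roots_span = ES (~` [set 0]).
Proof.
have [_ sW d dec] := ES_compl [set 0]; apply/seteqP; split.
  apply: lspan_sub => // x [l [l0 _] lx].
  have [u] := dec x; rewrite ES1 => Eu Wxu.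
  have uh h : brk (emb g h) u = 0.
    by move: Eu; rewrite E_gcomp => -[h' _ <-]; exact: brk_emb.
  have [h lh] : exists h, (l h : C) != 0.
    apply: contrapT => nl; case/negP: l0; apply/eqP/lfunP => h.
    rewrite zero_lfunE; apply/eqP/negP => /negP lh; apply: nl; by exists h.
  have Wh : ES (~` [set 0]) (brk (emb g h) (x - u)).
    apply: (@ES_brk [set 0] (~` [set 0])) Wxu; last by rewrite ES1; exact: E_emb.
    by move=> k m ->; rewrite add0r.
  suff u0 : u = 0 by rewrite -[x]subr0 -u0.
  have /eqP : (l h : C) *: u = 0.
    apply: d; first by rewrite ES1; apply: (subspaceZ (subspace_E 0)).
    rewrite -[_ *: u]opprK; apply: (subspaceN sW).
    have -> : - ((l h : C) *: u) = (l h : C) *: (x - u) - brk (emb g h) (x - u).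
      by rewrite linearBr uh lx; lmod_ring C.
    by apply: (subspaceB sW) => //; exact: (subspaceZ sW).
  by rewrite scaler_eq0 (negbTE lh) => /eqP.
apply: ES_ind; first exact: subspace_lspan.
move=> k x k0; rewrite -[E k]ES1.
have rootw (z : 'I_n -> g) r m w l : (forall i, rspace (r i) (z i)) -> l != 0 ->
    wspan z m `<=` E l -> w \in words z m -> roots_span w.
  move=> rz l0 El wm; have [f fw] := word_root rz wm.
  have [->|w0] := eqVneq w 0; first exact: (subspace0 (subspace_lspan _)).
  apply: sub_lspan; exists f => //; split; last by exists w.
  apply/eqP => f0; have := El _ (sub_lspan wm); rewrite /E /= fw f0 zero_lfunE.
  by move/esym/eqP; rewrite scale0r scaler_eq0 intr_eq0 (negbTE l0) (negbTE w0).
rewrite ES1 E_gcomp; case: k k0 => [[|m]|m] //= _; move: x;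
  (apply: lspan_sub; first exact: subspace_lspan) => w wm.
  by apply: (rootw _ _ _ _ (Posz m.+1) rspace_genX _ _ wm) => //; exact: (@gcompE (Posz m.+1)).
by apply: (rootw _ _ _ _ (Negz m) rspace_genY _ _ wm) => //; exact: (@gcompE (Negz m)).
Qed.

Lemma cartan_partP x : roots_span (x - emb g (cartan_part x)).
Proof.
have [_ _ _ /(_ x)[u]] := ES_compl [set 0]; rewrite ES1 E_gcomp => -[h _ <-] W.
apply: (@xgetPex _ 0 [set h | roots_span (x - emb g h)]); exists h.
by rewrite /= roots_spanE.
Qed.

Lemma cartan_part_uniq x h : roots_span (x - emb g h) -> cartan_part x = h.
Proof.
have [_ sW d _] := ES_compl [set 0]; have := cartan_partP x; rewrite roots_spanE => W1 W2.
apply/emb_inj/eqP; rewrite -subr_eq0; apply/eqP/d.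
  by rewrite ES1; apply: (subspaceB (subspace_E 0)); exact: E_emb.
have -> : emb g (cartan_part x) - emb g h =
  (x - emb g h) - (x - emb g (cartan_part x)) by lmod_ring C.
exact: (subspaceB sW).
Qed.

Lemma cartan_partE h x : roots_span x -> cartan_part (emb g h + x) = h.
Proof. by move=> Wx; apply: cartan_part_uniq; rewrite addrC addKr. Qed.

Lemma cartan_part_linear : linear (@cartan_part C n A p H g).
Proof.
move=> a x y; apply: cartan_part_uniq; rewrite linearP.
have -> : a *: x + y - (a *: emb g (cartan_part x) + emb g (cartan_part y)) =
  a *: (x - emb g (cartan_part x)) + (y - emb g (cartan_part y)) by lmod_ring C.
apply: (subspaceD (subspace_lspan _)); last exact: cartan_partP.
apply: (subspaceZ (subspace_lspan _)); exact: cartan_partP.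
Qed.

Lemma ext0_linear (l : 'Hom(H, C^o)) : linear (ext0 l : g -> C^o).
Proof. by move=> a x y; rewrite /ext0 cartan_part_linear linearP. Qed.

Lemma ext0_emb (l : 'Hom(H, C^o)) h : ext0 l (emb g h) = l h.
Proof.
rewrite /ext0 -[emb g h]addr0 cartan_partE //.
exact: (subspace0 (subspace_lspan _)).
Qed.

Lemma ext0_roots (l : 'Hom(H, C^o)) x : roots_span x -> ext0 l x = 0.
Proof.
by move=> Wx; rewrite /ext0 -[x]add0r -(linear0 (emb g)) cartan_partE // linear0.
Qed.

Lemma ext0_E (l : 'Hom(H, C^o)) k x : k != 0 -> E k x -> ext0 l x = 0.
Proof. by move=> k0 Ex; apply: ext0_roots; rewrite roots_spanE; apply: E_ES Ex; apply/eqP. Qed.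

(** * Invariant forms and consistent anti-involutions *)

Section InvariantForm.
Variable B : {biscalar g}.
Hypothesis Binv : forall x y z, B (brk x y) z = B x (brk y z).

(** Invariance under [h0] gives [(k + l) * B x y = 0]. *)
Lemma form_E k l x y : k + l != 0 -> E k x -> E l y -> B x y = 0.
Proof.
move=> kl Ex Ey; have := Binv x (emb g h0) y.
rewrite Ey linearZr_LR -[brk x _]opprK -brk_skew_even; last exact: par_emb.
rewrite Ex linearNl linearZl_LR /= => /eqP.
rewrite eq_sym -subr_eq0 opprK -mulrDl -rmorphD /= mulf_eq0 intr_eq0 addrC.
by rewrite (negbTE kl) => /eqP.
Qed.

Lemma form_ES (S S' : set int) x y : (forall k l, S k -> S' l -> k + l != 0) ->
  ES S x -> ES S' y -> B x y = 0.
Proof.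
move=> SS Sx; move: y; apply: ES_ind => [|l y S'l Ey].
  split=> [|a u v]; first by rewrite linear0r.
  by rewrite linearPr => -> ->; rewrite /= mulr0 addr0.
move: x Sx; apply: ES_ind => [|k x Sk Ex]; last exact: (form_E (SS _ _ Sk S'l)).
split=> [|a u v] /=; first by rewrite linear0l.
by rewrite linearPl => -> ->; rewrite /= mulr0 addr0.
Qed.

Hypothesis Bnd : forall x, (forall y, B x y = 0) -> x = 0.
Variable w : g -> g.
Hypothesis w_anti : conj_anti_involution w.
Hypothesis w_cons : consistent w.

Lemma anti_add x y : w (x + y) = w x + w y.
Proof. by case: w_anti => P _ _; have := P 1 x y; rewrite !scale1r conjC1 scale1r. Qed.

Lemma anti0 : w 0 = 0.
Proof. by apply: (addrI (w 0)); rewrite -anti_add !addr0. Qed.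

Lemma antiZ a x : w (a *: x) = a^* *: w x.
Proof. by case: w_anti => P _ _; have := P a x 0; rewrite anti0 !addr0. Qed.

Lemma is_root_opp (l : 'Hom(H, C^o)) : @is_root C n A p H g l -> @is_root C n A p H g (- l).
Proof.
move=> rl; have [l0 [x lx x0]] := rl; split; first by rewrite oppr_eq0.
exists (w x); first by rewrite -w_cons //; exists x.
case: w_anti => _ wK _; by rewrite -[0]anti0 (inj_eq (inv_inj wK)).
Qed.

Lemma anti_roots x : roots_span x -> roots_span (w x).
Proof.
have sW := subspace_lspan (\bigcup_(f in @is_root C n A p H g) rspace f).
move: x; apply: lspan_sub; first split.
- by rewrite anti0; exact: (subspace0 sW).
- by move=> a u v; rewrite anti_add antiZ; exact: sW.2.
move=> x [l rl lx]; apply: sub_lspan; exists (- l); first exact: is_root_opp.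
by rewrite -w_cons //; exists x.
Qed.

(** Consistency speaks of root spaces only. It implies that [u], the image of [h], acts on each root
    space by a scalar; invariance then makes [brk h0 u] orthogonal to the root vectors and to the
    Cartan subalgebra. By nondegeneracy [u] has degree 0. *)
Lemma anti_emb h : range (emb g) (w (emb g h)).
Proof.
have [_ wK wB] := w_anti; set u := w (emb g h).
have uy (l : 'Hom(H, C^o)) y : @is_root C n A p H g l -> rspace l y ->
    brk u y = ((l h)^* : C) *: y.
  move=> rl ly; have [y' ly' <-] : exists2 y', rspace (- l) y' & w y' = y.
    by exists (w y); rewrite ?wK // -w_cons //; exists y.
  rewrite -wB -[brk y' _]opprK -brk_skew_even; last exact: par_emb.
  by rewrite ly' opp_lfunE scaleNr opprK antiZ.
rewrite -[range _]/(gcomp 0) -E_gcomp /E /= scale0r; apply: Bnd => z.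
have [_ _ _ /(_ z)[e]] := ES_compl [set 0]; rewrite ES1 E_gcomp -roots_spanE => -[h' _ <-] W.
rewrite -[z](subrK (emb g h')) linearDr /=.
suff [e1 e2] : (B (brk (emb g h0) u) (z - emb g h') = 0) /\
    (B (brk (emb g h0) u) (emb g h') = 0) by rewrite e1 e2 addr0.
split.
  move: (z - _) W; apply: lspan_sub => [|y [l rl ly]].
    split=> [|a v v'] /=; first by rewrite linear0r.
    by rewrite linearPr => -> ->; rewrite /= mulr0 addr0.
  rewrite Binv (uy l) // linearZr_LR /=.
  suff -> : B (emb g h0) y = 0 by rewrite mulr0.
  apply: (@form_ES [set 0] (~` [set 0])).
  - by move=> k m -> /eqP; rewrite add0r.
  - by rewrite ES1; exact: E_emb.
  - by rewrite -roots_spanE; apply: sub_lspan; exists l.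
rewrite brk_skew_even; last exact: par_emb.
by rewrite linearNl Binv brk_emb linear0r oppr0.
Qed.

Lemma genX_neq0 i : genX g i != 0.
Proof.
have fr : free [tuple coroot H i | i < n] by case: H.
apply/eqP => X0; have := brk_XY i i; rewrite X0 linear0l eqxx.
rewrite -(linear0 (emb g)) => /esym/emb_inj h0'.
have := free_not0 fr (mem_nth 0 _); rewrite size_tuple => /(_ i (ltn_ord i)).
by rewrite (nth_mktuple _ _ i) h0' eqxx.
Qed.

Lemma is_root_sroot i : @is_root C n A p H g (sroot H i).
Proof.
split; last by exists (genX g i); [exact: rspace_genX|exact: genX_neq0].
apply/eqP => s0; have := h0E i; rewrite s0 zero_lfunE => /eqP.
by rewrite eq_sym oner_eq0.
Qed.

Lemma lspan_nth (V : lmodType C) (z : 'I_n -> V) (x : V) :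
  lspan [set` [seq z i | i <- enum 'I_n]] x -> exists c : 'I_n -> C, x = \sum_i c i *: z i.
Proof.
move=> Sx; apply: lspan_ranged; move: Sx; apply: lspanS => y /= /mapP[i _ ->].
by exists i.
Qed.

(** Being of degree -1, [x] is a combination of the [genY g j], and an element of the Cartan
    subalgebra dual to [sroot H i] isolates the term of index [i]. *)
Lemma rspace_oppE i x : rspace (- sroot H i) x -> exists c : C, x = c *: genY g i.
Proof.
move=> lx; have : E (-1) x by rewrite /E /= lx opp_lfunE h0E rmorphN1.
rewrite E_gcomp => /lspan_nth[c xE]; exists (c i).
have [h hE] := sroot_dual (fun j => (j == i)%:R).
have := lx h; rewrite opp_lfunE hE eqxx scaleN1r {1}xE linear_sumr => e.
rewrite -[x]opprK -e -sumrN (bigD1 i) //= big1 ?addr0.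
  by rewrite linearZr_LR /= brk_embY hE eqxx scale1r scalerN opprK.
by move=> j ji; rewrite linearZr_LR /= brk_embY hE (negbTE ji) scale0r oppr0 scaler0 oppr0.
Qed.

Lemma anti_genX i : exists c : C, w (genX g i) = c *: genY g i.
Proof.
apply: rspace_oppE; rewrite -w_cons; last exact: is_root_sroot.
by exists (genX g i) => //; exact: rspace_genX.
Qed.

Lemma anti_genY i : exists c : C, w (genY g i) = c *: genX g i.
Proof.
have [_ wK _] := w_anti; have [c wX] := anti_genX i.
have c0 : c != 0.
  apply/eqP => c0; have := genX_neq0 i.
  by rewrite -[genX g i]wK wX c0 scale0r anti0 eqxx.
exists ((c^* )^-1); rewrite -[X in _ *: X]wK wX antiZ scalerA mulVf ?scale1r //.
by rewrite conjC_eq0.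
Qed.

(** Parity is not mentioned in [conj_anti_involution]; it is preserved because [w] maps the Cartan
    subalgebra to itself and exchanges, up to scalars, [genX g i] and [genY g i], which have equal
    parity. Brackets propagate this. *)
Lemma anti_par q x : par q x -> par q (w x).
Proof.
have [_ wK wB] := w_anti.
suff H' : forall q, par q (w (pproj g q x)) by move=> /pproj_id {1}<-.
move: {q} x; apply: gen_ind.
- split=> [q|a u v Pu Pv q]; first by rewrite linear0 anti0; exact: (subspace0 (par_sub _ _)).
  by rewrite linearP anti_add antiZ; exact: (par_sub _ _).2.
- move=> h [].
    by rewrite pproj_eq0 ?anti0; [exact: (subspace0 (par_sub _ _))|exact: par_emb].
  by rewrite pproj_id; [have [h' _ <-] := anti_emb h; exact: par_emb|exact: par_emb].
- move=> i q; have [<-|ne] := eqVneq (p i) q.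
    rewrite pproj_id; last exact: par_genX.
    by have [c ->] := anti_genX i; apply: (subspaceZ (par_sub _ _)); exact: par_genY.
  by rewrite (pproj_neq (par_genX _) ne) anti0; exact: (subspace0 (par_sub _ _)).
- move=> i q; have [<-|ne] := eqVneq (p i) q.
    rewrite pproj_id; last exact: par_genY.
    by have [c ->] := anti_genY i; apply: (subspaceZ (par_sub _ _)); exact: par_genX.
  by rewrite (pproj_neq (par_genY _) ne) anti0; exact: (subspace0 (par_sub _ _)).
move=> q r x y _ _ Px Py s; rewrite brk_pproj anti_add !wB.
apply: (subspaceD (par_sub _ _)).
  by have := brk_par (Py s) (Px false); rewrite addbF.
by have := brk_par (Py (~~ s)) (Px true); rewrite addbT negbK.
Qed.

Lemma ext0_anti (l : 'Hom(H, C^o)) x : omega_real w l -> ext0 l x = (ext0 l (w x))^*.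
Proof.
move=> lr; rewrite {1}/ext0 (lr (cartan_part x)); congr (_^*).
have -> : w x = w (emb g (cartan_part x)) + w (x - emb g (cartan_part x)).
  by rewrite -anti_add addrC subrK.
have := ext0_linear l 1 (w (emb g (cartan_part x))) (w (x - emb g (cartan_part x))).
by rewrite !scale1r => ->; rewrite [X in _ + X](ext0_roots _ (anti_roots (cartan_partP x))) addr0.
Qed.

End InvariantForm.
End Chevalley.

(** * The supertrace cocycle *)

Section Cocycle.
Variables (C : numClosedFieldType) (n : nat) (A : 'M[C]_n) (p : 'I_n -> bool).
Variables (H : realization A) (g : chevalleyAlg p H).
Hypothesis gen : smallest (@subalgebra C g) (@generators C n A p H g) = setT.
Variable h0 : H.
Hypothesis h0E : forall j, (sroot H j h0 : C) = 1.
Hypothesis emb_inj : injective (emb g).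
Implicit Types (x y z v : g) (k l m : int) (a b c : bool).

Local Notation E := (@E C n A p H g h0).
Local Notation ES := (@ES C n A p H g h0).
Local Notation P := (@pS C n A p H g gen h0 h0E posdeg).
Local Notation Q := (@pS C n A p H g gen h0 h0E (~` posdeg)).

Lemma pospE k x : E k x -> P x = if 0 < k then x else 0.
Proof.
move=> Ex; rewrite (pS_E gen h0E _ Ex); case: asboolP => [/= -> //|].
by rewrite /posdeg /=; case: ifP.
Qed.

Lemma nonpospE k x : E k x -> Q x = if 0 < k then 0 else x.
Proof.
move=> Ex; rewrite (pS_E gen h0E _ Ex); case: asboolP => nk; case: ifP => k0 //.
by case: nk => /= k1; rewrite /posdeg /= k0 in k1.
Qed.

Lemma nonposp v : Q v = v - P v.
Proof.
have lf : linear (fun v : g => v - P v).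
  by move=> a u u'; rewrite linearP; lmod_ring C.
rewrite -[RHS](mklinE lf); move: v; apply: (E_eq_lin gen h0E) => k v Ev.
rewrite mklinE (nonpospE Ev) (pospE Ev).
by case: ifP; rewrite ?subrr ?subr0.
Qed.

Lemma pospK v : P (P v) = P v.
Proof.
apply: (E_eq_lin gen h0E (f := P \o P) (f' := P)) => k {}v Ev.
by rewrite /= (pospE Ev); case: ifP => // k0; rewrite ?linear0 // (pospE Ev) k0.
Qed.

(** For [y] of degree [k], a positive degree [j] is sent to a nonpositive one only if [j <= |k|],
    and the components of these degrees are finite-dimensional. *)
Lemma frank_nonposp y : frank (fun v => Q (brk y (P v))).
Proof.
have := ES_setT gen h0E y; move: y; apply: ES_ind; first split.
- have := @frank0 C g; congr frank; apply/funext => v.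
  by rewrite linear0l linear0.
- move=> a u v fu fv; have := frank_lin a fu fv; congr frank.
  by apply/funext => w; rewrite linearPl linearP.
move=> k y _ Ey; pose S := [set j : int | (0 < j) && (j <= `|k|)].
pose pS1 := @pS C n A p H g gen h0 h0E S.
have -> : (fun v => Q (brk y (P v))) = (Q \o brk y) \o pS1.
  apply/funext => v; move: v.
  apply: (E_eq_lin gen h0E (f := Q \o brk y \o P) (f' := Q \o brk y \o pS1)) => l v Ev /=.
  rewrite (pospE Ev) /pS1 (pS_E gen h0E S Ev).
  case: asboolP; rewrite /S /=; first by case/andP=> ->.
  case: ifP => // l0 /negP lk; rewrite !linear0 (nonpospE (E_brk Ey Ev)).
  by case: ifP => //; lia.
apply: (@frank_compl _ _ (Q \o brk y)).
apply: (@frank_span _ _ (flatten [seq words (genX g) j | j <- iota 0 `|k|])).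
move=> v; have := @pS_in C n A p H g gen h0 h0E S v; move: (pS1 v); apply: ES_ind.
  exact: subspace_lspan.
move=> [[|j]|j] // u; rewrite /S /= => jk; rewrite (E_gcomp gen h0E) /=.
apply: lspanS => w /= ww; apply/flattenP; exists (words (genX g) j) => //.
by apply: map_f; rewrite mem_iota; lia.
Qed.

(** A Toeplitz-type compression of [ad x] to the positive part. The operator [compr] measures its
    failure to be multiplicative, see [comprE]. *)
Definition toep x : {linear g -> g} := P \o brk x \o P.
Lemma toepPl r x y v : toep (r *: x + y) v = r *: toep x v + toep y v.
Proof. by rewrite /= linearPl linearP. Qed.

Definition compr x y : {linear g -> g} := P \o brk x \o Q \o brk y \o P.

Lemma comprPl r x x' y v :
  compr (r *: x + x') y v = r *: compr x y v + compr x' y v.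
Proof. by rewrite /= linearPl (linearP P). Qed.

Lemma comprPr r x y y' v :
  compr x (r *: y + y') v = r *: compr x y v + compr x y' v.
Proof. by rewrite /= linearPl (linearP Q) linearPr (linearP P). Qed.

Lemma frank_cmp x y : frank (compr x y).
Proof. exact: (frank_compl (P \o brk x) (frank_nonposp y)). Qed.

Lemma comprE x y v : compr x y v = P (brk x (brk y (P v))) - toep x (toep y v).
Proof. by rewrite /= nonposp linearBr linearB /= pospK. Qed.

Fact superc_subproof a b x y :
  linear (fun v => compr x y v - (-1) ^+ (a && b) *: compr y x v).
Proof.
by move=> r u v; rewrite (linearP (compr x y)) (linearP (compr y x)); lmod_ring C.
Qed.

(** The parities are arguments because the sign needs them and 0 does not determine its own. By
    [superc_toep] this is the curvature of [toep]: [toep] of the bracket minus the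
    supercommutator. *)
Definition superc a b x y : {linear g -> g} := mklin (superc_subproof a b x y).

Lemma supercE a b x y v :
  superc a b x y v = compr x y v - (-1) ^+ (a && b) *: compr y x v.
Proof. exact: mklinE. Qed.

Lemma frank_superc a b x y : frank (superc a b x y).
Proof.
have := frank_lin (- (-1) ^+ (a && b)) (frank_cmp y x) (frank_cmp x y).
by congr frank; apply/funext => v; rewrite supercE scaleNr addrC.
Qed.

Lemma superc_toep a b x y v : par a x -> par b y ->
  superc a b x y v = toep (brk x y) v - toep x (toep y v)
    + (-1) ^+ (a && b) *: toep y (toep x v).
Proof.
move=> Px Py; rewrite supercE !comprE.
have -> : toep (brk x y) v = P (brk x (brk y (P v)))
    - (-1) ^+ (a && b) *: P (brk y (brk x (P v))).
  by rewrite -linearZ -linearB (brk_jac _ Px Py) addrK.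
by lmod_ring C.
Qed.

Fact parop_subproof : linear (fun v => pproj g false v - pproj g true v).
Proof. by move=> r u v; rewrite !(linearP (pproj g _)); lmod_ring C. Qed.

(** The parity sign as an operator: composing with it turns [ftr] into the supertrace. *)
Definition parop : {linear g -> g} := mklin parop_subproof.

Lemma paropE v : parop v = pproj g false v - pproj g true v.
Proof. exact: mklinE. Qed.

Lemma parop_par a v : par a v -> parop v = (-1) ^+ a *: v.
Proof.
case: a => Pv; rewrite paropE.
  by rewrite (@pproj_eq0 _ _ false _ Pv) (pproj_id Pv) sub0r scaleN1r.
by rewrite (@pproj_eq0 _ _ true _ Pv) (pproj_id Pv) subr0 scale1r.
Qed.

Lemma par_eq_lin (V' : lmodType C) (f f' : {linear g -> V'}) :
  (forall a v, par a v -> f v = f' v) -> f =1 f'.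
Proof.
by move=> ff v; rewrite -[v]pprojD !linearD !(ff _ _ (pproj_par _ _)).
Qed.

Lemma toep_parop a x v : par a x -> toep x (parop v) = (-1) ^+ a *: parop (toep x v).
Proof.
have lr : linear (fun v => (-1) ^+ a *: parop (toep x v)).
  by move=> r u u'; rewrite (linearP (toep x)) (linearP parop); lmod_ring C.
move=> Px; rewrite -[RHS](mklinE lr) -[LHS]/((toep x \o parop) v).
move: v; apply: par_eq_lin => b v Pv.
have PT : par (a (+) b) (toep x v).
  by apply: pS_par; exact: (brk_par Px (pS_par gen h0E _ Pv)).
rewrite mklinE -[LHS]/(toep x (parop v)) (parop_par Pv) (linearZ_LR (toep x)).
by rewrite (parop_par PT) scalerA -signr_addb addKb.
Qed.

(* [parop] being the parity sign, this is the supertrace of a supercommutator. *)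
Lemma str_comm a x (K : {linear g -> g}) : par a x -> frank K ->
  ftr (fun v => parop (toep x (K v)) - (-1) ^+ a *: parop (K (toep x v))) = 0.
Proof.
move=> Px fK; have f1 : frank (fun v => parop (toep x (K v))).
  exact: (frank_compl (parop \o toep x)).
have f2 : frank (fun v => parop (K v)) by exact: (frank_compl parop).
have := ftr_lin (- (-1) ^+ a) (frank_compr (toep x) f2) f1.
rewrite (ftrC (toep x) f2).
have -> : ftr (toep x \o (fun v => parop (K v))) =
    (-1) ^+ a * ftr (fun v => parop (toep x (K v))).
  by rewrite -ftrZ //; apply: eq_ftr => v; rewrite [LHS](toep_parop _ Px).
rewrite mulrA mulNr -signr_addb addbb mulN1r addNr => e; rewrite -[RHS]e.
by apply: eq_ftr => v; rewrite scaleNr addrC.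
Qed.

Definition psi a b x y : C := ftr (parop \o superc a b x y).

(** An odd operator anticommutes with [parop], so by cyclicity its supertrace is its own
    negative. *)
Lemma psi_odd a b x y : par a x -> par b y -> a (+) b -> psi a b x y = 0.
Proof.
move=> Px Py ab; have fK := frank_superc a b x y.
have : psi a b x y = - psi a b x y.
  rewrite {1}/psi -(ftrC parop fK) /psi -mulN1r -ftrZ; last exact: frank_compl.
  apply: eq_ftr => v /=.
  have lr : linear (fun v => -1 *: parop (superc a b x y v)).
    by move=> r u u'; rewrite (linearP (superc a b x y)) (linearP parop); lmod_ring C.
  rewrite -[RHS](mklinE lr) -[LHS]/((superc a b x y \o parop) v).
  move: v; apply: par_eq_lin => c v Pv; rewrite mklinE.
  rewrite -[LHS]/(superc a b x y (parop v)) (parop_par Pv) (linearZ_LR (superc a b x y)).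
  have Pc u u' d d' : par d u -> par d' u' -> par (d (+) (d' (+) c)) (compr u u' v).
    move=> Pu Pu'; apply: pS_par; apply: brk_par => //; apply: pS_par.
    by apply: brk_par => //; exact: pS_par.
  have PK : par (~~ c) (superc a b x y v).
    rewrite supercE; apply: (subspaceB (par_sub _ _)).
      by have := Pc _ _ _ _ Px Py; rewrite addbA ab addTb.
    apply: (subspaceZ (par_sub _ _)).
    by have := Pc _ _ _ _ Py Px; rewrite addbA [b (+) a]addbC ab addTb.
  by rewrite (parop_par PK) scalerA mulN1r signrN opprK.
move/eqP; rewrite -addr_eq0 -mulr2n -mulr_natr mulf_eq0 pnatr_eq0 orbF.
by move/eqP.
Qed.

Lemma psi_linl a b r x x' y :
  psi a b (r *: x + x') y = r * psi a b x y + psi a b x' y.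
Proof.
rewrite /psi -ftr_lin; try exact/frank_compl/frank_superc.
apply: eq_ftr => v /=; rewrite !supercE -linearP; congr (parop _).
rewrite comprPl comprPr.
by lmod_ring C.
Qed.

Lemma psi_skew a b x y : psi a b x y = - ((-1) ^+ (a && b) * psi b a y x).
Proof.
rewrite /psi -mulNr -ftrZ; last exact/frank_compl/frank_superc.
apply: eq_ftr => v; rewrite /= -linearZ; congr (parop _).
rewrite !supercE [b && a]andbC.
by case: (a && b); rewrite ?expr0 ?expr1; lmod_ring C.
Qed.

Lemma psi_linr a b r x y y' :
  psi a b x (r *: y + y') = r * psi a b x y + psi a b x y'.
Proof. by rewrite !(psi_skew a b x) psi_linl; ring. Qed.

(** A Bianchi identity for the curvature of [toep]: the three curvature terms combine into
    supercommutators with [toep], whose supertraces vanish by [str_comm]. *)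
Lemma psi_jac a b c x y z : par a x -> par b y -> par c z ->
  psi (a (+) b) c (brk x y) z =
  psi a (b (+) c) x (brk y z) - (-1) ^+ (a && b) * psi b (a (+) c) y (brk x z).
Proof.
move=> Px Py Pz; have Pxy := brk_par Px Py; have Pyz := brk_par Py Pz.
have Pxz := brk_par Px Pz.
have [odd|] := boolP (a (+) b (+) c).
  rewrite (psi_odd Pxy Pz) // (psi_odd Px Pyz) ?addbA //.
  by rewrite (psi_odd Py Pxz) ?mulr0 ?subrr // addbCA addbA.
(* For even total parity [c] is the sum of [a] and [b]; after this substitution all signs are
   settled by the cases of [a] and [b]. *)
rewrite -[a (+) b (+) c]/((a (+) b) (+) c) negb_add => /eqP ec.
have fr u v d e : frank (fun w => parop (superc d e u v w)).
  exact: (frank_compl parop (frank_superc _ _ _ _)).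
pose D (d : bool) w (K : {linear g -> g}) v :=
  parop (toep w (K v)) - (-1) ^+ d *: parop (K (toep w v)).
have fD (d : bool) w (K : {linear g -> g}) : frank K -> frank (D d w K).
  move=> fK; have := frank_lin (- (-1) ^+ d) (frank_compl parop (frank_compr (toep w) fK))
    (frank_compl (parop \o toep w) fK).
  by congr frank; apply/funext => v; rewrite scaleNr addrC.
pose K12 := superc a b x y; pose K23 := superc b c y z; pose K13 := superc a c x z.
have key v : 1 *: parop (superc (a (+) b) c (brk x y) z v) +
    (-1 *: parop (superc a (b (+) c) x (brk y z) v)
     + (-1) ^+ (a && b) *: parop (superc b (a (+) c) y (brk x z) v)) =
  (-1) ^+ c *: D c z K12 v + (1 *: D a x K23 v + - (-1) ^+ (a && b) *: D b y K13 v).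
  rewrite /D /K12 /K23 /K13.
  rewrite (superc_toep _ Pxy Pz) (superc_toep _ Px Pyz) (superc_toep _ Py Pxz).
  rewrite !(superc_toep _ Px Py) !(superc_toep _ Py Pz) !(superc_toep _ Px Pz).
  have -> : toep (brk x (brk y z)) v = toep (brk (brk x y) z) v +
      (-1) ^+ (a && b) *: toep (brk y (brk x z)) v.
    by rewrite (brk_jac _ Px Py) addrC toepPl addrC.
  (* Only linearity matters from here on, so the operators become abstract linear maps. *)
  rewrite -ec; move: (toep x) (toep y) (toep z) (toep (brk x y)) (toep (brk y z))
    (toep (brk x z)) (toep (brk (brk x y) z) v) (toep (brk y (brk x z)) v)
    parop => tx ty tz txy tyz txz t1 t2 e.
  have eB u w : e (u - w) = e u - e w := linearB e u w.
  have eD u w : e (u + w) = e u + e w := linearD e u w.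
  have eZ r u : e (r *: u) = r *: e u := linearZ_LR e r u.
  have xB u w : tx (u - w) = tx u - tx w := linearB tx u w.
  have xD u w : tx (u + w) = tx u + tx w := linearD tx u w.
  have xZ r u : tx (r *: u) = r *: tx u := linearZ_LR tx r u.
  have yB u w : ty (u - w) = ty u - ty w := linearB ty u w.
  have yD u w : ty (u + w) = ty u + ty w := linearD ty u w.
  have yZ r u : ty (r *: u) = r *: ty u := linearZ_LR ty r u.
  have zB u w : tz (u - w) = tz u - tz w := linearB tz u w.
  have zD u w : tz (u + w) = tz u + tz w := linearD tz u w.
  have zZ r u : tz (r *: u) = r *: tz u := linearZ_LR tz r u.
  rewrite !(eB, eD, eZ, xB, xD, xZ, yB, yD, yZ, zB, zD, zZ).
  move: (a) (b) => [] []; rewrite ?expr0 ?expr1 /=; lmod_ring C.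
have fK u v d e := frank_superc d e u v.
have fDK := fD _ _ _ (fK _ _ _ _).
have := eq_ftr key.
rewrite (ftr_lin 1 (fr _ _ _ _) (frank_lin (-1) (fr _ _ _ _) (frankZ _ (fr _ _ _ _)))).
rewrite (ftr_lin (-1) (fr _ _ _ _) (frankZ _ (fr _ _ _ _))) (ftrZ _ (fr _ _ _ _)).
have f13 := fDK b y a c x z; have f23 := fDK a x b c y z; have f12 := fDK c z a b x y.
rewrite (ftr_lin _ f12 (frank_lin 1 f23 (frankZ _ f13))) (ftr_lin 1 f23 (frankZ _ f13)).
rewrite (ftrZ _ f13).
rewrite !str_comm //; try exact: fK.
rewrite !mulr0 !addr0 mul1r mulN1r => /eqP.
by rewrite addr_eq0 opprD opprK => /eqP.
Qed.

(** * Comparison with the coboundary of the Weyl vector *)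

Section Weyl.
Variable rho : 'Hom(H, C^o).
Hypothesis rhoE : is_weyl_vector rho.

Lemma ext0_lin r x y : ext0 rho (r *: x + y) = r * ext0 rho x + ext0 rho y.
Proof. exact: (ext0_linear gen h0E emb_inj). Qed.

Lemma ext0l0 (l : 'Hom(H, C^o)) : ext0 l (0 : g) = 0.
Proof.
rewrite (ext0_roots gen h0E emb_inj) //.
exact: (subspace0 (subspace_lspan _)).
Qed.

Lemma ext0_brk_emb h x : ext0 rho (brk (emb g h) x) = 0.
Proof.
have := ES_setT gen h0E x; move: x; apply: ES_ind => [|k x _ Ex].
  split=> [|r u v]; first by rewrite linear0r ext0l0.
  by rewrite linearPr ext0_lin => -> ->; rewrite mulr0 addr0.
have [k0|k0] := eqVneq k 0; last first.
  by apply: (ext0_E gen h0E emb_inj rho k0); exact: E_emb_brk.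
by move: Ex; rewrite k0 (E_gcomp gen h0E) => -[h' _ <-]; rewrite brk_emb ext0l0.
Qed.

(** The operator [K] shifts degrees by [k + l], so its commutator with [ad h0] is [k + l] times [K],
    and the trace of a commutator vanishes. *)
Lemma psi_deg a b k l x y : k + l != 0 -> E k x -> E l y -> psi a b x y = 0.
Proof.
move=> kl Ex Ey; pose K : {linear g -> g} := parop \o superc a b x y.
have fK : frank K by exact: (frank_compl parop (frank_superc _ _ _ _)).
have Epar m v : E m v -> E m (parop v).
  by move=> Ev; rewrite paropE; apply: (subspaceB (subspace_E _ _ _)); exact: E_pproj.
have EP S m v : E m v -> E m (@pS C n A p H g gen h0 h0E S v).
  move=> Ev; rewrite (pS_E gen h0E S Ev); case: ifP => _ //.
  exact: (subspace0 (subspace_E _ _ _)).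
have Ecmp u u' m m' m'' v : E m u -> E m' u' -> E m'' v -> E (m + (m' + m'')) (compr u u' v).
  move=> Eu Eu' Ev.
  exact: (EP _ _ _ (E_brk Eu (EP _ _ _ (E_brk Eu' (EP _ _ _ Ev))))). 
have EK m v : E m v -> E (k + l + m) (K v).
  move=> Ev; apply: Epar; rewrite supercE; apply: (subspaceB (subspace_E _ _ _)).
    by rewrite -addrA; exact: Ecmp.
  by apply: (subspaceZ (subspace_E _ _ _)); rewrite [k + l]addrC -addrA; exact: Ecmp.
have key v : -1 *: K (brk (emb g h0) v) + brk (emb g h0) (K v) = ((k + l)%:~R : C) *: K v.
  have l1 : linear (fun v => -1 *: K (brk (emb g h0) v) + brk (emb g h0) (K v)).
    by move=> r u u'; rewrite linearPr !(linearP K) linearPr; lmod_ring C.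
  have l2 : linear (fun v => ((k + l)%:~R : C) *: K v).
    by move=> r u u'; rewrite (linearP K); lmod_ring C.
  rewrite -[LHS](mklinE l1) -[RHS](mklinE l2).
  move: v; apply: (E_eq_lin gen h0E) => m v Ev; rewrite !mklinE.
  rewrite (EK m v Ev) (Ev : brk (emb g h0) v = _) (linearZ_LR K) rmorphD /=.
  by lmod_ring C.
have := eq_ftr key; rewrite (ftr_lin (-1) (frank_compr (brk (emb g h0)) fK)); last first.
  exact: (frank_compl (brk (emb g h0)) fK).
rewrite (ftrC (brk (emb g h0)) fK) mulN1r addNr ftrZ // => /esym/eqP.
by rewrite mulf_eq0 intr_eq0 (negbTE kl) => /eqP.
Qed.

(** Both sides vanish off degree [k], and for [k] equal to 1 or -1 this component is spanned by
    generators. The projection [pproj g b] provides the homogeneous argument that the parity [b]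
    presupposes. *)
Lemma psi_gen k x a (z : 'I_n -> g) : par a x -> E (- k) x ->
  E k `<=` wspan z 0 -> (forall j, E k (z j)) -> (forall j, par (p j) (z j)) ->
  (forall j, psi a (p j) x (z j) = 2 * ext0 rho (brk x (z j))) ->
  forall b y, psi a b x (pproj g b y) = 2 * ext0 rho (brk x (pproj g b y)).
Proof.
move=> Px Ex Ek zk Pz xz b y.
have sQ : subspace [set y | psi a b x (pproj g b y) = 2 * ext0 rho (brk x (pproj g b y))].
  split=> [|r u v] /=.
    rewrite linear0 linear0r ext0l0 mulr0; have := psi_linr a b (-1) x 0 0.
    by rewrite scaler0 addr0 mulN1r addNr.
  rewrite linearP psi_linr linearPr ext0_lin => -> ->; ring.
have := ES_setT gen h0E y; move: y; apply: ES_ind => // l y _ Ey.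
have [lk|lk] := eqVneq l k; last first.
  have d : - k + l != 0 by rewrite addrC subr_eq0.
  have Ep := E_pproj b Ey.
  by rewrite (psi_deg _ _ d Ex Ep) (ext0_E gen h0E emb_inj rho d (E_brk Ex Ep)) mulr0.
move: Ey; rewrite lk => /Ek; move: y; apply: wspan_ind0 => // j.
have [<-|ne] := eqVneq (p j) b; first by rewrite /= (pproj_id (Pz j)).
rewrite /= (pproj_neq (Pz j) ne).
by have [+ _] := sQ; rewrite /= linear0.
Qed.

(** On positive degrees [ad X] never reaches a nonpositive degree, and [ad Y] does so only from
    degree 1, landing in the Cartan subalgebra, where [brk X h] is [- sroot H i h] times [X]. The
    operator thus has rank one along [X]. For [i = j] its supertrace is [sroot H i (coroot H i)],
    twice the value of [rho]; the sign of [parop] on [X] cancels the one in [brk Y X]. *)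
Lemma psi_XY i j :
  psi (p i) (p j) (genX g i) (genY g j) = 2 * ext0 rho (brk (genX g i) (genY g j)).
Proof.
pose X := genX g i; pose Y := genY g j.
have lphi : linear (fun v => - ext0 (sroot H i) (brk Y (P v)) : C^o).
  move=> r u v; rewrite (linearP P) linearPr (ext0_linear gen h0E emb_inj).
  by rewrite -![_ *: (_ : C^o)]/(_ * _); ring.
have KE v : superc (p i) (p j) X Y v = mklin lphi v *: X.
  have lr : linear (fun v => (mklin lphi v : C) *: X).
    move=> r u u'; rewrite (linearP (mklin lphi)) scalerDl.
    by rewrite -[_ *: (_ : C^o)]/(r * _) scalerA.
  rewrite -[RHS](mklinE lr); move: v; apply: (E_eq_lin gen h0E) => k v Ev.
  have EX : E 1 X by exact: E_genX.
  have EY : E (-1) Y by exact: E_genY.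
  rewrite (mklinE lr) (mklinE lphi) supercE /= (pospE Ev); case: ifP => k0; last first.
    by rewrite !linear0 ext0l0 oppr0 scale0r ?scaler0 ?subr0 ?addr0.
  rewrite (nonpospE (E_brk EX Ev)) ifT; last by lia.
  rewrite !linear0 ?scaler0 ?subr0 ?addr0 (nonpospE (E_brk EY Ev)).
  have [k1|k1] := eqVneq k 1; last first.
    rewrite ifT; last by lia.
    rewrite !linear0 (ext0_E gen h0E emb_inj _ _ (E_brk EY Ev)); last by lia.
    by rewrite oppr0 scale0r.
  have := E_brk EY Ev; rewrite k1 addNr (E_gcomp gen h0E) => -[h _ <-] /=.
  rewrite (ext0_emb gen h0E emb_inj) -[brk X _]opprK -brk_skew_even; last exact: par_emb.
  by rewrite brk_embX linearN linearZ_LR /= (pospE EX) scaleNr.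
have PX : P X = X by rewrite (pospE (E_genX g h0E i)).
have tr : has_ftr (parop \o superc (p i) (p j) X Y)
    (- ext0 (sroot H i) (brk Y (P (parop X)))).
  exists [:: (mklin lphi, parop X)] => [v|].
    by rewrite /frop big_seq1 /= KE linearZ_LR.
  by rewrite /frtr big_seq1 /= (mklinE lphi).
rewrite /psi (has_ftrE tr) (parop_par (par_genX g i)) linearZ_LR PX linearZr_LR.
have ext0Z r x : ext0 (sroot H i) (r *: x) = r * ext0 (sroot H i) x.
  have := ext0_linear gen h0E emb_inj (sroot H i) r x 0.
  by rewrite addr0 ext0l0 addr0.
rewrite ext0Z (brk_skew (par_genY g j) (par_genX g i)) -scaleN1r !ext0Z brk_XY.
have [<-|ij] := eqVneq i j; last by rewrite ext0l0 ext0l0 !mulr0 oppr0.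
rewrite !(ext0_emb gen h0E emb_inj) rhoE.
by case: (p i); rewrite /= ?expr0 ?expr1; field.
Qed.

(** The elements [x] that satisfy the equation against all [y] form a subalgebra, by [psi_jac] on
    the left and the Jacobi identity on the right, and it contains the generators. The induction
    carries all parity components of [x] because [psi] takes parities as arguments. *)
Theorem psi_coboundary a b x y : par a x -> par b y ->
  psi a b x y = 2 * ext0 rho (brk x y).
Proof.
move=> Px Py; rewrite -(pproj_id Px); move: x {Px} a b y Py.
have bilin b y : subspace [set x | forall a, psi a b (pproj g a x) y = 2 * ext0 rho (brk (pproj g a x) y)].
  split=> [a|r u v Hu Hv a] /=.
    rewrite linear0 linear0l ext0l0 mulr0; have := psi_linl a b (-1) 0 0 y.
    by rewrite scaler0 addr0 mulN1r addNr.
  rewrite linearP psi_linl linearPl ext0_lin Hu Hv; ring.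
have zero a b y : psi a b 0 y = 2 * ext0 rho (brk 0 y).
  by have [/(_ a) + _] := bilin b y; rewrite /= linear0.
apply: (gen_ind gen (Q := [set x | forall a b y, par b y ->
    psi a b (pproj g a x) y = 2 * ext0 rho (brk (pproj g a x) y)])).
- split=> [a b y _|r u v Hu Hv a b y Py] /=; first by rewrite linear0 zero.
  by apply: (bilin b y).2 => a'; [exact: Hu|exact: Hv].
- move=> h [] b y Py; first by rewrite (pproj_neq (par_emb g h)) ?zero.
  rewrite (pproj_id (par_emb g h)) ext0_brk_emb mulr0 /psi.
  rewrite -[RHS](ftr_cst0 g); apply: eq_ftr => v; rewrite /= -[RHS](linear0 parop).
  congr (parop _); rewrite supercE.
  (* [ad h] preserves degrees, so it cannot cross between the positive and the nonpositive part. *)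
  have ch v' : P (brk (emb g h) (Q v')) = 0.
    move: v'.
    apply: (E_eq_lin gen h0E (f := P \o brk (emb g h) \o Q)
      (f' := (\0%R : {linear g -> g}))) => k v' Ev.
    rewrite /= (nonpospE Ev); case: ifP => k0; rewrite ?linear0 //.
    by rewrite (pospE (E_emb_brk h Ev)) k0.
  have ch' v' : Q (brk (emb g h) (P v')) = 0.
    move: v'.
    apply: (E_eq_lin gen h0E (f := Q \o brk (emb g h) \o P)
      (f' := (\0%R : {linear g -> g}))) => k v' Ev.
    rewrite /= (pospE Ev); case: ifP => k0; rewrite ?linear0 //.
    by rewrite (nonpospE (E_emb_brk h Ev)) k0.
  by rewrite /= ch ch' !linear0 ?scaler0 ?subr0 ?addr0.
- move=> i a b y Py; have [<-|ne] := eqVneq (p i) a; last first.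
    by rewrite (pproj_neq (par_genX g i) ne) zero.
  rewrite (pproj_id (par_genX g i)) -(pproj_id Py).
  apply: (@psi_gen (-1) _ _ (genY g)).
  + exact: par_genX.
  + exact: E_genX.
  + by rewrite (E_gcomp gen h0E).
  + exact: E_genY.
  + exact: par_genY.
  + by move=> j; exact: psi_XY.
- move=> i a b y Py; have [<-|ne] := eqVneq (p i) a; last first.
    by rewrite (pproj_neq (par_genY g i) ne) zero.
  rewrite (pproj_id (par_genY g i)) -(pproj_id Py).
  apply: (@psi_gen 1 _ _ (genX g)).
  + exact: par_genY.
  + exact: E_genY.
  + by rewrite (E_gcomp gen h0E).
  + exact: E_genX.
  + exact: par_genX.
  move=> j; rewrite psi_skew psi_XY (brk_skew (par_genY g i) (par_genX g j)).
  rewrite -scaleN1r; have := ext0_lin (-1) ((-1) ^+ (p i && p j) *: brk (genX g j) (genY g i)) 0.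
  have := ext0_lin ((-1) ^+ (p i && p j)) (brk (genX g j) (genY g i)) 0.
  by rewrite !addr0 ext0l0 !addr0 => -> ->; ring.
move=> q r x y Px Py Hx Hy a b z Pz.
have [<-|ne] := eqVneq (q (+) r) a; last by rewrite (pproj_neq (brk_par Px Py) ne) zero.
rewrite (pproj_id (brk_par Px Py)) (psi_jac Px Py Pz).
have := Hx q _ _ (brk_par Py Pz); have := Hy r _ _ (brk_par Px Pz).
rewrite (pproj_id Px) (pproj_id Py) => -> ->.
have -> : brk x (brk y z) = (-1) ^+ (q && r) *: brk y (brk x z) + brk (brk x y) z.
  by rewrite (brk_jac _ Px Py) addrC.
by rewrite ext0_lin; ring.
Qed.

End Weyl.

(** * The trace over the odd part *)

Definition odd_trace x y : C := ftr (brk x \o Q \o brk y \o P \o pproj g true).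

Lemma frank_brk_brk x y : frank (brk x \o Q \o brk y \o P).
Proof. exact: (frank_compl (brk x) (frank_nonposp y)). Qed.

(** Cyclicity moves the outer [P] to the right, where it commutes with the parity projection and is
    absorbed by the inner [P]. *)
Lemma ftr_compr_pproj x y q : ftr (compr x y \o pproj g q) =
  ftr (brk x \o Q \o brk y \o P \o pproj g q).
Proof.
have fr := frank_compr (pproj g q) (frank_brk_brk x y).
rewrite -(ftrC P fr); apply: eq_ftr => v /=.
by rewrite -pS_pproj pospK pS_pproj.
Qed.

(** The odd trace is the even trace minus the supertrace; [rho0] accounts for the first by
    hypothesis, [rho] for the second by [psi_coboundary]. *)
Lemma kac_peterson_odd (rho rho0 : 'Hom(H, C^o)) x y :
  is_weyl_vector rho -> is_kac_peterson g rho0 -> par false x -> par false y ->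
  ext0 (rho0 - rho) (brk x y) = 2^-1 * (odd_trace x y - odd_trace y x).
Proof.
move=> rhoE KP Px Py; have [t1 [t2 [H1 H2 e]]] := KP x y Px Py.
have T0 x' y' t : has_trace (par false)
    (fun z => brk x' (pi_minus (brk y' (pi_plus z)))) t ->
    ftr (brk x' \o Q \o brk y' \o P \o pproj g false) = t.
  move=> Ht.
  have [] // := @has_trace_ftr _ _ (par false) (brk x' \o Q \o brk y' \o P) (pproj g false) t.
  - by move=> v; exact: pproj_par.
  - by move=> v; exact: pproj_id.
  move: Ht; congr has_trace; apply/funext => v /=.
  by rewrite (pi_minusE gen h0E) (pi_plusE gen h0E) nonposp.
have st x' y' : ftr (fun v => parop (compr x' y' v)) =
    ftr (brk x' \o Q \o brk y' \o P \o pproj g false) - odd_trace x' y'.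
  rewrite -(ftrC parop (frank_cmp x' y')) /odd_trace -!ftr_compr_pproj.
  have fr q := frank_compr (pproj g q) (frank_cmp x' y').
  have := ftr_lin (-1) (fr true) (fr false); rewrite mulN1r addrC => <-.
  apply: eq_ftr => v; rewrite -[LHS]/(compr x' y' (parop v)) paropE linearB.
  by rewrite scaleN1r addrC.
have := psi_coboundary rhoE Px Py; rewrite /psi.
have -> : ftr (parop \o superc false false x y) =
    ftr (fun v => parop (compr x y v)) - ftr (fun v => parop (compr y x v)).
  have fr u v : frank (fun w => parop (compr u v w)) := frank_compl parop (frank_cmp u v).
  have := ftr_lin (-1) (fr y x) (fr x y); rewrite mulN1r addrC => <-.
  apply: eq_ftr => v; rewrite /= supercE expr0 scale1r linearB scaleN1r addrC.
  by [].
rewrite !st (T0 _ _ _ H1) (T0 _ _ _ H2) => e2.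
have -> : ext0 (rho0 - rho) (brk x y) = ext0 rho0 (brk x y) - ext0 rho (brk x y).
  by rewrite /ext0 add_lfunE opp_lfunE.
rewrite e; apply: (mulfI (_ : (2 : C) != 0)); first by rewrite pnatr_eq0.
by rewrite mulrBr -e2; field.
Qed.

End Cocycle.

(** * Polynomials *)

Lemma malgUE (R : nzRingType) (K : choiceType) (c : R) (m : K) :
  << c *g m >> = c *: << m >> :> {malg R[K]}.
Proof. by apply/malgP => k; rewrite mcoeffZ !mcoeffU mulr_natr. Qed.

Lemma malg_mul_linear (R : comNzRingType) (K : conomType) (x : {malg R[K]}) :
  linear (fun y : {malg R[K]} => x * y).
Proof. by move=> r u v; rewrite mulrDr -scalerAr. Qed.

Lemma malgU_mul (R : comNzRingType) (K : conomType) (k l : K) :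
  << k >> * << l >> = << mmul k l >> :> {malg R[K]}.
Proof. by rewrite malgM_def fgmulUU mulr1. Qed.

Section OscillatorAlgebra.
Variables (R : comNzRingType) (J : choiceType).
Local Notation O := {malg R[{cmonom J}]}.
Implicit Types (P Q : O) (m : {cmonom J}) (a b : J).

(* Opaque: failing unifications of monomials must not unfold to finite maps. *)
Fact mono_subproof : {f : {cmonom J} -> O | forall m, f m = << m >>}.
Proof. by exists (fun m => << m >>). Qed.

Definition mono m : O := sval mono_subproof m.

Lemma monoE m : mono m = << m >>.
Proof. exact: (svalP mono_subproof). Qed.


Lemma malg_ind (W : O -> Prop) : W 0 ->
  (forall r u v, W u -> W v -> W (r *: u + v)) ->
  (forall m, W (mono m)) -> forall P, W P.
Proof.
move=> W0 WD Wm P; rewrite [P]monalgE; elim: (enum_fset _) => [|m s IH].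
  by rewrite big_nil.
by rewrite big_cons malgUE -monoE; apply: WD => //; exact: Wm.
Qed.

Lemma malg_eq_lin (V : lmodType R) (f f' : {linear O -> V}) :
  (forall m, f (mono m) = f' (mono m)) -> f =1 f'.
Proof.
move=> ff; apply: malg_ind => // [|r u v fu fv]; first by rewrite !linear0.
by rewrite !linearP fu fv.
Qed.

Fact mulu_subproof :
  {f : J -> {cmonom J} -> {cmonom J} | forall a m, f a m = mmul (ucm a) m}.
Proof. by exists (fun a m => mmul (ucm a) m). Qed.

Definition mulu a m : {cmonom J} := sval mulu_subproof a m.

Lemma muluEm a m : mulu a m = mmul (ucm a) m.
Proof. exact: (svalP mulu_subproof). Qed.

Lemma muluE a m i : mulu a m i = ((a == i) + m i)%N.
Proof. by rewrite muluEm cmM cmU. Qed.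

Fact divu_subproof :
  {f : J -> {cmonom J} -> {cmonom J} | forall a m, f a m = divcm m (ucm a)}.
Proof. by exists (fun a m => divcm m (ucm a)). Qed.

Definition divu a m : {cmonom J} := sval divu_subproof a m.

Lemma divuEm a m : divu a m = divcm m (ucm a).
Proof. exact: (svalP divu_subproof). Qed.

Lemma divuE a m i : divu a m i = (m i - (a == i))%N.
Proof. by rewrite divuEm divcmE cmU. Qed.

Definition dfun a P : O :=
  \sum_(m <- msupp P) << P@_m *+ m a *g divcm m (ucm a) >>.

(** Any finite set containing the support may index the sum, so linearity can be checked over a
    common index set. *)
Lemma dfunEw a P (D : {fset {cmonom J}}) : (msupp P `<=` D)%fset ->
  dfun a P = \sum_(m <- D) P@_m *: ((m a)%:R *: mono (divu a m)).
Proof.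
move=> PD; have -> : dfun a P =
    \sum_(m <- msupp P) P@_m *: ((m a)%:R *: mono (divu a m)).
  by apply: eq_bigr => m _; rewrite malgUE scalerA mulr_natr monoE divuEm.
by apply: big_fset_incl => // m _ /mcoeff_outdom->; rewrite scale0r.
Qed.

Fact dfun_is_linear a : linear (dfun a).
Proof.
move=> r u v; pose D := (msupp (r *: u + v) `|` (msupp u `|` msupp v))%fset.
have uD : (msupp u `<=` D)%fset := fsubset_trans (fsubsetUl _ _) (fsubsetUr _ _).
have vD : (msupp v `<=` D)%fset := fsubset_trans (fsubsetUr _ _) (fsubsetUr _ _).
rewrite (dfunEw a (fsubsetUl _ _ : (_ `<=` D)%fset)) (dfunEw a uD) (dfunEw a vD).
rewrite scaler_sumr -big_split; apply: eq_bigr => m _ /=.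
by rewrite mcoeffD mcoeffZ scalerDl -!scalerA.
Qed.

Fact pder_subproof : {f : J -> {linear O -> O} | forall a P, f a P = dfun a P}.
Proof. by exists (fun a => mklin (dfun_is_linear a)) => a P; rewrite mklinE. Qed.

Definition pder a : {linear O -> O} := sval pder_subproof a.

Lemma pderE a P : pder a P = dfun a P.
Proof. exact: (svalP pder_subproof). Qed.

Lemma pderU a m : pder a (mono m) = (m a)%:R *: mono (divu a m).
Proof.
by rewrite pderE monoE (dfunEw a msuppU_le) big_seq_fset1 mcoeffUU scale1r.
Qed.

Fact mulx_subproof : {f : J -> {linear O -> O} | forall a P, f a P = << ucm a >> * P}.
Proof.
by exists (fun a => mklin (malg_mul_linear << ucm a >>)) => a P; rewrite mklinE.
Qed.

Definition mulx a : {linear O -> O} := sval mulx_subproof a.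

Lemma mulxE a P : mulx a P = << ucm a >> * P.
Proof. exact: (svalP mulx_subproof). Qed.

Lemma mulxU a m : mulx a (mono m) = mono (mulu a m).
Proof. by rewrite mulxE !monoE muluEm; exact: malgU_mul. Qed.

Lemma mcoeff_mono m k : (mono m)@_k = (m == k)%:R.
Proof. rewrite monoE; exact: mcoeffU1. Qed.

Lemma divuKl a m : divu a (mulu a m) = m.
Proof. by apply/eqP/cmP => i; rewrite divuE muluE addKn. Qed.

Lemma divuK a m : m a != 0%N -> mulu a (divu a m) = m.
Proof.
move=> ma; apply/eqP/cmP => i; rewrite muluE divuE; case: eqP => [<-|_].
  by rewrite subnKC // lt0n.
by rewrite add0n subn0.
Qed.

Lemma pder_mulx a b P :
  pder a (mulx b P) = mulx b (pder a P) + (a == b)%:R *: P.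
Proof.
have l1 : linear (fun P => pder a (mulx b P)).
  by move=> r u v; rewrite !linearP.
have l2 : linear (fun P => mulx b (pder a P) + (a == b)%:R *: P).
  by move=> r u v; rewrite !(linearP (pder a)) (linearP (mulx b)); lmod_ring R.
rewrite -[LHS](mklinE l1) -[RHS](mklinE l2); move: P; apply: malg_eq_lin => m.
rewrite (mklinE l1) (mklinE l2) mulxU !pderU muluE linearZ_LR mulxU [b == a]eq_sym.
have [->|ab] := eqVneq a b.
  have -> : (m b)%:R *: mono (mulu b (divu b m)) = (m b)%:R *: mono m.
    have [->|mb] := eqVneq (m b) 0%N; first by rewrite !scale0r.
    by rewrite divuK.
  by rewrite -scalerDl divuKl addnC natrD.
rewrite add0n scale0r addr0; have [->|ma] := eqVneq (m a) 0%N; first by rewrite !scale0r.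
congr (_ *: (mono _)); apply/eqP/cmP => i; rewrite divuE !muluE divuE addnBA //.
by have [<-|_] := eqVneq a i; rewrite ?lt0n.
Qed.

Lemma pderC a b P : pder a (pder b P) = pder b (pder a P).
Proof.
move: P; apply: (malg_eq_lin (f := pder a \o pder b)
  (f' := pder b \o pder a)) => m.
rewrite /= !pderU !linearZ /= !pderU !scalerA !divuE.
have [->//|ab] := eqVneq a b; rewrite !subn0 mulrC.
congr (_ *: (mono _)); apply/eqP/cmP => i; rewrite !divuE; lia.
Qed.

Lemma pder1 a : pder a (mono mone) = 0.
Proof. by rewrite pderU cm1 scale0r. Qed.

Lemma mcoeff_pder a P m : (pder a P)@_m = (m a).+1%:R * P@_(mulu a m).
Proof.
have l1 : linear (fun P => (pder a P)@_m : R^o).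
  by move=> r u v; rewrite linearP mcoeffD mcoeffZ.
have l2 : linear (fun P => (m a).+1%:R * P@_(mulu a m) : R^o).
  by move=> r u v; rewrite mcoeffD mcoeffZ -[_ *: (_ : R^o)]/(_ * _); ring.
rewrite -[LHS](mklinE l1) -[RHS](mklinE l2); move: P; apply: (malg_eq_lin (f := mklin l1) (f' := mklin l2)) => m'.
rewrite (mklinE l1) (mklinE l2) pderU mcoeffZ !mcoeff_mono.
have [->|m'm] := eqVneq m' (mulu a m); first by rewrite divuKl eqxx muluE eqxx.
rewrite mulr0; have [->|m'a] := eqVneq (m' a) 0%N; first by rewrite mul0r.
case: eqP => [e|_]; last by rewrite mulr0.
by rewrite -e divuK ?eqxx in m'm.
Qed.

(** A monomial [m] other than 1 contains some variable [a], and the coefficient of [divu a m] in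
    [pder a P] is a positive integer times that of [m] in [P]. The hypothesis on [R] allows dividing
    by that integer. *)
Lemma pder_eq0 P : (forall (k : nat) (c : R), k.+1%:R * c = 0 -> c = 0) ->
  (forall a, pder a P = 0) -> P = P@_(mone : {cmonom J}) *: mono mone.
Proof.
move=> R0 P0; apply/malgP => m; rewrite mcoeffZ mcoeff_mono eq_sym.
have [->|m1] := eqVneq m mone; first by rewrite mulr1.
rewrite mulr0; have [a ma] : exists a, m a != 0%N.
  apply: contrapT => na; case/eqP: m1; apply/eqP/cmP => i; rewrite cm1.
  by apply/eqP/negP => /negP mi; apply: na; exists i.
have := congr1 (mcoeff (divu a m)) (P0 a).
by rewrite mcoeff_pder divuK // mcoeff0 => /R0.
Qed.

Lemma mcoeff1_mulx a P : (mulx a P)@_(mone : {cmonom J}) = 0.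
Proof.
have l1 : linear (fun P => (mulx a P)@_(mone : {cmonom J}) : R^o).
  by move=> r u v; rewrite linearP mcoeffD mcoeffZ.
rewrite -[LHS](mklinE l1); move: P.
apply: (malg_eq_lin (f := mklin l1) (f' := (\0%R : {linear O -> R^o}))) => m.
by rewrite (mklinE l1) mulxU mcoeff_mono /= muluEm cmM_eq1 cm1_eq1.
Qed.

Lemma mulxC a b P : mulx a (mulx b P) = mulx b (mulx a P).
Proof. by rewrite !mulxE; exact: mulrCA. Qed.

Lemma mcoeff1_one : (mono mone)@_(mone : {cmonom J}) = 1.
Proof. by rewrite mcoeff_mono eqxx. Qed.

Lemma mono_expand P (D : {fset {cmonom J}}) : (msupp P `<=` D)%fset ->
  P = \sum_(m <- D) P@_m *: mono m.
Proof.
move=> PD; rewrite {1}(monalgEw PD); apply: eq_bigr => m _.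
by rewrite malgUE monoE.
Qed.

Lemma pder_supp P : exists V : {fset J}, forall a, a \notin V -> pder a P = 0.
Proof.
move: P; apply: malg_ind.
- by exists fset0 => a _; rewrite linear0.
- move=> r u v [U Uu] [V Vv]; exists (U `|` V)%fset => a.
  by rewrite inE negb_or (linearP (pder a)) => /andP[/Uu -> /Vv ->]; rewrite scaler0 addr0.
move=> m; exists (finsupp (cmonom_val m)) => a ma.
by rewrite pderU; move: ma; rewrite -cmE_eq0 => /eqP->; rewrite scale0r.
Qed.

Lemma mulx_ind (W : O -> Prop) : W 0 ->
  (forall r u v, W u -> W v -> W (r *: u + v)) -> W (mono mone) ->
  (forall a P, W P -> W (mulx a P)) -> forall P, W P.
Proof.
move=> W0 WD W1 WX; apply: malg_ind => // m.
move: {2}(mdeg m) (leqnn (mdeg m)) => d; elim: d m => [|d IH] m.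
  by rewrite leqn0 mdeg_eq0 => /eqP ->.
have [->//|m1 md] := eqVneq m mone.
have [a ma] : exists a, m a != 0%N.
  apply: contrapT => na; case/eqP: m1; apply/eqP/cmP => i; rewrite cm1.
  by apply/eqP/negP => /negP mi; apply: na; exists i.
rewrite -(divuK ma) -mulxU; apply: WX; apply: IH.
by move: md; rewrite -{1}(divuK ma) muluEm mdegM mdegU.
Qed.

Lemma mfactEw m (D : {fset J}) : (finsupp (cmonom_val m) `<=` D)%fset ->
  mfact m = (\prod_(a <- D) (m a)`!)%N.
Proof.
move=> mD; rewrite /mfact; apply: big_fset_incl => // a _.
by rewrite -cmE_eq0 => /eqP ->.
Qed.

Lemma mfactM a m : mfact (mulu a m) = ((m a).+1 * mfact m)%N.
Proof.
pose D := (a |` finsupp (cmonom_val m))%fset.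
have aD : a \in D by rewrite !inE eqxx.
rewrite (mfactEw (m := m) (D := D)) ?fsubsetU1 //.
rewrite (mfactEw (m := mulu a m) (D := D)) ?muluEm ?mdomD ?mdomU // -muluEm.
rewrite !(big_fsetD1 a aD) /= muluE eqxx add1n factS -mulnA; congr (_ * (_ * _))%N.
apply: eq_big_seq => b; rewrite !inE => /andP[ba _].
by rewrite muluE eq_sym (negbTE ba).
Qed.

Variable cj : {rmorphism R -> R}.
Hypothesis cjK : involutive cj.

(** [osc_form] over a ring whose involutive endomorphism [cj] stands for complex conjugation. *)
Definition oform P Q : R := \sum_(m <- msupp P) cj P@_m * Q@_m * (mfact m)%:R.

Lemma oformEw P Q (D : {fset {cmonom J}}) : (msupp P `<=` D)%fset ->
  oform P Q = \sum_(m <- D) cj P@_m * Q@_m * (mfact m)%:R.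
Proof.
move=> PD; apply: big_fset_incl => // m _ /mcoeff_outdom->.
by rewrite rmorph0 !mul0r.
Qed.

Lemma oformPr P (r : R) Q Q' : oform P (r *: Q + Q') = r * oform P Q + oform P Q'.
Proof.
rewrite /oform mulr_sumr -big_split; apply: eq_bigr => m _ /=.
by rewrite mcoeffD mcoeffZ; ring.
Qed.

Lemma oform_herm P Q : oform P Q = cj (oform Q P).
Proof.
rewrite (oformEw _ (fsubsetUl _ (msupp Q))) (oformEw _ (fsubsetUr (msupp P) _)).
rewrite rmorph_sum; apply: eq_bigr => m _ /=.
by rewrite !rmorphM /= cjK rmorph_nat [X in _ = X * _]mulrC.
Qed.

Lemma oformPl (r : R) P P' Q :
  oform (r *: P + P') Q = cj r * oform P Q + oform P' Q.
Proof. by rewrite oform_herm oformPr rmorphD rmorphM /= -!oform_herm. Qed.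

Lemma oform0l Q : oform 0 Q = 0.
Proof. by have := oformPl (-1) 0 0 Q; rewrite scaler0 addr0 rmorphN1 mulN1r addNr. Qed.

Lemma oformUl m Q : oform (mono m) Q = Q@_m * (mfact m)%:R.
Proof.
by rewrite monoE (oformEw _ msuppU_le) big_seq_fset1 mcoeffUU rmorph1 mul1r.
Qed.

Lemma oform_mono m k : oform (mono m) (mono k) = (m == k)%:R * (mfact m)%:R.
Proof. by rewrite oformUl mcoeff_mono eq_sym. Qed.

(** On monomials this is [mfactM]: the factor by which the factorial grows is the one that
    differentiation produces. *)
Lemma oform_mulxl a P Q : oform (mulx a P) Q = oform P (pder a Q).
Proof.
move: P; apply: malg_ind.
- by rewrite linear0 !oform0l.
- by move=> r u v hu hv; rewrite linearP !oformPl hu hv.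
move=> m; rewrite mulxU !oformUl mfactM mcoeff_pder natrM; ring.
Qed.

End OscillatorAlgebra.

(** * The oscillator representation *)

Section Eventually.
Variable J : choiceType.
Implicit Types (S T : {fset J}) (P Q : {fset J} -> Prop).

(** Closure under conjunction lets finitely many identities between infinite sums be read off at one
    common truncation [S]. *)
Definition ev P := exists T, forall S, (T `<=` S)%fset -> P S.

Lemma ev_and P Q : ev P -> ev Q -> ev (fun S => P S /\ Q S).
Proof.
move=> [T1 P1] [T2 P2]; exists (T1 `|` T2)%fset => S TS.
by split; [apply: P1|apply: P2]; apply: fsubset_trans TS; rewrite ?fsubsetUl ?fsubsetUr.
Qed.

Lemma ev_ex P : ev P -> exists S, P S.
Proof. by move=> [T PT]; exists T; apply: PT. Qed.

Lemma ev_imp P Q : (forall S, P S -> Q S) -> ev P -> ev Q.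
Proof. by move=> PQ [T PT]; exists T => S /PT/PQ. Qed.

Lemma ev_mem a : ev (fun S => a \in S).
Proof. by exists [fset a]%fset => S; rewrite fsub1set. Qed.

Lemma ev_all (I : choiceType) (r : {fset I}) (P : I -> {fset J} -> Prop) :
  (forall i, ev (P i)) -> ev (fun S => forall i, i \in r -> P i S).
Proof.
move=> eP; have H : ev (fun S => forall i, i \in (r : seq I) -> P i S).
  elim: (r : seq I) => [|i s IH]; first by exists fset0.
  have := ev_and (eP i) IH; apply: ev_imp => S [Pi Ps] j.
  by rewrite inE => /orP[/eqP->|/Ps].
exact: H.
Qed.

End Eventually.

Section FiniteSums.
Variables (C : numClosedFieldType) (J : choiceType) (V : lmodType C).
Implicit Types (S : {fset J}) (F G : J -> V).

Lemma sum_delta S c F : c \in S -> \sum_(a <- S) (a == c)%:R *: F a = F c.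
Proof.
move=> cS; rewrite (big_fsetD1 c cS) /= eqxx scale1r big_seq big1 ?addr0 // => a.
by rewrite !inE => /andP[/negbTE-> _]; rewrite scale0r.
Qed.

Lemma sum2_split S (F G : J -> J -> V) :
  \sum_(a <- S) \sum_(b <- S) (F a b + G a b) =
  \sum_(a <- S) \sum_(b <- S) F a b + \sum_(a <- S) \sum_(b <- S) G a b.
Proof. by rewrite -big_split; apply: eq_bigr => a _; rewrite big_split. Qed.

Lemma sum2_delta1 S c (F : J -> J -> V) : c \in S ->
  \sum_(a <- S) \sum_(b <- S) (a == c)%:R *: F a b = \sum_(b <- S) F c b.
Proof.
move=> cS; rewrite -(sum_delta (fun a => \sum_(b <- S) F a b) cS).
by apply: eq_bigr => a _; rewrite scaler_sumr.
Qed.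

Lemma sum2_delta2 S c (F : J -> J -> V) : c \in S ->
  \sum_(a <- S) \sum_(b <- S) (b == c)%:R *: F a b = \sum_(a <- S) F a c.
Proof. by move=> cS; apply: eq_bigr => a _; exact: sum_delta. Qed.

Lemma sum2_linear (W : lmodType C) (f : {linear V -> W}) S (F : J -> J -> V) :
  f (\sum_(a <- S) \sum_(b <- S) F a b) = \sum_(a <- S) \sum_(b <- S) f (F a b).
Proof. by rewrite linear_sum; apply: eq_bigr => a _; rewrite linear_sum. Qed.

End FiniteSums.

(** * The odd part in the coordinates of the polarization *)

Section Oscillator.
Variables (C : numClosedFieldType) (n : nat) (A : 'M[C]_n) (p : 'I_n -> bool).
Variables (H : realization A) (g : chevalleyAlg p H).
Hypothesis gen : smallest (@subalgebra C g) (@generators C n A p H g) = setT.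
Variable h0 : H.
Hypothesis h0E : forall j, (sroot H j h0 : C) = 1.
Hypothesis emb_inj : injective (emb g).
Variable B : {biscalar g}.
Hypothesis Bpar : forall x y : g, par false x -> par true y -> B x y = 0 /\ B y x = 0.
Hypothesis Bskew : forall x y : g, par true x -> par true y -> B x y = - B y x.
Hypothesis Binv : forall x y z : g, B (brk x y) z = B x (brk y z).
Variables (J : choiceType) (xs ds : J -> g).
Hypothesis pol : is_polarization_basis B xs ds.
Implicit Types (x y z u v : g) (a b c d : J) (S : {fset J}) (r : C).

Local Notation E := (@E C n A p H g h0).
Local Notation ES := (@ES C n A p H g h0).
Local Notation P_ := (@pS C n A p H g gen h0 h0E posdeg).
Local Notation Q_ := (@pS C n A p H g gen h0 h0E (~` posdeg)).

Lemma xs_odd a : par true (xs a).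
Proof. by have [[[H1 _ _] _] _ _ _] := pol; have [] := H1 a. Qed.

Lemma ds_odd a : par true (ds a).
Proof. by have [[_ [H1 _ _]] _ _ _] := pol; have [] := H1 a. Qed.

Lemma xs_neg a : ES negdeg (xs a).
Proof.
have [[[H1 _ _] _] _ _ _] := pol; have [_] := H1 a.
by rewrite (nminusE gen h0E).
Qed.

Lemma ds_pos a : ES posdeg (ds a).
Proof.
have [[_ [H1 _ _]] _ _ _] := pol; have [_] := H1 a.
by rewrite (nplusE gen h0E).
Qed.

Lemma Bdx a b : B (ds a) (xs b) = if a == b then 2^-1 else 0.
Proof. by case: pol. Qed.

Lemma Bxx a b : B (xs a) (xs b) = 0.
Proof.
apply: (form_ES Binv _ (xs_neg a) (xs_neg b)) => k l; rewrite /negdeg /=; lia.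
Qed.

Lemma Bdd a b : B (ds a) (ds b) = 0.
Proof.
apply: (form_ES Binv _ (ds_pos a) (ds_pos b)) => k l; rewrite /posdeg /=; lia.
Qed.

Lemma ds_deg a : exists2 k : int, 0 < k & E k (ds a).
Proof.
have [_ _ /(_ a)[k] + _] := pol; rewrite (pdeg_E gen h0E) => Ek; exists k => //.
apply: contraT => nk; have := pospE gen h0E Ek; rewrite (negbTE nk) mklinE.
rewrite (proj_id (ES_compl gen h0E _) (ds_pos a)) => d0.
have := Bdx a a; rewrite d0 linear0l eqxx => /esym/eqP.
by rewrite invr_eq0 pnatr_eq0.
Qed.

Definition cx u a : C := 2 * B (ds a) u.
Definition cd u a : C := 2 * B u (xs a).

Lemma cxP r u v a : cx (r *: u + v) a = r * cx u a + cx v a.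
Proof. by rewrite /cx linearPr /=; ring. Qed.

Lemma cdP r u v a : cd (r *: u + v) a = r * cd u a + cd v a.
Proof. by rewrite /cd linearPl /=; ring. Qed.

Lemma twohalf : 2 * 2^-1 = 1 :> C. Proof. by field. Qed.

Lemma cx_xs a b : cx (xs a) b = (b == a)%:R.
Proof. by rewrite /cx Bdx; case: eqP => _; rewrite ?twohalf ?mulr0. Qed.

Lemma cd_ds a b : cd (ds a) b = (b == a)%:R.
Proof. by rewrite /cd Bdx eq_sym; case: eqP => _; rewrite ?twohalf ?mulr0. Qed.

Lemma cx_ds a b : cx (ds a) b = 0. Proof. by rewrite /cx Bdd mulr0. Qed.
Lemma cd_xs a b : cd (xs a) b = 0. Proof. by rewrite /cd Bxx mulr0. Qed.

Lemma cx_even u a : par false u -> cx u a = 0.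
Proof. by move=> Pu; rewrite /cx (Bpar Pu (ds_odd a)).2 mulr0. Qed.

Lemma cd_even u a : par false u -> cd u a = 0.
Proof. by move=> Pu; rewrite /cd (Bpar Pu (xs_odd a)).1 mulr0. Qed.

(** An odd element has no component of degree 0, since that component is the even Cartan subalgebra;
    its positive and negative parts are spanned by the [ds] and the [xs]. *)
Lemma odd_ind (W : set g) : subspace W -> (forall a, W (xs a)) ->
  (forall a, W (ds a)) -> forall u, par true u -> W u.
Proof.
move=> sW Wx Wd u Pu.
have [[[_ _ sx] [_ _ sd]] _ _ _] := pol.
have -> : u = P_ u + @pS C n A p H g gen h0 h0E negdeg u.
  have uE : (P_ \+ (@pS C n A p H g gen h0 h0E negdeg \+ @pS C n A p H g gen h0 h0E [set 0])) u = u.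
    move: u {Pu}; apply: (E_eq_lin gen h0E (f' := idfun)) => k u Eu /=.
    rewrite !(pS_E gen h0E _ Eu) /posdeg /negdeg /=.
    do 3!case: asboolP => /=; rewrite ?addr0 ?add0r //; lia.
  suff e0 : @pS C n A p H g gen h0 h0E [set 0] u = 0 by rewrite -[LHS]uE /= e0 addr0.
  have := pS_in gen h0E (S := [set 0]) u; rewrite ES1 (E_gcomp gen h0E) => -[h _ he].
  have [_ _ d _] := par_compl g true; apply: d; first exact: pS_par.
  by rewrite -he; exact: par_emb.
apply: (subspaceD sW).
  have : lspan (range ds) (P_ u).
    by apply: sd; split; [exact: pS_par|rewrite (nplusE gen h0E); exact: pS_in].
  by move: (P_ u); apply: lspan_sub => // _ [a _ <-].
have : lspan (range xs) (@pS C n A p H g gen h0 h0E negdeg u).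
  by apply: sx; split; [exact: pS_par|rewrite (nminusE gen h0E); exact: pS_in].
by move: (pS _ _ _ u); apply: lspan_sub => // _ [a _ <-].
Qed.

Lemma odd_coord u : par true u -> ev (fun S =>
  u = \sum_(a <- S) cx u a *: xs a + \sum_(a <- S) cd u a *: ds a).
Proof.
move: u; apply: odd_ind.
- split.
    exists fset0 => S _; rewrite !big1 ?addr0 // => a _.
      by rewrite /cd linear0l mulr0 scale0r.
    by rewrite /cx linear0r mulr0 scale0r.
  move=> r u v eu ev'; have := ev_and eu ev'; apply: ev_imp => S [Su Sv].
  rewrite {1}Su {1}Sv scalerDr !scaler_sumr -!big_split; apply: eq_bigr => a _ /=.
  by rewrite cxP cdP; lmod_ring C.
- move=> a; have := ev_mem a; apply: ev_imp => S aS.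
  under eq_bigr do rewrite cx_xs; rewrite sum_delta // big1 ?addr0 // => b _.
  by rewrite cd_xs scale0r.
move=> a; have := ev_mem a; apply: ev_imp => S aS.
under [X in _ = _ + X]eq_bigr do rewrite cd_ds; rewrite sum_delta // big1 ?add0r // => b _.
by rewrite cx_ds scale0r.
Qed.

Lemma fin_coord u : ev (fun S => forall a, a \notin S -> cx u a = 0 /\ cd u a = 0).
Proof.
have [T TS] := odd_coord (pproj_par true u); exists T => S TS' a aS.
have {TS} e := TS S TS'.
(* Both coordinates are pairings with odd elements and ignore the even component of [u]. *)
have ue a' : (cx u a' = cx (pproj g true u) a') * (cd u a' = cd (pproj g true u) a').
  have ea := pprojD u.
  have e1 := cx_even a' (pproj_par false u); have e2 := cd_even a' (pproj_par false u).
  split; rewrite -[in LHS]ea.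
    by have := cxP 1 (pproj g false u) (pproj g true u) a'; rewrite scale1r e1 mulr0 add0r.
  by have := cdP 1 (pproj g false u) (pproj g true u) a'; rewrite scale1r e2 mulr0 add0r.
have ne b : b \in S -> (a == b) = false by move=> bS; apply: contraNF aS => /eqP->.
rewrite !ue; move: (pproj g true u) e => v e; split; rewrite [v in LHS]e.
  rewrite /cx linearDr !linear_sumr /= !big_seq !big1 ?addr0 ?mulr0 // => b bS.
    by rewrite linearZr_LR Bdd /= mulr0.
  by rewrite linearZr_LR Bdx ne //= mulr0.
rewrite /cd linearDl !linear_sumlz /= !big_seq !big1 ?addr0 ?mulr0 // => b bS.
  by rewrite linearZl_LR Bdx eq_sym ne //= mulr0.
by rewrite linearZl_LR Bxx /= mulr0.
Qed.

Section Coefficients.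
Variable x : g.
Hypothesis Px : par false x.

(** The blocks of the matrix of [ad x] on the odd part. Invariance of [B] makes [be] and [ga]
    symmetric and the remaining block minus the transpose of [al], the shape of a symplectic Lie
    algebra. *)
Definition al a b : C := cx (brk x (xs a)) b.
Definition be a b : C := cd (brk x (xs a)) b.
Definition ga a b : C := cx (brk x (ds a)) b.

Lemma brk_odd u : par true u -> par true (brk x u).
Proof. exact: (brk_par Px). Qed.

Lemma be_sym a b : be a b = be b a.
Proof.
rewrite /be /cd (brk_skew_even _ Px) linearNl Binv /=.
by rewrite -(Bskew (brk_odd (xs_odd b)) (xs_odd a)).
Qed.

Lemma ga_sym a b : ga a b = ga b a.
Proof.
rewrite /ga /cx -Binv -[brk (ds b) x]opprK -(brk_skew_even _ Px) linearNl /=.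
by rewrite -(Bskew (ds_odd a) (brk_odd (ds_odd b))).
Qed.

Lemma cd_brk_ds a b : cd (brk x (ds a)) b = - al b a.
Proof. by rewrite /cd /al /cx (brk_skew_even _ Px) linearNl Binv /= mulrN. Qed.

End Coefficients.

(** For [x] of degree [k], a nonzero entry forces the degrees of [ds a] and [ds b] to add up to
    [- k], so [ds a] is in the span of the words of length at most [|k|]. There are finitely many
    such words; for [a] outside all their coordinates, [cd] at [a] vanishes on this span but is 1 on
    [ds a]. *)
Lemma ga_fin x : ev (fun S => forall a, a \notin S -> forall b, ga x a b = 0).
Proof.
have := ES_setT gen h0E x; move: x; apply: ES_ind; first split.
- by exists fset0 => S _ a _ b; rewrite /ga /cx linear0l linear0r mulr0.
- move=> r u v eu ev'; have := ev_and eu ev'; apply: ev_imp => S [Su Sv] a aS b.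
  by rewrite /ga linearPl cxP -!/(ga _ _ _) Su // Sv // mulr0 addr0.
move=> k x _ Ex; pose s := flatten [seq words (genX g) j | j <- iota 0 `|k|].
have := ev_all (seq_fset tt s) fin_coord; apply: ev_imp => S HS a aS b.
have [ka ka0 Ea] := ds_deg a; have [kb kb0 Eb] := ds_deg b.
rewrite /ga /cx; have [e|ne] := eqVneq (kb + (k + ka)) 0; last first.
  by rewrite (form_E Binv ne Eb (E_brk Ex Ea)) mulr0.
have kak : ka <= `|k| by lia.
suff : cd (ds a) a = 0 by rewrite cd_ds eqxx => /eqP; rewrite oner_eq0.
have : lspan [set` s] (ds a).
  move: Ea; rewrite (E_gcomp gen h0E); case: ka ka0 kak {e} => [[|m]|m] //= _ mk.
  apply: lspanS => w /= ww; apply/flattenP; exists (words (genX g) m) => //.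
  by apply: map_f; rewrite mem_iota; lia.
apply: (@lspan_sub _ _ _ [set v | cd v a = 0]).
  split=> [|r u v hu hv]; first by rewrite /= /cd linear0l mulr0.
  by rewrite /= cdP hu hv mulr0 addr0.
move=> w ws; have [] // := HS w _ a aS.
by rewrite seq_fsetE.
Qed.

(** * The action on an abstract Weyl algebra module with vacuum vector *)

Section Representation.
Variables (O : lmodType C) (mx dx : J -> {linear O -> O}) (one : O).
Variable kap : {linear O -> C^o}.
Hypothesis dx_mx : forall a b P, dx a (mx b P) = mx b (dx a P) + (a == b)%:R *: P.
Hypothesis dxC : forall a b P, dx a (dx b P) = dx b (dx a P).
Hypothesis mxC : forall a b P, mx a (mx b P) = mx b (mx a P).
Hypothesis dx1 : forall a, dx a one = 0.
Hypothesis kap1 : kap one = 1.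
Hypothesis kap_mx : forall a P, kap (mx a P) = 0.
Hypothesis dx_eq0 : forall P, (forall a, dx a P = 0) -> P = (kap P : C) *: one.
Hypothesis dx_supp : forall P, ev (fun S => forall a, a \notin S -> dx a P = 0).
Hypothesis mx_ind : forall W : set O, subspace W -> W one ->
  (forall a P, W P -> W (mx a P)) -> forall P, W P.
Variable rho1 : 'Hom(H, C^o).
Implicit Types (P Q : O).

(** Counterparts of [creat], [annih], [nord] and [osc_act], identified with them in [osc_actE]; the
    abstract [O] keeps polynomials out of the commutator computations. *)
Definition crea u P : O := \sum_(a \in [set: J]) cx u a *: mx a P.
Definition anni u P : O := \sum_(a \in [set: J]) cd u a *: dx a P.
Definition nordo u v P : O :=
  crea u (crea v P) + crea u (anni v P) + crea v (anni u P) + anni u (anni v P).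
Definition oact x P : O :=
  2^-1 *: (\sum_(a \in [set: J]) nordo (brk x (xs a)) (ds a) P)
  - 2^-1 *: (\sum_(a \in [set: J]) nordo (brk x (ds a)) (xs a) P)
  - ext0 rho1 x *: P.

Lemma creaE u P S : (forall a, a \notin S -> cx u a = 0) ->
  crea u P = \sum_(a <- S) cx u a *: mx a P.
Proof. by move=> uS; apply: fsbigTE => a /uS->; rewrite scale0r. Qed.

Lemma anniE u P S : (forall a, a \notin S -> cd u a *: dx a P = 0) ->
  anni u P = \sum_(a <- S) cd u a *: dx a P.
Proof. exact: fsbigTE. Qed.

Lemma crea_ds a P : crea (ds a) P = 0.
Proof. by apply: fsbig1 => b _; rewrite cx_ds scale0r. Qed.

Lemma anni_xs a P : anni (xs a) P = 0.
Proof. by apply: fsbig1 => b _; rewrite cd_xs scale0r. Qed.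

Lemma crea_xs a P : crea (xs a) P = mx a P.
Proof.
rewrite (@creaE _ _ [fset a]%fset); last first.
  by move=> b; rewrite inE cx_xs => /negbTE->.
by rewrite big_seq_fset1 cx_xs eqxx scale1r.
Qed.

Lemma anni_ds a P : anni (ds a) P = dx a P.
Proof.
rewrite (@anniE _ _ [fset a]%fset); last first.
  by move=> b; rewrite inE cd_ds => /negbTE->; rewrite scale0r.
by rewrite big_seq_fset1 cd_ds eqxx scale1r.
Qed.

Lemma crea_ev u P : ev (fun S => crea u P = \sum_(a <- S) cx u a *: mx a P).
Proof. by apply: ev_imp (fin_coord u) => S uS; apply: creaE => a /uS[]. Qed.

Lemma anni_ev u P : ev (fun S => anni u P = \sum_(a <- S) cd u a *: dx a P).
Proof.
by apply: ev_imp (fin_coord u) => S uS; apply: anniE => a /uS[_ ->]; rewrite scale0r.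
Qed.

Lemma crea_linr u r P Q : crea u (r *: P + Q) = r *: crea u P + crea u Q.
Proof.
have [S [-> [-> ->]]] := ev_ex (ev_and (crea_ev u (r *: P + Q))
  (ev_and (crea_ev u P) (crea_ev u Q))).
rewrite scaler_sumr -big_split; apply: eq_bigr => a _ /=.
by rewrite (linearP (mx a)); lmod_ring C.
Qed.

Lemma anni_linr u r P Q : anni u (r *: P + Q) = r *: anni u P + anni u Q.
Proof.
have [S [-> [-> ->]]] := ev_ex (ev_and (anni_ev u (r *: P + Q))
  (ev_and (anni_ev u P) (anni_ev u Q))).
rewrite scaler_sumr -big_split; apply: eq_bigr => a _ /=.
by rewrite (linearP (dx a)); lmod_ring C.
Qed.

Lemma crea_linl r u v P : crea (r *: u + v) P = r *: crea u P + crea v P.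
Proof.
have [S [-> [-> ->]]] := ev_ex (ev_and (crea_ev (r *: u + v) P)
  (ev_and (crea_ev u P) (crea_ev v P))).
rewrite scaler_sumr -big_split; apply: eq_bigr => a _ /=.
by rewrite cxP; lmod_ring C.
Qed.

Lemma anni_linl r u v P : anni (r *: u + v) P = r *: anni u P + anni v P.
Proof.
have [S [-> [-> ->]]] := ev_ex (ev_and (anni_ev (r *: u + v) P)
  (ev_and (anni_ev u P) (anni_ev v P))).
rewrite scaler_sumr -big_split; apply: eq_bigr => a _ /=.
by rewrite cdP; lmod_ring C.
Qed.

Lemma crea0 u : crea u 0 = 0.
Proof. by apply: fsbig1 => a _; rewrite linear0 scaler0. Qed.

Lemma anni0 u : anni u 0 = 0.
Proof. by apply: fsbig1 => a _; rewrite linear0 scaler0. Qed.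

(** Both normally ordered halves contribute [al] with factor 1/2, hence its full coefficient here;
    [ga] comes from the second half only and inherits its minus sign. *)
Definition term x a b P : O :=
  al x a b *: mx b (dx a P) + (2^-1 * be x a b) *: dx b (dx a P)
  - (2^-1 * ga x a b) *: mx b (mx a P).

Definition opS S x P : O := \sum_(a <- S) \sum_(b <- S) term x a b P.

(** Terms ending in [dx a] are limited to the finitely many variables of [P], and for each of these
    [brk x (xs a)] has finitely many coordinates; the other terms are limited by [ga_fin]. A single
    [S] serves all the sums. *)
Lemma oact_ev x P : par false x ->
  ev (fun S => oact x P = opS S x P - ext0 rho1 x *: P).
Proof.
move=> Px; have [V VP] := dx_supp P; have {}VP := VP V (fsubset_refl V).
have evx := ev_all V (fun a => fin_coord (brk x (xs a))).
have evV : ev (fun S => V `<=` S)%fset by exists V.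
have := ev_and evV (ev_and evx (ga_fin x)); apply: ev_imp => S [VS [xS gS]].
have gS' a b : b \notin S -> ga x a b = 0 by move=> bS; rewrite ga_sym // gS.
have dS a : a \notin S -> dx a P = 0.
  by move=> aS; apply: VP; apply: contra aS; exact: (fsubsetP VS).
have n1 a : nordo (brk x (xs a)) (ds a) P =
    crea (brk x (xs a)) (dx a P) + anni (brk x (xs a)) (dx a P).
  by rewrite /nordo !crea_ds !anni_ds crea0 add0r addr0.
have n2 a : nordo (brk x (ds a)) (xs a) P =
    crea (brk x (ds a)) (mx a P) + mx a (anni (brk x (ds a)) P).
  by rewrite /nordo !crea_xs !anni_xs crea0 anni0 !addr0.
have e1 : \sum_(a \in [set: J]) nordo (brk x (xs a)) (ds a) P =
    \sum_(a <- S) \sum_(b <- S) (al x a b *: mx b (dx a P) + be x a b *: dx b (dx a P)).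
  rewrite (fsbigTE S) => [|a aS]; last by rewrite n1 dS // crea0 anni0 addr0.
  apply: eq_bigr => a _; rewrite n1 big_split /=.
  have [aV|aV] := boolP (a \in V); last first.
    by rewrite VP // crea0 anni0 !big1 ?addr0 // => b _; rewrite !linear0 ?scaler0.
  rewrite (@creaE _ _ S) => [|b /(xS a aV)[]//].
  by rewrite (@anniE _ _ S) // => b /(xS a aV)[_ ->]; rewrite scale0r.
have e2 : \sum_(a \in [set: J]) nordo (brk x (ds a)) (xs a) P =
    \sum_(a <- S) \sum_(b <- S) (ga x a b *: mx b (mx a P) - al x b a *: mx a (dx b P)).
  have e3 a : nordo (brk x (ds a)) (xs a) P =
      \sum_(b <- S) (ga x a b *: mx b (mx a P) - al x b a *: mx a (dx b P)).
    rewrite n2 (@creaE _ _ S) => [|b bS]; last exact: gS'.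
    rewrite (@anniE _ _ S) => [|b bS]; last by rewrite dS // scaler0.
    rewrite linear_sum -big_split; apply: eq_bigr => b _ /=.
    by rewrite linearZ_LR cd_brk_ds // scaleNr.
  (* For [a] outside [S] the [ga] part vanishes, and the [al] part would need [b] in [V], but then
     the coordinates of [brk x (xs b)] are confined to [S]. *)
  rewrite (fsbigTE S) => [|a aS]; first exact: eq_bigr.
  rewrite e3 big1 // => b _; rewrite gS // scale0r add0r.
  have [bV|bV] := boolP (b \in V); last by rewrite VP // linear0 scaler0 oppr0.
  by have [] := xS b bV a aS; rewrite /al => -> _; rewrite scale0r oppr0.
rewrite /oact e1 e2; congr (_ - _); rewrite /opS.
have ex : \sum_(a <- S) \sum_(b <- S) (ga x a b *: mx b (mx a P) - al x b a *: mx a (dx b P))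
    = \sum_(a <- S) \sum_(b <- S) (ga x a b *: mx b (mx a P) - al x a b *: mx b (dx a P)).
  have spl (F G : J -> J -> O) : \sum_(a <- S) \sum_(b <- S) (F a b - G a b) =
      \sum_(a <- S) \sum_(b <- S) F a b - \sum_(a <- S) \sum_(b <- S) G a b.
    by rewrite -sumrB; apply: eq_bigr => a _; rewrite sumrB.
  rewrite !spl; congr (_ - _); exact: exchange_big.
rewrite ex !scaler_sumr -sumrB; apply: eq_bigr => a _.
rewrite !scaler_sumr -sumrB; apply: eq_bigr => b _; rewrite /term.
set X := mx b (dx a P); set Y := dx b (dx a P); set Z := mx b (mx a P).
have h : (al x a b : C) = 2^-1 * al x a b + 2^-1 * al x a b by field.
by rewrite [in RHS]h; lmod_ring C.
Qed.

Lemma term_linr x a b r P Q :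
  term x a b (r *: P + Q) = r *: term x a b P + term x a b Q.
Proof.
rewrite /term !(linearP (dx _)) !(linearP (mx _)).
by lmod_ring C.
Qed.

Lemma opS_linr S x r P Q : opS S x (r *: P + Q) = r *: opS S x P + opS S x Q.
Proof.
rewrite /opS scaler_sumr -big_split; apply: eq_bigr => a _ /=.
rewrite scaler_sumr -big_split; apply: eq_bigr => b _ /=; exact: term_linr.
Qed.

Lemma opS_linl S r x y P : opS S (r *: x + y) P = r *: opS S x P + opS S y P.
Proof.
rewrite /opS scaler_sumr -big_split; apply: eq_bigr => a _ /=.
rewrite scaler_sumr -big_split; apply: eq_bigr => b _ /=.
by rewrite /term /al /be /ga !linearPl !cxP cdP; lmod_ring C.
Qed.

Lemma oact_linr x r P Q : par false x ->
  oact x (r *: P + Q) = r *: oact x P + oact x Q.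
Proof.
move=> Px; have [S [-> [-> ->]]] := ev_ex (ev_and (oact_ev (r *: P + Q) Px)
  (ev_and (oact_ev P Px) (oact_ev Q Px))).
by rewrite opS_linr; lmod_ring C.
Qed.

Lemma oact_linl r x y P : par false x -> par false y ->
  oact (r *: x + y) P = r *: oact x P + oact y P.
Proof.
move=> Px Py; have Pxy : par false (r *: x + y) by exact: (par_sub g false).2.
have [S [-> [-> ->]]] := ev_ex (ev_and (oact_ev P Pxy)
  (ev_and (oact_ev P Px) (oact_ev P Py))).
have := ext0_linear gen h0E emb_inj rho1 r x y; rewrite -[_ *: (_ : C^o)]/(_ * _) => ->.
by rewrite opS_linl; lmod_ring C.
Qed.

Definition cl u P : O := crea u P + anni u P.

Lemma cl_xs a P : cl (xs a) P = mx a P.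
Proof. by rewrite /cl crea_xs anni_xs addr0. Qed.

Lemma cl_ds a P : cl (ds a) P = dx a P.
Proof. by rewrite /cl crea_ds anni_ds add0r. Qed.

Lemma cl_linr u r P Q : cl u (r *: P + Q) = r *: cl u P + cl u Q.
Proof. by rewrite /cl crea_linr anni_linr; lmod_ring C. Qed.

Lemma cl_linl r u v P : cl (r *: u + v) P = r *: cl u P + cl v P.
Proof. by rewrite /cl crea_linl anni_linl; lmod_ring C. Qed.

Lemma cl_ev u P : ev (fun S => cl u P =
  \sum_(a <- S) (cx u a *: mx a P + cd u a *: dx a P)).
Proof.
by apply: ev_imp (ev_and (crea_ev u P) (anni_ev u P)) => S [e1 e2]; rewrite /cl e1 e2 big_split.
Qed.

Section Commutators.
Variable x : g.
Hypothesis Px : par false x.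

(** Each [dx] in a term contracts once with [mx c]. The two contractions of the [be] part agree
    after summation by symmetry of [be], which absorbs the factor 1/2. *)
Lemma opS_mx S c P : c \in S -> opS S x (mx c P) =
  mx c (opS S x P) + \sum_(b <- S) (al x c b *: mx b P + be x c b *: dx b P).
Proof.
move=> cS.
have t a b : term x a b (mx c P) = mx c (term x a b P) +
    ((a == c)%:R *: (al x a b *: mx b P + (2^-1 * be x a b) *: dx b P)
     + (b == c)%:R *: ((2^-1 * be x a b) *: dx a P)).
  rewrite /term !dx_mx !(linearD (mx _)) !(linearD (dx _)) !(linearZ_LR (mx _)) !(linearZ_LR (dx _)).
  rewrite !dx_mx (linearN (mx c)) !(linearZ_LR (mx _)) !(mxC c).
  by lmod_ring C.
rewrite /opS; under eq_bigr do under eq_bigr do rewrite t.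
rewrite sum2_linear sum2_split; congr (_ + _).
rewrite sum2_split sum2_delta1 // sum2_delta2 //.
rewrite -big_split; apply: eq_bigr => b _ /=; rewrite (be_sym Px b c).
have h : (be x c b : C) = 2^-1 * be x c b + 2^-1 * be x c b by field.
by rewrite [in RHS]h; lmod_ring C.
Qed.

Lemma opS_dx S c P : c \in S -> opS S x (dx c P) =
  dx c (opS S x P) + \sum_(b <- S) (ga x c b *: mx b P - al x b c *: dx b P).
Proof.
move=> cS.
have t a b : term x a b (dx c P) = dx c (term x a b P) +
    ((a == c)%:R *: ((2^-1 * ga x a b) *: mx b P)
     + (b == c)%:R *: ((2^-1 * ga x a b) *: mx a P - al x a b *: dx a P)).
  rewrite /term !(linearD (dx _)) (linearN (dx c)) !(linearZ_LR (dx _)) !dx_mx.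
  rewrite !(linearD (mx _)) !(linearZ_LR (mx _)) !(dxC c) [c == b]eq_sym [c == a]eq_sym.
  by lmod_ring C.
rewrite /opS; under eq_bigr do under eq_bigr do rewrite t.
rewrite sum2_linear sum2_split; congr (_ + _).
rewrite sum2_split sum2_delta1 // sum2_delta2 //.
rewrite -big_split; apply: eq_bigr => b _ /=; rewrite (ga_sym Px b c).
have h : (ga x c b : C) = 2^-1 * ga x c b + 2^-1 * ga x c b by field.
by rewrite [in RHS]h; lmod_ring C.
Qed.

(** By [odd_ind] it is enough to treat the basis, where [opS_mx] and [opS_dx] produce exactly the
    coordinates of [brk x (xs c)] and [brk x (ds c)]; the scalar part of the action commutes with
    everything. *)
Lemma oact_cl u P : par true u -> oact x (cl u P) = cl u (oact x P) + cl (brk x u) P.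
Proof.
move: u; apply: odd_ind.
- split=> [|r u v eu ev'].
    have z Q : cl 0 Q = 0.
      by have := cl_linl (-1) 0 0 Q; rewrite scaler0 addr0 scaleN1r addNr.
    have := oact_linr (-1) 0 0 Px; rewrite scaler0 addr0 scaleN1r addNr => o0.
    by rewrite /= linear0r !z o0 addr0.
  by rewrite /= linearPr !cl_linl oact_linr // eu ev'; lmod_ring C.
- move=> c; rewrite !cl_xs.
  have [S [cS [-> [-> ->]]]] := ev_ex (ev_and (ev_mem c) (ev_and (oact_ev (mx c P) Px)
    (ev_and (oact_ev P Px) (cl_ev (brk x (xs c)) P)))).
  rewrite opS_mx // (linearB (mx c)) (linearZ_LR (mx c)) -!/(al _ _ _) -!/(be _ _ _).
  by rewrite /al /be addrAC.
move=> c; rewrite !cl_ds.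
have [S [cS [-> [-> ->]]]] := ev_ex (ev_and (ev_mem c) (ev_and (oact_ev (dx c P) Px)
  (ev_and (oact_ev P Px) (cl_ev (brk x (ds c)) P)))).
rewrite opS_dx // (linearB (dx c)) (linearZ_LR (dx c)).
under [X in _ = _ + X]eq_bigr do rewrite (cd_brk_ds Px) scaleNr.
by rewrite /ga addrAC.
Qed.

End Commutators.

Lemma cd_is_linear a : linear (fun v : g => cd v a : C^o).
Proof. by move=> r u v; rewrite cdP. Qed.

Lemma cd_pproj u a : cd (pproj g true u) a = cd u a.
Proof.
have := cdP 1 (pproj g false u) (pproj g true u) a.
by rewrite scale1r pprojD mul1r (cd_even _ (pproj_par false u)) add0r.
Qed.

Lemma posp_ds a : P_ (ds a) = ds a.
Proof. by rewrite mklinE; exact: (proj_id (ES_compl gen h0E _) (ds_pos a)). Qed.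

Lemma posp_xs a : P_ (xs a) = 0.
Proof.
rewrite mklinE; apply: (proj_eq0 (ES_compl gen h0E _)).
have := xs_neg a; move: (xs a) => u; apply: lspanS => v [k nk Ek]; exists k => //.
by move=> pk; move: nk pk; rewrite /negdeg /posdeg /=; lia.
Qed.

(** One [S] serves every [c]: it bounds the first index of [ga], and by symmetry also the second. *)
Lemma nonposp_brk_ds y c S : par false y ->
  (forall a, a \notin S -> forall b, ga y a b = 0) ->
  Q_ (brk y (ds c)) = \sum_(b <- S) ga y c b *: xs b.
Proof.
move=> Py gS.
have [T [ST e]] : exists T, (S `<=` T)%fset /\ brk y (ds c) =
    \sum_(b <- T) ga y c b *: xs b + \sum_(b <- T) cd (brk y (ds c)) b *: ds b.
  have evS : ev (fun T => S `<=` T)%fset by exists S.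
  have [T [ST e]] := ev_ex (ev_and evS (odd_coord (brk_odd Py (ds_odd c)))).
  by exists T.
rewrite e linearD !linear_sum /= [X in _ + X]big1 => [|b _]; last first.
  by rewrite linearZ_LR (nonposp gen h0E) posp_ds subrr scaler0.
rewrite addr0; apply/esym.
rewrite [RHS](_ : _ = \sum_(b <- T) ga y c b *: xs b); last first.
  by apply: eq_bigr => b _; rewrite linearZ_LR (nonposp gen h0E) posp_xs subr0.
apply: big_fset_incl => // b _ bS.
by rewrite ga_sym // gS // scale0r.
Qed.

(** On odd elements [P_] keeps the d-coordinates, and the nonpositive part of [brk y (ds a)] is
    [w a]. So the functionals [cd _ a] and the vectors [brk x (w a)] represent the operator, and
    their contraction pairs [be] of [x] with [ga] of [y]. *)
Lemma odd_trace_ev x y : par false x -> par false y -> ev (fun S =>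
  odd_trace gen h0E x y = \sum_(a <- S) \sum_(b <- S) be x a b * ga y a b).
Proof.
move=> Px Py; apply: ev_imp (ga_fin y) => S gS.
pose w a := \sum_(b <- S) ga y a b *: xs b.
have key u : par true u -> Q_ (brk y (P_ u)) = \sum_(a <- S) cd u a *: w a.
  move: u; apply: odd_ind.
  - split=> [|r u v eu ev'] /=.
      by rewrite !linear0 big1 // => a _; rewrite /cd linear0l mulr0 scale0r.
    rewrite (linearP P_) linearPr (linearP Q_) eu ev' scaler_sumr -big_split.
    by apply: eq_bigr => a _ /=; rewrite cdP; lmod_ring C.
  - move=> c /=; rewrite posp_xs !linear0 big1 // => a _.
    by rewrite cd_xs scale0r.
  move=> c /=; rewrite posp_ds (nonposp_brk_ds _ Py gS).
  under [RHS]eq_bigr do rewrite cd_ds.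
  have [cS|cS] := boolP (c \in S); first by rewrite sum_delta.
  rewrite !big_seq !big1 // => [a aS|b _]; last by rewrite gS // scale0r.
  by rewrite (_ : (a == c) = false) ?scale0r //; apply: contraNF cS => /eqP<-.
rewrite /odd_trace; apply: has_ftrE.
exists [seq (mklin (cd_is_linear a), brk x (w a)) | a <- S] => [v|].
  rewrite /frop big_map /= key; last exact: pproj_par.
  rewrite linear_sumr; apply: eq_bigr => a _.
  by rewrite linearZr_LR (mklinE (cd_is_linear a)) cd_pproj.
rewrite /frtr big_map; apply: eq_bigr => a _ /=; rewrite (mklinE (cd_is_linear a)) /w linear_sumr.
rewrite /cd linear_sumlz mulr_sumr; apply: eq_bigr => b _.
rewrite linearZr_LR linearZl_LR /= (be_sym Px) /be /cd; ring.
Qed.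

Lemma kapZ r P : kap (r *: P) = r * kap P :> C.
Proof. exact: linearZ_LR. Qed.

(** A vacuum expectation: [y] creates two variables and [x] has to annihilate both, in two ways that
    agree by symmetry of [ga], so 1/2 times 1/2 times 2 leaves 1/2. The other contribution is the
    product of the two scalars. *)
Lemma kap_oact x y P Q : par false x -> par false y ->
  oact y one = P -> oact x P = Q ->
  kap Q = - 2^-1 * odd_trace gen h0E x y + ext0 rho1 x * ext0 rho1 y :> C.
Proof.
move=> Px Py yP xP.
have [S [e1 [e2 e3]]] := ev_ex (ev_and (oact_ev one Py) (ev_and (oact_ev P Px)
  (odd_trace_ev Px Py))).
rewrite yP in e1; rewrite xP in e2; rewrite e3.
have PE : P = - 2^-1 *: (\sum_(a <- S) \sum_(b <- S) ga y a b *: mx b (mx a one))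
    - ext0 rho1 y *: one.
  rewrite e1 /opS; congr (_ - _); rewrite scaler_sumr; apply: eq_bigr => a _.
  rewrite scaler_sumr; apply: eq_bigr => b _.
  by rewrite /term dx1 !linear0 ?scaler0 ?add0r ?sub0r -scalerA scaleNr.
have kapP : kap P = - ext0 rho1 y :> C.
  rewrite PE linearB !kapZ (sum2_linear kap) kap1 big1 ?mulr0 ?sub0r ?mulr1 // => a _.
  by rewrite big1 // => b _; rewrite kapZ kap_mx mulr0.
have dd c d : c \in S -> d \in S -> kap (dx d (dx c P)) = - ga y c d :> C.
  move=> cS dS.
  have dE : dx d (dx c P) = - 2^-1 *: (\sum_(a <- S) \sum_(b <- S)
      ((a == c)%:R *: ((b == d)%:R *: (ga y a b *: one))
       + (b == c)%:R *: ((a == d)%:R *: (ga y a b *: one)))).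
    rewrite PE !(linearB (dx _)) !(linearZ_LR (dx _)) dx1 linear0 scaler0 subr0.
    rewrite (sum2_linear (dx c)) (sum2_linear (dx d)); congr (_ *: _); apply: eq_bigr => a _; apply: eq_bigr => b _.
    rewrite !(linearZ_LR (dx _)) dx_mx dx_mx dx1 linear0 add0r.
    rewrite (linearD (dx d)) (linearZ_LR (mx b)) !(linearZ_LR (dx d)) !dx_mx dx1 !linear0 !add0r.
    rewrite [c == a]eq_sym [c == b]eq_sym [d == a]eq_sym [d == b]eq_sym.
    by lmod_ring C.
  rewrite dE sum2_split sum2_delta1 // sum2_delta2 // !sum_delta // (ga_sym Py d c).
  by rewrite -scalerDl scalerA kapZ kap1; field.
rewrite e2 linearB kapZ kapP mulrN opprK.
congr (_ + _); rewrite /opS (sum2_linear kap) mulr_sumr; apply: eq_big_seq => a aS.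
rewrite mulr_sumr; apply: eq_big_seq => b bS.
rewrite /term linearB linearD !kapZ !kap_mx dd //; ring.
Qed.

Hypothesis rho1E : forall x y, par false x -> par false y ->
  ext0 rho1 (brk x y) = 2^-1 * (odd_trace gen h0E x y - odd_trace gen h0E y x).

(** The defect [Z] commutes with the Clifford action by [oact_cl] and the Jacobi identity, so
    [Z one] is killed by every [dx a] and is a multiple of [one]. The multiple is
    [ext0 rho1 (brk x y)] minus half the antisymmetrized odd trace, zero by [rho1E]. *)
Theorem oact_brk x y P : par false x -> par false y ->
  oact (brk x y) P = oact x (oact y P) - oact y (oact x P).
Proof.
move=> Px Py; have Pxy : par false (brk x y) := brk_par Px Py.
pose Z P := oact x (oact y P) - oact y (oact x P) - oact (brk x y) P.
suff Z0 : Z P = 0 by apply/eqP; rewrite eq_sym -subr_eq0; apply/eqP.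
have Zlin r Q R : Z (r *: Q + R) = r *: Z Q + Z R.
  by rewrite /Z !oact_linr //; lmod_ring C.
have clB u Q R : cl u (Q - R) = cl u Q - cl u R.
  by have := cl_linr u (-1) R Q; rewrite !scaleN1r addrC => ->; rewrite addrC.
have clD u v Q : cl (u + v) Q = cl u Q + cl v Q.
  by have := cl_linl 1 u v Q; rewrite !scale1r.
have oD z Q R : par false z -> oact z (Q + R) = oact z Q + oact z R.
  by move=> Pz; have := oact_linr 1 Q R Pz; rewrite !scale1r.
have Zcl u Q : par true u -> Z (cl u Q) = cl u (Z Q).
  move=> Pu; rewrite /Z.
  rewrite (clB u (_ - _) (oact (brk x y) Q)) (clB u (oact x _) (oact y _)).
  have Pxu := brk_odd Px Pu; have Pyu := brk_odd Py Pu.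
  rewrite (oact_cl Py _ Pu) (oact_cl Px _ Pu) (oact_cl Pxy _ Pu).
  rewrite (oD x (cl u _) (cl (brk y u) Q) Px) (oD y (cl u _) (cl (brk x u) Q) Py).
  rewrite (oact_cl Px _ Pu) (oact_cl Px _ Pyu) (oact_cl Py _ Pu) (oact_cl Py _ Pxu).
  by rewrite (brk_jac_even y u Px) clD; lmod_ring C.
have Zmx a Q : Z (mx a Q) = mx a (Z Q) by rewrite -!cl_xs Zcl //; exact: xs_odd.
have Z00 : Z 0 = 0 by have := Zlin (-1) 0 0; rewrite scaler0 addr0 scaleN1r addNr.
have Zone : Z one = 0.
  rewrite [Z one]dx_eq0 => [|a]; last first.
    rewrite -cl_ds -Zcl; last exact: ds_odd.
    by rewrite cl_ds dx1 Z00.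
  rewrite [X in X *: _](_ : _ = 0) ?scale0r // /Z.
  have kapB U V : kap (U - V) = kap U - kap V :> C by exact: linearB.
  rewrite (kapB (_ - _) (oact (brk x y) one)) (kapB (oact x _) (oact y _)).
  rewrite (kap_oact Px Py erefl erefl) (kap_oact Py Px erefl erefl).
  have [S ->] := ev_ex (oact_ev one Pxy).
  rewrite linearB kapZ kap1 /opS (sum2_linear kap) big1 => [|a _]; last first.
    rewrite big1 // => b _; rewrite /term dx1 !linear0 ?scaler0 ?add0r ?sub0r.
    by rewrite linearN kapZ kap_mx mulr0 oppr0.
  rewrite rho1E //; ring.
move: P; apply: mx_ind => [||a Q ZQ] //; last by rewrite Zmx ZQ linear0.
by split=> // r Q R ZQ ZR; rewrite Zlin ZQ ZR scaler0 addr0.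
Qed.

(** * Contravariance of the oscillator form *)

Section Contravariance.
Variables (w : g -> g) (form : O -> O -> C).
Hypothesis formPr : forall P r Q R, form P (r *: Q + R) = r * form P Q + form P R.
Hypothesis form_herm : forall P Q, form P Q = (form Q P)^*.
Hypothesis form_mx : forall a P Q, form (mx a P) Q = form P (dx a Q).
Hypothesis w_anti : conj_anti_involution w.
Hypothesis w_par : forall q x, par q x -> par q (w x).
Hypothesis w_ext : forall x, ext0 rho1 x = (ext0 rho1 (w x))^*.
Hypothesis w_adapted : omega_adapted xs ds w.

Lemma form_dx a P Q : form (dx a P) Q = form P (mx a Q).
Proof. by rewrite form_herm -form_mx -form_herm. Qed.

Lemma coord_anti : exists2 s : C, s != 0 &
  (forall a, w (xs a) = s *: ds a /\ w (ds a) = s *: xs a) /\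
  forall u, par true u -> forall b,
    cd (w u) b = s * (cx u b)^* /\ cx (w u) b = s * (cd u b)^*.
Proof.
have [s sE wE] := w_adapted; exists s.
  by case: sE => ->; rewrite ?oppr_eq0 oner_eq0.
split=> //; have [w1 _ _] := w_anti.
apply: odd_ind.
- split=> [b|r u v eu ev' b] /=.
    rewrite (anti0 w_anti) /cd /cx !linear0l !linear0r !mulr0 conjC0.
    by rewrite !mulr0.
  have [e1 e2] := eu b; have [e3 e4] := ev' b.
  rewrite w1 !cdP !cxP e1 e2 e3 e4 !rmorphD !rmorphM /=; split; ring.
- move=> a b; have [-> _] := wE a; rewrite cx_xs cd_xs conjC0 mulr0.
  have := cdP s (ds a) 0 b; have := cxP s (ds a) 0 b.
  rewrite addr0 cx_ds cd_ds /cx /cd linear0r linear0l !mulr0 !addr0 => -> ->.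
  by rewrite conjC_nat.
move=> a b; have [_ ->] := wE a; rewrite cx_ds cd_ds conjC0 mulr0.
have := cdP s (xs a) 0 b; have := cxP s (xs a) 0 b.
rewrite addr0 cx_xs cd_xs /cx /cd linear0r linear0l !mulr0 !addr0 => -> ->.
by rewrite conjC_nat.
Qed.

(** [w] sends [brk x (xs a)] to [- s] times [brk (w x) (ds a)]. Comparing coordinates by
    [coord_anti] gives both equations with a common factor [s], which is cancelled. *)
Lemma anti_coef x a b : par false x ->
  (al x a b)^* = al (w x) b a /\ (be x a b)^* = - ga (w x) a b.
Proof.
move=> Px; have [s s0 [wE sE]] := coord_anti; have [_ _ wB] := w_anti.
have Pwx := w_par Px.
have [e1 e2] := sE _ (brk_odd Px (xs_odd a)) b.
have we : w (brk x (xs a)) = (- s) *: brk (w x) (ds a) + 0.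
  by rewrite wB (wE a).1 linearZl_LR (brk_skew_even (ds a) Pwx) addr0 scaleNr scalerN opprK.
split; apply: (mulfI s0).
  rewrite -e1 we cdP (cd_brk_ds Pwx) /cd linear0l; ring.
rewrite -e2 we cxP /ga /cx linear0r; ring.
Qed.

(** The adjoint of the term [(b, a)] of [x] is the term [(a, b)] of [w x]: [al] is conjugate
    transposed, while [be] and [ga] are exchanged with a sign that matches their opposite signs in
    [term]. *)
Lemma oact_contravariant x P Q : par false x ->
  form (oact x P) Q = form P (oact (w x) Q).
Proof.
move=> Px; have Pwx := w_par Px.
have [S [-> ->]] := ev_ex (ev_and (oact_ev P Px) (oact_ev Q Pwx)).
have flin R : linear (form R : O -> C^o) by move=> r U V; rewrite formPr.
have formr R : form R = mklin (flin R) :> (O -> C) by apply/funext => U; rewrite mklinE.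
have fB R U V : form R (U - V) = form R U - form R V by rewrite formr linearB.
have fZ R r U : form R (r *: U) = r * form R U by rewrite formr linearZ_LR.
have fD R U V : form R (U + V) = form R U + form R V by rewrite formr linearD.
have fS R (F : J -> J -> O) : form R (\sum_(a <- S) \sum_(b <- S) F a b) =
    \sum_(a <- S) \sum_(b <- S) form R (F a b).
  by rewrite formr (sum2_linear (mklin (flin R))).
rewrite form_herm (fB _ (opS _ _ _)) (fB _ (opS _ _ _)) !fZ rmorphB rmorphM /=.
rewrite (w_ext x) conjCK; congr (_ - _); last by rewrite -form_herm.
rewrite /opS !fS exchange_big rmorph_sum /=.
apply: eq_bigr => a _; rewrite rmorph_sum; apply: eq_bigr => b _ /=.
have [wal wbe] := anti_coef b a Px.
have wga : (ga x b a)^* = - be (w x) b a.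
  have [_ wK _] := w_anti; have [_ e] := anti_coef b a Pwx.
  by apply: (inv_inj (@conjCK C)); rewrite rmorphN /= e wK conjCK opprK.
have two : (2^-1 : C)^* = 2^-1 by rewrite fmorphV /= conjC_nat.
have adj1 : (form Q (mx a (dx b P)))^* = form P (mx b (dx a Q)).
  by rewrite -form_herm form_mx form_dx.
have adj2 : (form Q (dx a (dx b P)))^* = form P (mx b (mx a Q)).
  by rewrite -form_herm !form_dx.
have adj3 : (form Q (mx a (mx b P)))^* = form P (dx b (dx a Q)).
  by rewrite -form_herm !form_mx.
have tE : (form Q (term x b a P))^* = (al x b a)^* * (form Q (mx a (dx b P)))^*
    + (2^-1)^* * (be x b a)^* * (form Q (dx a (dx b P)))^*
    - (2^-1)^* * (ga x b a)^* * (form Q (mx a (mx b P)))^*.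
  rewrite /term fB fD !fZ; move: (al x b a) (be x b a) (ga x b a) => r1 r2 r3.
  by rewrite rmorphB rmorphD !rmorphM.
rewrite tE two wal wbe wga adj1 adj2 adj3 /term fB fD !fZ.
rewrite (be_sym Pwx b a) (ga_sym Pwx b a); ring.
Qed.

End Contravariance.
End Representation.

End Oscillator.

(** * Tensor products *)

Section Submodule.
Variables (C : numClosedFieldType) (V : lmodType C) (W : set V).
Hypothesis sW : subspace W.

(** With the proof of [subspace W] as an argument, the closure instance is found from the predicate.
    The resulting module type serves as a target for the universal property in [tens_ind]. *)
Definition subspace_pred of subspace W : {pred V} := [pred x | `[< W x >]].

Fact subspace_pred_closed : submod_closed (subspace_pred sW).
Proof.
split=> [|r u v]; rewrite !inE /=; first by apply/asboolP; exact: subspace0 sW.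
by move=> /asboolP Wu /asboolP Wv; apply/asboolP; exact: sW.2.
Qed.

HB.instance Definition _ :=
  GRing.isSubmodClosed.Build C V (subspace_pred sW) subspace_pred_closed.

Record submodule_type := SubmoduleType
  { submodule_val : V; _ : submodule_val \in subspace_pred sW }.

HB.instance Definition _ := [isSub for submodule_val].
HB.instance Definition _ := [Choice of submodule_type by <:].
HB.instance Definition _ := [SubChoice_isSubLmodule of submodule_type by <:].

End Submodule.

Section Tensor.
Variables (C : numClosedFieldType) (M O T : lmodType C).
Variable tens : {bilinear M -> O -> T}.
Hypothesis tensP : is_tensor tens.

Definition mkbilin (V : lmodType C) (f : M -> O -> V)
  (fl : forall P, linear (f^~ P)) (fr : forall v, linear (f v)) :
  {bilinear M -> O -> V} :=
  HB.pack f (bilinear_isBilinear.Build C M O V *:%R *:%R f (fl, fr)).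

Lemma tens_lift (V : lmodType C) (f : M -> O -> V) :
  (forall P, linear (f^~ P)) -> (forall v, linear (f v)) ->
  exists h : {linear T -> V}, forall v P, h (tens v P) = f v P.
Proof. by move=> fl fr; have [h [hE _]] := tensP (mkbilin fl fr); exists h. Qed.

(** The universal property lifts the pure tensors to a map into [W]. Followed by the inclusion it
    fixes pure tensors, so by uniqueness it is the identity. *)
Lemma tens_ind (W : set T) : subspace W -> (forall v P, W (tens v P)) -> forall t, W t.
Proof.
move=> sW Wt; pose S := submodule_type sW.
have Wp v P : tens v P \in subspace_pred sW by rewrite inE; apply/asboolP.
pose f v P : S := Sub (tens v P) (Wp v P).
have fl P : linear (f^~ P) by move=> r u v; apply: val_inj; rewrite /= linearPl.
have fr v : linear (f v) by move=> r P Q; apply: val_inj; rewrite /= linearPr.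
have [h hE] := tens_lift fl fr.
have [k [_ ku]] := tensP tens.
move=> t; have -> : t = val (h t).
  have e1 := ku (idfun : {linear T -> T}) (fun v P => erefl).
  have e2 := ku (val \o h : {linear T -> T}).
  rewrite [LHS](e1 t) -e2 // => v P; by rewrite /= hE.
by have := valP (h t); rewrite inE => /asboolP.
Qed.

Lemma tens_eq (V : lmodType C) (h k : {linear T -> V}) :
  (forall v P, h (tens v P) = k (tens v P)) -> h =1 k.
Proof.
move=> hk; apply: tens_ind => //; split=> [|r u v] /=; first by rewrite !linear0.
by rewrite !linearP => -> ->.
Qed.

Section Form.
Variables (fM : M -> M -> C) (fO : O -> O -> C).
Hypothesis fM_herm : hermitian_form fM.
Hypothesis fO_herm : hermitian_form fO.

(** Forms are conjugate-linear on the left, whereas the universal property handles bilinear maps. It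
    is applied in the right argument, then to the conjugate of the result in the left one, and [f]
    conjugates back. *)
Lemma tensor_form : exists f : T -> T -> C, hermitian_form f /\
  forall v w P Q, f (tens v P) (tens w Q) = fM v w * fO P Q.
Proof.
have [Mr Mh] := fM_herm; have [Or Oh] := fO_herm.
have Ml r u v w : fM (r *: u + v) w = r^* * fM u w + fM v w.
  by rewrite Mh Mr rmorphD rmorphM /= -!Mh.
have Ol r u v w : fO (r *: u + v) w = r^* * fO u w + fO v w.
  by rewrite Oh Or rmorphD rmorphM /= -!Oh.
have /choice[G0 G0E] vP : exists h : {linear T -> C^o},
    forall w Q, h (tens w Q) = fM vP.1 w * fO vP.2 Q.
  apply: (tens_lift (f := fun w Q => (fM vP.1 w * fO vP.2 Q : C^o))).
    by move=> Q r u v; rewrite Mr -[_ *: (_ : C^o)]/(_ * _); ring.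
  by move=> v r P Q; rewrite Or -[_ *: (_ : C^o)]/(_ * _); ring.
pose G v P : {linear T -> C^o} := G0 (v, P).
have GE v P w Q : G v P (tens w Q) = fM v w * fO P Q :> C by exact: G0E.
have Gl v P r t t' : G v P (r *: t + t') = r * G v P t + G v P t' :> C.
  exact: linearP.
have /choice[K KE] t : exists h : {linear T -> C^o},
    forall v P, h (tens v P) = (G v P t)^* :> C.
  apply: (tens_lift (f := fun v P => ((G v P t)^* : C^o))).
    move=> P r u v; suff -> : G (r *: u + v) P t = r^* * G u P t + G v P t :> C.
      by rewrite rmorphD rmorphM /= conjCK.
    have lr : linear (fun t => r^* * G u P t + G v P t : C^o).
      by move=> c t1 t2; rewrite !Gl -[_ *: (_ : C^o)]/(_ * _); ring.
    rewrite -[RHS](mklinE lr); move: t; apply: (tens_eq (h := G (r *: u + v) P) (k := mklin lr)) => w Q.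
    by rewrite mklinE !GE Ml; ring.
  move=> v r P Q; suff -> : G v (r *: P + Q) t = r^* * G v P t + G v Q t :> C.
    by rewrite rmorphD rmorphM /= conjCK.
  have lr : linear (fun t => r^* * G v P t + G v Q t : C^o).
    by move=> c t1 t2; rewrite !Gl -[_ *: (_ : C^o)]/(_ * _); ring.
  rewrite -[RHS](mklinE lr); move: t; apply: (tens_eq (h := G v (r *: P + Q)) (k := mklin lr)) => w Q'.
  by rewrite mklinE !GE Ol; ring.
pose f s t : C := (K t s : C)^*.
have fG v P t : f (tens v P) t = G v P t :> C by rewrite /f KE conjCK.
have fl r s s' t : f (r *: s + s') t = r^* * f s t + f s' t.
  by rewrite /f linearP /= -[_ *: (_ : C^o)]/(_ * _) rmorphD rmorphM.
have f0l t : f 0 t = 0 by rewrite /f linear0 conjC0.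
have fr s r t t' : f s (r *: t + t') = r * f s t + f s t'.
  move: s; apply: (@tens_ind [set s | f s (r *: t + t') = r * f s t + f s t']).
    split=> [|c s s'] /=; first by rewrite !f0l mulr0 addr0.
    by rewrite !fl => -> ->; ring.
  by move=> v P /=; rewrite !fG Gl.
exists f; split; last by move=> v w P Q; rewrite fG GE.
split=> // s t; move: s; apply: (@tens_ind [set s | f s t = (f t s)^*]).
  split=> [|c s s'] /=.
    by rewrite f0l; have := fr t (-1) 0 0; rewrite scaler0 addr0 mulN1r addNr => ->; rewrite conjC0.
  by rewrite fl fr rmorphD rmorphM /= => -> ->.
move=> v P /=; move: t; apply: (@tens_ind [set t | f (tens v P) t = (f t (tens v P))^*]).
  split=> [|c s s'] /=.
    by rewrite f0l; have := fr (tens v P) (-1) 0 0; rewrite scaler0 addr0 mulN1r addNr => ->; rewrite conjC0.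
  by rewrite fl fr rmorphD rmorphM /= conjCK => -> ->.
by move=> w Q /=; rewrite !fG !GE rmorphM /= -Mh -Oh.
Qed.

Variables (I : choiceType) (e : I -> O) (c : I -> C).
Hypothesis e_span : forall P, exists r : I -> C,
  ev (fun S => P = \sum_(i <- S) r i *: e i).
Hypothesis e_orth : forall i j, fO (e i) (e j) = (i == j)%:R * c i.
Hypothesis c_gt0 : forall i, 0 < c i.

Lemma tensor_expand t : exists v : I -> M,
  ev (fun S => t = \sum_(i <- S) tens (v i) (e i)).
Proof.
move: t; apply: (@tens_ind [set t | exists v : I -> M,
  ev (fun S => t = \sum_(i <- S) tens (v i) (e i))]).
  split=> [|r s t [v ev1] [w ev2]] /=.
    exists (fun=> 0), fset0 => S _.
    by rewrite big1 // => i _; rewrite linear0l.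
  exists (fun i => r *: v i + w i); apply: ev_imp (ev_and ev1 ev2) => S [-> ->].
  rewrite scaler_sumr -big_split; apply: eq_bigr => i _ /=.
  by rewrite linearPl.
move=> v P /=; have [r evP] := e_span P; exists (fun i => r i *: v).
apply: ev_imp evP => S {1}->; rewrite linear_sumr; apply: eq_bigr => i _.
by rewrite linearZl_LR linearZr_LR.
Qed.

(** Expanding [t] along the orthogonal [e i] with coefficients in [M] removes the cross terms; what
    remains is a sum of nonnegative terms, one of them positive since [t] is nonzero. *)
Lemma tensor_posdef (f : T -> T -> C) : hermitian_form f ->
  (forall v w P Q, f (tens v P) (tens w Q) = fM v w * fO P Q) ->
  posdef fM -> posdef f.
Proof.
move=> [fr fh] fE pM t t0; have [v /ev_ex[S tE]] := tensor_expand t.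
have f0 s : f s 0 = 0 by have := fr s (-1) 0 0; rewrite scaler0 addr0 mulN1r addNr.
have fD s x y : f s (x + y) = f s x + f s y by have := fr s 1 x y; rewrite scale1r mul1r.
have fS s (r : seq I) F : f s (\sum_(i <- r) F i) = \sum_(i <- r) f s (F i).
  by elim: r => [|i r IH]; rewrite ?big_nil // !big_cons fD IH.
have fSl s (r : seq I) F : f (\sum_(i <- r) F i) s = \sum_(i <- r) f (F i) s.
  by rewrite fh fS rmorph_sum; apply: eq_bigr => i _; rewrite /= -fh.
have -> : f t t = \sum_(i <- S) fM (v i) (v i) * c i.
  rewrite {1}tE fSl; apply: eq_big_seq => i iS.
  rewrite tE fS (big_fsetD1 i iS) /= fE e_orth eqxx mul1r big_seq big1 ?addr0 // => j.
  by rewrite !inE => /andP[ji _]; rewrite fE e_orth eq_sym (negbTE ji) mul0r mulr0.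
have [Mr Mh] := fM_herm.
have M0 : fM 0 0 = 0 by have := Mr 0 (-1) 0 0; rewrite scaler0 addr0 mulN1r addNr.
have ge i : 0 <= fM (v i) (v i) * c i.
  apply: mulr_ge0; last exact: ltW.
  by have [->|v0] := eqVneq (v i) 0; [rewrite M0|exact/ltW/pM].
have [i iS vi0] : exists2 i, i \in S & v i != 0.
  apply: contrapT => ne; case/eqP: t0; rewrite tE big_seq big1 // => i iS.
  have [->|v0] := eqVneq (v i) 0; first by rewrite linear0l.
  by case: ne; exists i.
rewrite (big_fsetD1 i iS) /=; apply: ltr_wpDr; last by apply: mulr_gt0 => //; exact: pM.
by apply: sumr_ge0 => j _.
Qed.

End Form.
End Tensor.

(** * The diagonal action of the even part *)

Section EvenTensor.
Variables (C : numClosedFieldType) (n : nat) (A : 'M[C]_n) (p : 'I_n -> bool).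
Variables (H : realization A) (g : chevalleyAlg p H) (M : superModule g).
Variables (O T : lmodType C) (tens : {bilinear M -> O -> T}) (w : g -> g).
Variables (o : g -> O -> O) (fM : M -> M -> C) (fO : O -> O -> C).
Hypothesis tensP : is_tensor tens.
Hypothesis w_even : forall x : g, par false x -> par false (w x).
Hypothesis o_linr : forall x : g, par false x -> linear (o x).
Hypothesis o_linl : forall r (x y : g) P, par false x -> par false y ->
  o (r *: x + y) P = r *: o x P + o y P.
Hypothesis o_brk : forall (x y : g) P, par false x -> par false y ->
  o (brk x y) P = o x (o y P) - o y (o x P).
Hypothesis fM_herm : hermitian_form fM.
Hypothesis fO_herm : hermitian_form fO.
Hypothesis fM_contra : forall x u v, fM (act M x u) v = fM u (act M (w x) v).
Hypothesis fO_contra : forall (x : g) P Q, par false x -> fO (o x P) Q = fO P (o (w x) Q).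
Hypothesis fM_pos : posdef fM.
Variables (I : choiceType) (e : I -> O) (c : I -> C).
Hypothesis e_span : forall P, exists r : I -> C,
  ev (fun S => P = \sum_(i <- S) r i *: e i).
Hypothesis e_orth : forall i j, fO (e i) (e j) = (i == j)%:R * c i.
Hypothesis c_gt0 : forall i, 0 < c i.

Lemma act_brk_even (x y : g) (v : M) : par false x -> par false y ->
  act M (brk x y) v = act M x (act M y v) - act M y (act M x v).
Proof.
move=> Px Py; case: M v => V P a ? ? HM v.
by rewrite (HM _ _ _ _ _ Px Py) scale1r.
Qed.

(** All the identities are additive in the tensors and compatible with scalars, so pure tensors
    suffice; there the mixed terms of the diagonal action cancel in the commutator. *)
Theorem tensor_unitarizable : exists (a : g -> T -> T) (f : T -> T -> C),
  [/\ forall x v P, par false x ->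
        a x (tens v P) = tens (act M x v) P + tens v (o x P),
      forall v u P Q, f (tens v P) (tens u Q) = fM v u * fO P Q
    & even_unitarizable w a f].
Proof.
have [f [fh fE]] := tensor_form tensP fM_herm fO_herm.
(* The identity is a default value for [x] that are not even, of which nothing is claimed. *)
have /choice[a0 a0E] x : exists h : {linear T -> T}, par false x ->
    forall v P, h (tens v P) = tens (act M x v) P + tens v (o x P).
  have [Px|nPx] := pselect (par false x); last by exists idfun => /nPx.
  have [|v|h hE] := tens_lift tensP (f := fun v P => tens (act M x v) P + tens v (o x P)).
  - by move=> P r u v; rewrite linearPr !linearPl; lmod_ring C.
  - by move=> r P Q; rewrite (o_linr Px) !linearPr; lmod_ring C.
  by exists h => _ v P; rewrite hE.
exists a0, f; split=> //; first by move=> x v P Px; rewrite a0E.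
have [fr fh'] := fh.
have fl r s s' t : f (r *: s + s') t = r^* * f s t + f s' t.
  by rewrite fh' fr rmorphD rmorphM /= -!fh'.
have f0l t : f 0 t = 0.
  by have := fl (-1) 0 0 t; rewrite scaler0 addr0 rmorphN1 mulN1r addNr.
have f0r t : f t 0 = 0 by rewrite fh' f0l conjC0.
have fDl s s' t : f (s + s') t = f s t + f s' t.
  by have := fl 1 s s' t; rewrite scale1r conjC1 mul1r.
have fDr s t t' : f s (t + t') = f s t + f s t'.
  by have := fr s 1 t t'; rewrite scale1r mul1r.
split.
- by move=> x _ r u v; rewrite linearP.
- move=> r x y t Px Py.
  have lr : linear (fun t => r *: a0 x t + a0 y t).
    by move=> c' t1 t2; rewrite !(linearP (a0 _)); lmod_ring C.
  rewrite -[RHS](mklinE lr); move: t; apply: (tens_eq tensP) => v P.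
  have Pr : par false (r *: x + y) by exact: (par_sub g false).2.
  rewrite (mklinE lr) !a0E // o_linl // linearPr !linearPl.
  by lmod_ring C.
- move=> x y t Px Py; have Pxy : par false (brk x y) := brk_par Px Py.
  have lr : linear (fun t => a0 x (a0 y t) - a0 y (a0 x t)).
    by move=> c' t1 t2; rewrite !(linearP (a0 _)); lmod_ring C.
  rewrite -[RHS](mklinE lr); move: t; apply: (tens_eq tensP) => v P.
  rewrite (mklinE lr) !a0E // !(linearD (a0 _)) !a0E // o_brk // act_brk_even //.
  by rewrite linearBr linearBl; lmod_ring C.
- split=> //; exact: (tensor_posdef tensP fM_herm e_span e_orth c_gt0 fh fE fM_pos).
move=> x s t Px; have Pwx := w_even Px.
move: s; apply: (tens_ind tensP (W := [set s | f (a0 x s) t = f s (a0 (w x) t)])).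
  split=> [|r u v] /=; first by rewrite linear0 !f0l.
  by rewrite linearP !fl => -> ->.
move=> v P /=; move: t.
apply: (tens_ind tensP (W := [set t | f (a0 x (tens v P)) t = f (tens v P) (a0 (w x) t)])).
  split=> [|r u u'] /=; first by rewrite linear0 !f0r.
  by rewrite linearP !fr => -> ->.
move=> u Q /=; rewrite !a0E // fDl fDr !fE fM_contra fO_contra //.
Qed.

End EvenTensor.

(** * Unitarizability *)

Section Instance.
Variables (C : numClosedFieldType) (J : choiceType).
Local Notation O := {malg C[{cmonom J}]}.

Definition oscO : lmodType C := {malg C[{cmonom J}]}.
Definition omul : J -> {linear oscO -> oscO} := @mulx C J.
Definition oder : J -> {linear oscO -> oscO} := @pder C J.
Definition oone : oscO := mono C (mone : {cmonom J}).
Fact ocst_subproof : linear (fun P : oscO => P@_(mone : {cmonom J}) : C^o).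
Proof. by move=> r P Q; rewrite mcoeffD mcoeffZ. Qed.
Definition ocst : {linear oscO -> C^o} := mklin ocst_subproof.

Lemma oder_omul a b P :
  oder a (omul b P) = omul b (oder a P) + (a == b)%:R *: P.
Proof. exact: (@pder_mulx C J). Qed.

Lemma oderC a b P : oder a (oder b P) = oder b (oder a P).
Proof. exact: (@pderC C J). Qed.

Lemma omulC a b P : omul a (omul b P) = omul b (omul a P).
Proof. exact: (@mulxC C J). Qed.

Lemma oder1 a : oder a oone = 0.
Proof. exact: (@pder1 C J). Qed.

Lemma ocstE P : ocst P = P@_(mone : {cmonom J}).
Proof. exact: mklinE. Qed.

Lemma ocst1 : ocst oone = 1.
Proof. by rewrite ocstE; exact: (@mcoeff1_one C J). Qed.

Lemma ocst_omul a P : ocst (omul a P) = 0.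
Proof. by rewrite ocstE; exact: (@mcoeff1_mulx C J). Qed.

Lemma oder_eq0 P : (forall a, oder a P = 0) -> P = (ocst P : C) *: oone.
Proof.
move=> P0; rewrite ocstE; apply: (@pder_eq0 C J) => // k c /eqP.
by rewrite mulf_eq0 pnatr_eq0 => /eqP.
Qed.

Lemma oder_supp P : ev (fun S : {fset J} => forall a, a \notin S -> oder a P = 0).
Proof.
have [V HV] := @pder_supp C J P; exists V => S VS a aS; apply: HV.
by apply: contra aS; exact: (fsubsetP VS).
Qed.

Lemma omul_ind (W : set oscO) : subspace W -> W oone ->
  (forall a P, W P -> W (omul a P)) -> forall P, W P.
Proof.
move=> sW W1 WX; apply: (@mulx_ind C J W) => //; first exact: (subspace0 sW).
exact: sW.2.
Qed.

Implicit Types P Q R : oscO.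

Lemma osc_form_linr P r Q R :
  osc_form P (r *: Q + R) = r * osc_form P Q + osc_form P R.
Proof. exact: (@oformPr C J (@Num.conj C)). Qed.

Lemma osc_form_herm P Q : osc_form P Q = (osc_form Q P)^*.
Proof. exact: (@oform_herm C J (@Num.conj C) (@conjCK C)). Qed.

Lemma osc_form_omul a P Q : osc_form (omul a P) Q = osc_form P (oder a Q).
Proof. exact: (@oform_mulxl C J (@Num.conj C) (@conjCK C)). Qed.

Lemma osc_hermitian : hermitian_form (@osc_form C J : oscO -> oscO -> C).
Proof. by split; [exact: osc_form_linr|exact: osc_form_herm]. Qed.

Lemma osc_span (P : oscO) : exists r : {cmonom J} -> C,
  ev (fun S => P = \sum_(m <- S) r m *: (mono C m : oscO)).
Proof.
exists (fun m => P@_m), (msupp P) => S PS.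
exact: (@mono_expand C J).
Qed.

Lemma osc_orth m k : osc_form (mono C m : oscO) (mono C k : oscO) =
  (m == k)%:R * (mfact m)%:R :> C.
Proof. exact: (@oform_mono C J (@Num.conj C)). Qed.

Lemma mfact_gt0 (m : {cmonom J}) : 0 < (mfact m)%:R :> C.
Proof. by rewrite ltr0n; apply: prodn_gt0 => a; exact: fact_gt0. Qed.

Variables (n : nat) (A : 'M[C]_n) (p : 'I_n -> bool).
Variables (H : realization A) (g : chevalleyAlg p H) (B : {biscalar g}).
Variables (xs ds : J -> g) (rho1 : 'Hom(H, C^o)).

Lemma creatE u P : creat B ds u P = crea B ds omul u P.
Proof. by apply: eq_fsbigr => a _; congr (_ *: _); apply/esym; exact: (@mulxE C J). Qed.

Lemma annihE u P : annih B xs u P = anni B xs oder u P.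
Proof. by apply: eq_fsbigr => a _; congr (_ *: _); apply/esym; exact: (@pderE C J). Qed.

Lemma osc_actE x P : osc_act B xs ds rho1 x P = oact B xs ds omul oder rho1 x P.
Proof.
rewrite /osc_act; have -> : nord B xs ds = nordo B xs ds omul oder :> (g -> g -> O -> O); last by [].
apply/funext => u; apply/funext => v; apply/funext => Q.
rewrite /nord; have -> : creat B ds = crea B ds omul.
  by apply/funext => y; apply/funext => R; exact: creatE.
have -> : annih B xs = anni B xs oder.
  by apply/funext => y; apply/funext => R; exact: annihE.
by [].
Qed.

End Instance.

(** * Unitarizability for contragredient superalgebras *)

Section Main.
Variables (C : numClosedFieldType) (n : nat) (A : 'M[C]_n) (p : 'I_n -> bool).
Variables (H : realization A) (g : chevalleyAlg p H).

(** The presented superalgebra is generated by its Chevalley generators and maps onto [g]; preimages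
    of subalgebras are subalgebras. *)
Lemma contragredient_gen : is_contragredient g ->
  smallest (@subalgebra C g) (@generators C n A p H g) = setT.
Proof.
move=> [gt [q [[_ gengt _] [_ qB qH qX qY] qT _ _]]].
apply/seteqP; split=> // x _; have [y _ <-] : range q x by rewrite qT.
have : smallest (@subalgebra C gt)
  (range (emb gt) `|` range (genX gt) `|` range (genY gt)) y by rewrite gengt.
move: y => y Sy U [[sU bU] GU].
apply: (Sy (q @^-1` U)); split.
  split; first split; rewrite /preimage /=.
  - by rewrite linear0; exact: (subspace0 sU).
  - by move=> r u v Uu Uv; rewrite linearP; exact: sU.2.
  by move=> u v Uu Uv /=; rewrite qB; exact: bU.
move=> u /= [[|]|] [i _ <-]; apply: GU.
- by rewrite qH; left; left; exists i.
- by rewrite qX; left; right; exists i.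
by rewrite qY; right; exists i.
Qed.

(** The Cartan subalgebra embeds in the presented superalgebra and meets the kernel of the quotient
    map trivially. *)
Lemma contragredient_emb_inj : is_contragredient g -> injective (emb g).
Proof.
move=> [gt [q [[ei _ _] [_ _ qH _ _] _ [_ kI] _]]] h h' e.
apply: ei; apply/eqP; rewrite -subr_eq0 -linearB; apply/eqP; apply: kI.
split; last by exists (h - h').
by rewrite /preimage /= qH linearB /= e subrr.
Qed.

Variables (B : {biscalar g}) (rho rho0 : 'Hom(H, C^o)) (w : g -> g).
Variables (J : choiceType) (xs ds : J -> g) (M : superModule g) (L : 'Hom(H, C^o)).
Variables (vL : M) (hM : M -> M -> C) (T : lmodType C).
Variable tens : {bilinear M -> osc C J -> T}.

Theorem oscillator_unitarizable :
  is_contragredient g -> standard_form B -> is_weyl_vector rho ->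
  is_kac_peterson g rho0 -> conj_anti_involution w -> consistent w ->
  omega_real w (rho0 - rho) -> is_polarization_basis B xs ds ->
  omega_adapted xs ds w -> contravariant_form w vL hM -> posdef hM ->
  is_tensor tens ->
  exists (a : g -> T -> T) (f : T -> T -> C),
    [/\ forall x v P, par false x ->
          a x (tens v P) =
            tens (act M x v) P + tens v (osc_act B xs ds (rho0 - rho) x P),
        forall v u P Q, f (tens v P) (tens u Q) = hM v u * osc_form P Q
      & even_unitarizable w a f].
Proof.
move=> KM [Bp Bs Binv Bnd _] rhoE KP wA wC wr pol wad [hMh _ hMc] pM tP.
have gen := contragredient_gen KM; have inj := contragredient_emb_inj KM.
have [h0 h0E] := sroot_dual H (fun=> 1).
have Bskew (x y : g) : par true x -> par true y -> B x y = - B y x.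
  by move=> Px Py; rewrite (Bs _ _ _ _ Px Py) mulN1r.
have wp q x : par q x -> par q (w x).
  exact: (anti_par gen h0E inj Binv Bnd wA wC).
have oE : osc_act B xs ds (rho0 - rho) =
    oact B xs ds (@omul C J) (@oder C J) (rho0 - rho).
  by apply/funext => x; apply/funext => P; exact: osc_actE.
rewrite oE.
have rE x y : par false x -> par false y -> ext0 (rho0 - rho) (brk x y) =
    2^-1 * (odd_trace gen h0E x y - odd_trace gen h0E y x).
  by move=> Px Py; exact: kac_peterson_odd.
apply: (tensor_unitarizable (O := oscO C J) tP _ _ _ _ hMh (@osc_hermitian C J) hMc _ pM
  (@osc_span C J) (@osc_orth C J) (@mfact_gt0 C J)).
- exact: wp.
- move=> x Px r P Q.
  exact: (oact_linr gen h0E Bp Bskew Binv pol (@omul C J) (@oder_supp C J) _ r P Q Px).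
- move=> r x y P Px Py.
  exact: (oact_linl gen h0E inj Bp Bskew Binv pol (@omul C J) (@oder_supp C J) _ r P Px Py).
- move=> x y P Px Py.
  exact: (oact_brk Bp Bskew Binv pol (@oder_omul C J) (@oderC C J) (@omulC C J)
    (@oder1 C J) (@ocst1 C J) (@ocst_omul C J) (@oder_eq0 C J) (@oder_supp C J)
    (@omul_ind C J) rE P Px Py).
move=> x P Q Px.
have we y : ext0 (rho0 - rho) y = (ext0 (rho0 - rho) (w y))^*.
  exact: (ext0_anti gen h0E inj wA wC).
exact: (oact_contravariant (O := oscO C J) (mx := @omul C J) (dx := @oder C J)
  (form := @osc_form C J) gen h0E Bp Bskew Binv pol (@oder_supp C J) (@osc_form_linr C J)
  (@osc_form_herm C J) (@osc_form_omul C J) wA wp we wad P Q Px).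
Qed.

End Main.

Local Close Scope classical_set_scope.

Theorem proposition95 (R : realType) (n : nat) (A : 'M[R[i]]_n)
    (p : 'I_n -> bool) (H : realization A) (g : chevalleyAlg p H)
    (B : {biscalar g}) (rho rho0 : 'Hom(H, (R[i])^o))
    (omega : g -> g)
    (J : choiceType) (xs ds : J -> g)
    (M : superModule g) (L : 'Hom(H, (R[i])^o)) (vL : M)
    (hM : M -> M -> R[i])
    (T : lmodType R[i]) (tens : {bilinear M -> osc R[i] J -> T}) :
  is_kac_moody g ->
  symmetrizable A ->
  standard_form B ->
  real_on_simple_roots B ->
  is_weyl_vector rho ->
  is_kac_peterson g rho0 ->
  conj_anti_involution omega ->
  consistent omega ->
  omega_real omega (rho0 - rho) ->
  is_polarization_basis B xs ds ->
  omega_adapted xs ds omega ->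
  highest_weight_module L vL ->
  omega_real omega L ->
  contravariant_form omega vL hM ->
  posdef hM ->
  is_tensor tens ->
  exists (a : g -> T -> T) (f : T -> T -> R[i]),
    [/\ forall x v P, par false x ->
          a x (tens v P) =
            tens (act M x v) P + tens v (osc_act B xs ds (rho0 - rho) x P),
        forall v w P Q, f (tens v P) (tens w Q) = hM v w * osc_form P Q
      & even_unitarizable omega a f].
Proof.
move=> [_ KM _ _ _] _ sB _ rhoE KP wA wC wr pol wad _ _ hMc pM tP.
exact: (oscillator_unitarizable KM sB rhoE KP wA wC wr pol wad hMc pM tP).
Qed.
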